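(* Let $\lambda\ge0$, $\varphi(s)=|1-e^{2\pi is}|^{2\lambda}$, and for a positive integer $l$ let $$ S_l[\varphi](\mu)=\int_{[0,1]^l}\prod_{j=1}^l|1-e^{2\pi i\theta_j}|^{2\lambda}\prod_{1\le k<m\le l}|e^{2\pi i\theta_k}-e^{2\pi i\theta_m}|^{-\mu}\,d\theta_1\cdots d\theta_l . $$ The expansion of the log-moments in $\mu$ near $\mu=0$ is $$ \log S_l[\varphi](\mu)=l\Bigl(\log\Gamma(1+2\lambda)-2\log\Gamma(1+\lambda)\Bigr)+\sum_{p=1}^\infty c_p(l)\,\mu^p, $$ $$ c_p(l)=\frac1{p\,2^p}\Bigl[\bigl(\zeta(p,1+2\lambda)-2\zeta(p,1+\lambda)\bigr)\frac{B_{p+1}(l)-B_{p+1}}{p+1}+\zeta(p)\,\frac{B_{p+1}(l+1)-B_{p+1}}{p+1}-l\,\zeta(p)\Bigr]. $$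
   Context: $B_n(x)$ are the Bernoulli polynomials and $B_n=B_n(0)$. $\zeta(p,a)$ is the Hurwitz zeta function, $\zeta(p,1)=\zeta(p)$, with the convention $\zeta(1,a)=-\psi(a)$ where $\psi=\Gamma'/\Gamma$ (so $\zeta(1)=-\psi(1)$). $S_l[\varphi](\mu)$ is the $l$th moment of the total mass $\int_0^1\varphi(s)\,M_\mu(ds)$ of the Bacry-Muzy Gaussian multiplicative chaos measure on the circle with intermittency $\mu$, finite for $l<2/\mu$. *)

(* Defs.v *)
From HB Require Import structures.
From mathcomp Require Import all_boot all_order all_algebra.
From mathcomp Require Import all_classical all_reals all_analysis.
From mathcomp Require Import complex.

Set Implicit Arguments.
Unset Strict Implicit.
Unset Printing Implicit Defensive.

Import Order.TTheory GRing.Theory Num.Theory.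
Import numFieldNormedType.Exports.

Local Open Scope classical_set_scope.
Local Open Scope ring_scope.

(* The library has the Borel sigma-algebra on [n.-tuple R] but no Lebesgue    *)
(* measure there: it is built from [lebesgue_measure] by iterating the binary *)
(* product along the bijection [R * n.-tuple R -> n.+1.-tuple R].             *)
Section lebesgue_tuple.
Context {R : realType}.
Local Notation T := (measurableTypeR R).

Definition tuple_cons n (x : T * n.-tuple T) : n.+1.-tuple T :=
  [tuple of x.1 :: x.2].

Lemma measurable_tuple_cons n : measurable_fun setT (@tuple_cons n).
Proof. exact: measurable_cons. Qed.

Section lebesgue_cons.
Variables (n : nat) (m : {sigma_finite_measure set (n.-tuple T) -> \bar R}).

Definition lebesgue_cons : set (n.+1.-tuple T) -> \bar R :=
  pushforward (@lebesgue_measure R \x m)%E (@tuple_cons n).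

Let lebesgue_cons_measure : {measure set (n.+1.-tuple T) -> \bar R}.
Proof.
unshelve refine (pushforward (@lebesgue_measure R \x m)%E (@tuple_cons n)
  : {measure set (n.+1.-tuple T) -> \bar R}).
exact: measurable_tuple_cons.
Defined.

HB.instance Definition _ := Measure.copy lebesgue_cons lebesgue_cons_measure.

Let lebesgue_cons_sigma_finite : sigma_finite setT lebesgue_cons.
Proof.
have /sigma_finiteP[F [FT ndF Foo]] := sigma_finiteT (@lebesgue_measure R).
have /sigma_finiteP[G [GT ndG Goo]] := sigma_finiteT m.
pose g (t : n.+1.-tuple T) : T * n.-tuple T := (thead t, [tuple of behead t]).
have mg : measurable_fun setT g.
  apply/measurable_fun_pairP; split; first exact: measurable_tnth.
  exact: measurable_behead.
have gK : g \o @tuple_cons n = id.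
  by apply/funext => -[a t]; congr pair; exact/val_inj.
exists (fun i => g @^-1` (F i `*` G i)).
  apply/esym/seteqP; split=> // t _.
  have : setT (g t).1 by [].
  have : setT (g t).2 by [].
  rewrite FT GT => -[j _ Gj] [i _ Fi].
  exists (maxn i j) => //; split.
    by move: Fi; exact/subsetPset/ndF/leq_maxl.
  by move: Gj; exact/subsetPset/ndG/leq_maxr.
move=> i; have [mF Fi] := Foo i; have [mG Gi] := Goo i; split.
  by rewrite -[X in measurable X]setTI; apply: mg => //; exact: measurableX.
rewrite /lebesgue_cons /pushforward -comp_preimage gK preimage_id.
by rewrite product_measure1E// lte_mul_pinfty// ge0_fin_numE.
Qed.

HB.instance Definition _ := Measure_isSigmaFinite.Build _ _ _ lebesgue_cons
  lebesgue_cons_sigma_finite.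

End lebesgue_cons.
End lebesgue_tuple.

Fixpoint lebesgue_tuple (R : realType) (n : nat) :
    {sigma_finite_measure set (n.-tuple (measurableTypeR R)) -> \bar R} :=
  if n is k.+1 then lebesgue_cons (lebesgue_tuple R k)
  else \d_([tuple]).

Definition unit_cube (R : realType) n : set (n.-tuple (measurableTypeR R)) :=
  [set t | forall j, tnth t j \in `[0, 1]].

Section special_functions.
Context {R : realType}.
Implicit Types (x a : R) (p n : nat).

Definition expi2pi x : R[i] := (cos (2 * pi * x) +i* sin (2 * pi * x))%C.

(* Only meaningful for [0 < x], where the integral converges. *)
Definition Gamma x : R :=
  \int[@lebesgue_measure R]_(t in `]0, +oo[) (t `^ (x - 1) * expR (- t)).

Definition digamma x : R := derive1 Gamma x / Gamma x.

(* The series diverges at [p = 1]; there [- digamma a] is the constant term   *)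
(* of the Laurent expansion of the Hurwitz zeta function at its pole.         *)
Definition hurwitz_zeta p a : R :=
  if p == 1%N then - digamma a
  else limn (series (fun n => (n%:R + a) ^- p)).

(* [:: B_0; ...; B_n], from \sum_(k <= m) 'C(m + 1, k) B_k = 0 for [0 < m]    *)
(* (so that B_1 = - 1 / 2).                                                   *)
Fixpoint bernoulli_upto n : seq R :=
  if n is m.+1 then
    let s := bernoulli_upto m in
    rcons s (- (\sum_(k < m.+1) 'C(m.+2, k)%:R * s`_k) / m.+2%:R)
  else [:: 1].

Definition bernoulli_number n : R := (bernoulli_upto n)`_n.

Definition bernoulli_poly n : {poly R} :=
  \poly_(k < n.+1) ('C(n, k)%:R * bernoulli_number (n - k)).

End special_functions.

(* Extended-real valued, so that a divergent integral is not confused with 0. *)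
Definition circle_moment (R : realType) (phi : R -> R) (l : nat) (mu : R) :
    \bar R :=
  (\int[lebesgue_tuple R l]_(t in @unit_cube R l)
    ((\prod_(j < l) phi (tnth t j)) *
     \prod_(k < l) \prod_(m < l | (k < m)%N)
       Normc.normc (expi2pi (tnth t k) - expi2pi (tnth t m)) `^ (- mu))%:E)%E.

Definition log_moment_coef (R : realType) (lambda : R) (l p : nat) : R :=
  let B n x := (bernoulli_poly n).[x] in
  (p%:R * 2 ^+ p)^-1 *
  ((hurwitz_zeta p (1 + 2 * lambda) - 2 * hurwitz_zeta p (1 + lambda)) *
     ((B p.+1 l%:R - B p.+1 0) / p.+1%:R) +
   hurwitz_zeta p 1 * ((B p.+1 l.+1%:R - B p.+1 0) / p.+1%:R) -
   l%:R * hurwitz_zeta p 1).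

(* Main.v *)
(** With [U x = |1 - e^(2 pi i x)|^2] the moment is the Morris integral
      M_l(lambda, k) = int prod_j U(t_j)^lambda prod_(i<j) U(t_i - t_j)^k
    at [k = - mu / 2].  Aomoto's method (integrate by parts in one coordinate
    an integrand in which part of the factors is modified, then antisymmetrise)
    gives
      M_l(lambda + 1, k) / M_l(lambda, k) =
        prod_(j<l) (1 + 2 lambda + j k) (2 + 2 lambda + j k) / (1 + lambda + j k)^2.
    As [M_l] is log-convex in [lambda], the argument of Bohr and Mollerup turns
    this recursion into
      M_l(lambda, k) = M_l(0, k) prod_(j<l) G(lambda, j) / G(0, j),
      G(lambda, j) = Gamma(1 + 2 lambda + j k) / Gamma(1 + lambda + j k)^2.
    Rotating the circle gives [M_(l+1)(0, k) = M_l(k, k)], so that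
    [M_l(0, k) = Gamma(1 + l k) / Gamma(1 + k)^l] by induction on [l].  The
    expansion follows from the Taylor series of [ln Gamma], whose coefficients
    are Hurwitz zeta values, and from [sum_(j<l) j^p], given by [B_(p+1)]. *)

(* For [mu > 0] the exponent [k = - mu / 2] is negative: the weight blows up where points meet, and
   integrating by parts makes the singularities worse. Two devices deal with this. Every squared
   chord [U] is replaced by [U + e] with [e > 0] during the integration by parts, and dominated
   convergence returns to [e = 0]. Domination is paid from a budget [d]: all exponents are at least
   [- d], and [4 * d * (n + n * n) <= 1]. This is crude, but the claim concerns a neighbourhood of
   [mu = 0] that may depend on [l]. The budget also admits a slightly negative [lambda], which the
   rotation requires, as it sets [lambda = k]. Passing from [lambda] to [lambda + 1] multiplies the
   integrand by the product of the [U]. It is split as [1 -> z -> U] with [z = 1 - e^(2 pi i x)],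
   because each half, done one coordinate at a time, gives a two-term relation. On the side of
   [Gamma], log-convexity and the functional equation give Gauss's limit and from it the Taylor
   bounds; [digamma] is identified last, as the linear coefficient. *)
From HB Require Import structures.
Require Import Defs.
From mathcomp Require Import all_boot all_order fingroup perm all_algebra.
From mathcomp Require Import all_classical all_reals all_analysis.
From mathcomp Require Import complex measurable_realfun.
From mathcomp Require Import ring lra zify.

Set Implicit Arguments.
Unset Strict Implicit.
Unset Printing Implicit Defensive.

Import Order.TTheory GRing.Theory Num.Theory.
Import numFieldNormedType.Exports.

Local Open Scope classical_set_scope.
Local Open Scope ring_scope.

(** * Power sums *)

Section bernoulli.
Context {R : realType}.
Implicit Types (n m k : nat) (x : R).

Lemma size_bernoulli_upto n : size (@bernoulli_upto R n) = n.+1.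
Proof. by elim: n => //= n IHn; rewrite size_rcons IHn. Qed.

Lemma nth_bernoulli_upto n k : (k <= n)%N ->
  (@bernoulli_upto R n)`_k = bernoulli_number k.
Proof.
elim: n => [|n IHn]; first by rewrite leqn0 => /eqP ->.
rewrite leq_eqVlt => /predU1P[-> //|]; rewrite ltnS => kn.
by rewrite /= nth_rcons size_bernoulli_upto ltnS kn IHn.
Qed.

Lemma bernoulli_numberS n : (@bernoulli_number R n.+1) =
  - (\sum_(k < n.+1) 'C(n.+2, k)%:R * bernoulli_number k) / n.+2%:R.
Proof.
rewrite {1}/bernoulli_number /= nth_rcons size_bernoulli_upto ltnn eqxx.
congr (- _ / _); apply: eq_bigr => k _.
by rewrite nth_bernoulli_upto// -ltnS.
Qed.

(** This is [B_n(1) - B_n(0)]: the defining recursion of the Bernoulli numbers makes it vanish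
    except at [n = 1]. *)
Lemma sum_bin_bernoulli n :
  \sum_(k < n) 'C(n, k)%:R * @bernoulli_number R k = (n == 1%N)%:R.
Proof.
case: n => [|[|n]]; first by rewrite big_ord0.
  by rewrite big_ord1 bin0 mul1r.
rewrite big_ord_recr /= binSn bernoulli_numberS mulrC divfK ?pnatr_eq0//.
by rewrite subrr.
Qed.

(** Both sides are the multinomial coefficient [n! / (i! j! (n - i - j)!)]; multiplying by its
    denominator leaves four instances of [bin_fact]. *)
Lemma mul_bin_bin_sub n i j : (i + j <= n)%N ->
  ('C(n, i) * 'C(n - i, j) = 'C(n, j) * 'C(n - j, i))%N.
Proof.
move=> ijn; have e : (n - i - j)`! = (n - j - i)`! by congr (_`!); lia.
have f : (0 < i`! * j`! * (n - i - j)`!)%N by rewrite !muln_gt0 !fact_gt0.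
apply/eqP; rewrite -(eqn_pmul2r f); apply/eqP.
have /bin_fact i_n : (i <= n)%N by lia.
have /bin_fact j_n : (j <= n)%N by lia.
have /bin_fact j_ni : (j <= n - i)%N by lia.
have /bin_fact i_nj : (i <= n - j)%N by lia.
transitivity n`!.
  by rewrite -i_n -j_ni; ring.
by rewrite -j_n -i_nj e; ring.
Qed.

Lemma horner_bernoulli_poly n x : (bernoulli_poly n).[x] =
  \sum_(i < n.+1) 'C(n, i)%:R * bernoulli_number i * x ^+ (n - i).
Proof.
rewrite /bernoulli_poly horner_poly (reindex_inj rev_ord_inj) /=.
apply: eq_bigr => i _; rewrite subSS subKn; last by rewrite -ltnS.
by rewrite bin_sub// -ltnS.
Qed.

(** After expanding [(x + 1) ^+ (n - i)] and exchanging the sums, the coefficient of [x ^+ j] is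
    ['C(n, j)] times [B_(n-j)(1)]. This differs from [B_(n-j)] only for [j = n - 1], and that one
    term is [n * x ^+ n.-1]. *)
Lemma bernoulli_poly_add1 n x : (bernoulli_poly n).[x + 1] =
  (bernoulli_poly n).[x] + n%:R * x ^+ n.-1.
Proof.
rewrite !horner_bernoulli_poly.
transitivity (\sum_(i < n.+1) \sum_(j < n.+1 | (i + j <= n)%N)
   ('C(n, j)%:R * x ^+ j) * ('C(n - j, i)%:R * @bernoulli_number R i)).
  apply: eq_bigr => i _; rewrite addrC exprDn mulr_sumr.
  rewrite (@big_ord_widen_cond _ _ _ (n - i).+1 n.+1 xpredT (fun j =>
    'C(n, i)%:R * bernoulli_number i *
    (1 ^+ (n - i - j) * x ^+ j *+ 'C(n - i, j)))); last by lia.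
  apply: eq_big => [j|j ij]; first by move: (ltn_ord i); lia.
  have ij' : (i + j <= n)%N by move: ij (ltn_ord i); lia.
  have := mul_bin_bin_sub ij' => /(congr1 (fun z : nat => z%:R : R)).
  rewrite !natrM expr1n -mulr_natr mul1r => e.
  transitivity ('C(n, i)%:R * 'C(n - i, j)%:R * (bernoulli_number i * x ^+ j)).
    by rewrite /bernoulli_number; ring.
  by rewrite e /bernoulli_number; ring.
rewrite (exchange_big_dep xpredT)//=.
transitivity (\sum_(j < n.+1) 'C(n, j)%:R * x ^+ j *
    (bernoulli_number (n - j) + (n - j == 1)%N%:R)).
  apply: eq_bigr => j _; rewrite -mulr_sumr; congr (_ * _).
  transitivity (\sum_(i < (n - j).+1) 'C(n - j, i)%:R * @bernoulli_number R i).
    rewrite (@big_ord_widen _ _ _ (n - j).+1 n.+1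
      (fun i => 'C(n - j, i)%:R * bernoulli_number i)); last by lia.
    by apply: eq_bigl => i; move: (ltn_ord j); lia.
  by rewrite big_ord_recr /= sum_bin_bernoulli binn mul1r addrC.
rewrite (eq_bigr _ (fun j _ => mulrDr _ _ _)).
rewrite big_split /=; congr (_ + _).
  rewrite (reindex_inj rev_ord_inj) /=; apply: eq_bigr => i _.
  have il : (i <= n)%N by rewrite -ltnS.
  by rewrite subSS (subKn il) (bin_sub il) mulrAC.
case: n => [|n]; first by rewrite big_ord1 mulr0 mul0r.
rewrite (bigD1 (inord n : 'I_n.+2)) //= inordK// subSnn eqxx mulr1 big1.
  by rewrite addr0 binSn.
move=> i; rewrite -val_eqE /= inordK// => ne.
by case: eqP => [|_]; [move: (ltn_ord i) ne; lia|rewrite mulr0].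
Qed.

Lemma bernoulli_poly_sum n m :
  ((bernoulli_poly n.+1).[m%:R] - (bernoulli_poly n.+1).[0]) / n.+1%:R =
  \sum_(j < m) (j%:R : R) ^+ n.
Proof.
elim: m => [|m IHm]; first by rewrite subrr mul0r big_ord0.
rewrite big_ord_recr /= -IHm -natr1 bernoulli_poly_add1.
by rewrite addrAC mulrDl mulrAC mulfV ?pnatr_eq0// mul1r.
Qed.
End bernoulli.

Lemma cvg_rsum {R : realType} {T I : Type} (F : set_system T) (FF : Filter F)
    (r : seq I) (P : pred I) (f : I -> T -> R) (l : I -> R) :
  (forall i, P i -> f i x @[x --> F] --> l i) ->
  \sum_(i <- r | P i) f i x @[x --> F] --> \sum_(i <- r | P i) l i.
Proof.
move=> fl; elim: r => [|i r IHr].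
  rewrite big_nil (_ : (fun _ => _) = cst 0); first exact: cvg_cst.
  by apply/funext => x; rewrite big_nil.
rewrite big_cons (_ : (fun _ => _) = (fun x => if P i then
  f i x + \sum_(j <- r | P j) f j x else \sum_(j <- r | P j) f j x)).
  by case: ifPn => // Pi; apply: cvgD => //; exact: fl.
by apply/funext => x; rewrite big_cons.
Qed.

(** * Taylor bounds for sums of logarithms, with Hurwitz zeta coefficients *)

Section log_series.
Context {R : realType}.
Implicit Types (a x y c : R) (n m p P : nat).

Lemma is_derive_log_partial y P :
  is_derive y 1 (fun z : R => \sum_(i < P) (- z) ^+ i.+1 / i.+1%:R)
    (- \sum_(i < P) (- y) ^+ i).
Proof.
elim: P => [|P IHP].
  rewrite big_ord0 oppr0 (_ : (fun _ => _) = cst 0); first exact: is_derive_cst.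
  by apply/funext => z; rewrite big_ord0.
rewrite (_ : (fun _ => _) = (fun z : R => \sum_(i < P) (- z) ^+ i.+1 / i.+1%:R)
   + (fun z : R => (P.+1%:R^-1 : R) *: (- z) ^+ P.+1)); last first.
  by apply/funext => z; rewrite big_ord_recr /=; congr (_ + _); exact: mulrC.
have IH := IHP.
have D : is_derive y 1 (fun z : R => (P.+1%:R^-1 : R) *: (- z) ^+ P.+1) (- (- y) ^+ P).
  have -> : (fun z : R => (P.+1%:R^-1 : R) *: (- z) ^+ P.+1) =
    P.+1%:R^-1 *: (- (@id R)) ^+ P.+1.
    by apply/funext => z; rewrite fctE /= exprfctE.
  apply: is_derive_eq.
  rewrite /GRing.scale /= mulrA mulrA mulVf ?pnatr_eq0//; lra.
by rewrite big_ord_recr /= opprD; apply: is_deriveD.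
Qed.

(** The difference [h] has derivative [(- z) ^+ P / (1 + z)], since the partial sums differentiate
    to a geometric sum. For [|z| <= 1 / 2] the denominator is at least [1 / 2], hence the factor 2;
    the mean value theorem gives one more power of [|y|]. *)
Lemma ln_taylor_bound y P : `|y| <= 2^-1 ->
  `|ln (1 + y) + \sum_(i < P) (- y) ^+ i.+1 / i.+1%:R| <= 2 * `|y| ^+ P.+1.
Proof.
move=> y2.
pose h (z : R) := ln (1 + z) + \sum_(i < P) (- z) ^+ i.+1 / i.+1%:R.
pose dh (z : R) := (1 + z)^-1 - \sum_(i < P) (- z) ^+ i.
have dhE (z : R) : `|z| <= 2^-1 -> is_derive z 1 h (dh z).
  rewrite ler_norml => /andP[z1 z2].
  have z0 : 0 < 1 + z by lra.
  have dln : is_derive z 1 (fun z : R => ln (1 + z)) (1 + z)^-1.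
    have dz : is_derive z 1 (fun z : R => 1 + z) 1.
      have -> : (fun z : R => 1 + z) = cst 1 + @id R by [].
      by apply: is_derive_eq; rewrite add0r.
    have := @is_derive1_comp _ (@ln R) (fun z : R => 1 + z) z _ _ (is_derive1_ln z0) dz.
    by rewrite mulr1.
  by apply: is_deriveD; exact: is_derive_log_partial.
have dh_bound (z : R) : `|z| <= `|y| -> `|dh z| <= 2 * `|y| ^+ P.
  move=> zy; have := le_trans zy y2; rewrite ler_norml => /andP[z1 z2].
  have z0 : 0 < 1 + z by lra.
  have -> : dh z = (- z) ^+ P / (1 + z).
    have := subrX1 (- z) P => e.
    rewrite /dh; apply: (mulIf (lt0r_neq0 z0)).
    rewrite mulrBl mulVf ?gt_eqF// divfK ?gt_eqF//.
    have -> : (- z) ^+ P = 1 + (- z - 1) * \sum_(i < P) (- z) ^+ i.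
      by rewrite -e addrC subrK.
    ring.
  rewrite normrM normrX normrN mulrC.
  apply: ler_pM => //; last by rewrite lerXn2r// nnegrE.
  rewrite normfV gtr0_norm// -[leRHS]invrK lef_pV2 ?posrE//; first lra.
have h0 : h 0 = 0.
  by rewrite /h addr0 ln1 add0r big1// => i _; rewrite oppr0 expr0n mul0r.
have [e|y0] := eqVneq y 0.
  by move: h0; rewrite /h e => ->; rewrite !normr0 exprS mul0r mulr0.
(* Stated for an arbitrary increasing pair, so that it serves both [0 < y] and [y < 0]. *)
have key (u v : R) : u < v -> `|u| <= `|y| -> `|v| <= `|y| -> `|h v - h u| <= 2 * `|y| ^+ P * (v - u).
  move=> uv uy vy.
  have zy z : u <= z -> z <= v -> `|z| <= `|y|.
    move=> uz zv; move: uy vy; rewrite !ler_norml => /andP[? ?] /andP[? ?].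
    by apply/andP; split; lra.
  have [z /[!in_itv]/= /andP[uz zv] ->] : exists2 z, z \in `]u, v[ & h v - h u = dh z * (v - u).
    apply: MVT => //.
      move=> z /[!in_itv]/= /andP[/ltW uz /ltW zv]; apply: dhE.
      exact: le_trans (zy _ uz zv) y2.
    apply: derivable_within_continuous => z /[!in_itv]/= /andP[uz zv].
    apply: ex_derive; apply: dhE.
    exact: le_trans (zy _ uz zv) y2.
  have vu : 0 < v - u by rewrite subr_gt0.
  rewrite normrM (gtr0_norm vu); apply: ler_wpM2r; first exact: ltW.
  by apply: dh_bound; apply: zy; exact: ltW.
rewrite -/(h y) exprSr mulrA.
have [y_gt0|y_lt0|] := ltgtP 0 y; last by move/eqP; rewrite eq_sym (negbTE y0).
  have := key 0 y y_gt0; rewrite h0 !subr0 normr0 (gtr0_norm y_gt0); apply => //; exact: ltW.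
have := key y 0 y_lt0; rewrite h0 !sub0r normrN normr0 (ltr0_norm y_lt0); apply => //; lra.
Qed.

(** Comparison with the sum of [1 / (m + 1)^2], whose partial sums are at most [2 - 1 / n] by
    telescoping. The bound is uniform in [a] and [p], as the remainder estimates require. *)
Lemma hurwitz_series_le a p n : 1 <= a -> (2 <= p)%N ->
  series (fun m => (m%:R + a) ^- p) n <= 2.
Proof.
move=> a1 p2; rewrite /series/=.
have term m : (m%:R + a) ^- p <= (m.+1%:R : R) ^- 2.
  have m1 : (1 : R) <= m.+1%:R by rewrite ler1n.
  rewrite lef_pV2 ?posrE ?exprn_gt0 ?ltr_wpDl//; last by lra.
  apply: (@le_trans _ _ (m.+1%:R ^+ p)); first exact: ler_weXn2l.
  by apply: lerXn2r; rewrite ?nnegrE// -?natr1; lra.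
case: n => [|n]; first by rewrite big_geq.
suff : \sum_(0 <= k < n.+1) (k%:R + a) ^- p <= 2 - n.+1%:R^-1.
  by move/le_trans; apply; rewrite lerBlDr lerDl invr_ge0.
elim: n => [|n IHn].
  by rewrite big_nat1 (le_trans (term 0))// expr1n invr1; lra.
rewrite big_nat_recr//= (le_trans (lerD IHn (term n.+1)))//.
have e1 : (0 : R) < n.+1%:R by rewrite ltr0n.
rewrite -[n.+2%:R]natr1; move: (n.+1%:R : R) e1 => z z0.
have -> : 2 - z^-1 + (z + 1) ^- 2 = 2 - (z + 1)^-1 - (z * (z + 1) ^+ 2)^-1.
  by field; rewrite !gt_eqF//; lra.
by rewrite lerBlDr lerDl invr_ge0 mulr_ge0 ?sqr_ge0// ltW.
Qed.

Lemma cvg_hurwitz_series a p : 1 <= a -> (2 <= p)%N ->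
  series (fun m => (m%:R + a) ^- p) n @[n --> \oo] --> hurwitz_zeta p a.
Proof.
move=> a1 p2; rewrite /hurwitz_zeta gtn_eqF//.
apply: nondecreasing_is_cvgn.
  apply/nondecreasing_seqP => n; rewrite /series/= big_nat_recr//= lerDl.
  by rewrite invr_ge0 exprn_ge0// addr_ge0// (le_trans ler01).
by exists 2 => _ [n _ <-]; exact: hurwitz_series_le.
Qed.

(** Removing the linear term leaves exponents at least 2, where the Hurwitz series converge. Each
    summand obeys [ln_taylor_bound] at [x / (m + a)], and the inverse powers of [m + a] sum to at
    most 2: hence [4 = 2 * 2], uniformly in [n]. *)
Lemma log_tail_bound a x n P : 1 <= a -> `|x| <= 2^-1 ->
  `|\sum_(0 <= m < n) (x / (m%:R + a) - ln (1 + x / (m%:R + a)))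
    - \sum_(i < P) (- x) ^+ i.+2 / i.+2%:R *
        series (fun m => (m%:R + a) ^- i.+2) n| <= 4 * `|x| ^+ P.+2.
Proof.
move=> a1 x2.
have am m : 1 <= m%:R + a by rewrite ler_wpDl.
have am0 m : 0 < m%:R + a by rewrite (lt_le_trans ltr01).
rewrite (_ : \sum_(i < P) _ = \sum_(0 <= m < n) \sum_(i < P)
    (- (x / (m%:R + a))) ^+ i.+2 / i.+2%:R); last first.
  rewrite exchange_big/=; apply: eq_bigr => i _; rewrite /series/= mulr_sumr.
  apply: eq_bigr => m _; rewrite -mulNr expr_div_n.
  by rewrite mulrAC.
rewrite -sumrB (le_trans (ler_norm_sum _ _ _))//.
apply: (@le_trans _ _ (\sum_(0 <= m < n) 2 * `|x| ^+ P.+2 * (m%:R + a) ^- P.+2)).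
  apply: ler_sum => m _.
  have y2 : `|x / (m%:R + a)| <= 2^-1.
    rewrite normrM normfV (gtr0_norm (am0 m)) ler_pdivrMr//.
    by rewrite (le_trans x2)// ler_peMr// invr_ge0.
  have := ln_taylor_bound P.+1 y2.
  rewrite big_ord_recl /= expr1 divr1 -[X in X <= _]normrN => /le_trans le.
  rewrite [leLHS](_ : _ = `|- (ln (1 + x / (m%:R + a)) + (- (x / (m%:R + a)) +
      \sum_(i < P) (- (x / (m%:R + a))) ^+ i.+2 / i.+2%:R))|).
    rewrite -mulrA -exprVn -[X in 2 * (_ * X)]gtr0_norm ?exprn_gt0 ?invr_gt0//.
    rewrite normrX -exprMn -normrM.
    exact: le.
  by congr (`| _ |); ring.
rewrite -mulr_sumr (_ : 4 = 2 * 2); last by ring.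
rewrite mulrAC [leLHS](_ : _ = 2 * (\sum_(0 <= m < n) (m%:R + a) ^- P.+2) * `|x| ^+ P.+2); last by ring.
apply: ler_wpM2r; first exact: exprn_ge0.
by apply: ler_wpM2l => //; exact: hurwitz_series_le.
Qed.

(* [v x] stands for [ln (Gamma (a + x)) - ln (Gamma a)], given by Gauss's limit   *)
(* formula; the constant [c] is the digamma value, not yet identified.            *)
Lemma gauss_limit_taylor a (v : R -> R) : 1 <= a ->
  (forall x, `|x| <= 2^-1 ->
    (x * ln n%:R - \sum_(0 <= m < n) ln (1 + x / (m%:R + a))) @[n --> \oo]
      --> v x) ->
  exists c, forall P x, `|x| <= 2^-1 ->
    `|v x - c * x - \sum_(i < P) (- x) ^+ i.+2 / i.+2%:R * hurwitz_zeta i.+2 a|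
      <= 4 * `|x| ^+ P.+2.
Proof.
move=> a1 vlim.
pose D x n : R := \sum_(0 <= m < n) (x / (m%:R + a) - ln (1 + x / (m%:R + a))).
pose h n : R := ln n%:R - \sum_(0 <= m < n) (m%:R + a)^-1.
have split_ x n : x * ln n%:R - \sum_(0 <= m < n) ln (1 + x / (m%:R + a)) =
    x * h n + D x n.
  rewrite /D /h sumrB mulrBr [in RHS]mulr_sumr; ring.
have half : `|2^-1 : R| <= 2^-1 by rewrite ger0_norm.
have am0 m : 0 < m%:R + a by rewrite ltr_wpDl// (lt_le_trans ltr01).
have Dcvg : cvgn (D 2^-1).
  apply: nondecreasing_is_cvgn.
    apply/nondecreasing_seqP => n; rewrite /D big_nat_recr//= lerDl subr_ge0.
    apply: le_ln1Dx; apply: (@lt_trans _ _ 0); first by rewrite ltrN10.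
    by rewrite divr_gt0.
  exists (4 * `|2^-1| ^+ 2) => _ [n _ <-].
  have := @log_tail_bound a 2^-1 n 0 a1 half.
  by rewrite big_ord0 subr0; apply: le_trans; exact: ler_norm.
(* The coefficient [h n] of [x] converges because the single value [x = 1 / 2] suffices: there both
   the Gauss expression and the monotone bounded [D] converge. Its limit is the constant [c]. *)
have hcvg : h n @[n --> \oo] --> 2 * (v 2^-1 - limn (D 2^-1)).
  rewrite (_ : (fun n => h n) = (fun n => 2 * (2^-1 * ln n%:R -
      \sum_(0 <= m < n) ln (1 + 2^-1 / (m%:R + a)) - D 2^-1 n))); last first.
    by apply/funext => n; rewrite split_ addrK mulrA mulfV// mul1r.
  by apply: cvgMr; apply: cvgB => //; exact: vlim.
exists (2 * (v 2^-1 - limn (D 2^-1))); set c := 2 * _ => P x x2.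
have lim : `|x * h n + D x n - x * h n -
    \sum_(i < P) (- x) ^+ i.+2 / i.+2%:R * series (fun m => (m%:R + a) ^- i.+2) n|
    @[n --> \oo] --> `|v x - c * x -
    \sum_(i < P) (- x) ^+ i.+2 / i.+2%:R * hurwitz_zeta i.+2 a|.
  apply: cvg_norm; apply: cvgB.
    apply: cvgB; last by rewrite mulrC; apply: cvgMr.
    by under eq_fun do rewrite -split_; exact: vlim.
  apply: cvg_rsum => i _; apply: cvgMr; exact: cvg_hurwitz_series.
rewrite -(cvg_lim (@Rhausdorff R) lim).
apply: limr_le; first by apply/cvg_ex; eexists; exact: lim.
by apply: nearW => n; rewrite [x * h n + _]addrC addrK; exact: log_tail_bound.
Qed.

End log_series.

(** * Strict positivity and log-convexity of integrals *)

Section integral_lemmas.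
Context d (T : measurableType d) {R : realType}.
Variable mu : {measure set T -> \bar R}.
Implicit Types (D : set T) (f : T -> R).

Lemma integral_gt0 D f : measurable D -> measurable_fun D f ->
  (forall x, D x -> 0 <= f x) -> {ae mu, forall x, D x -> f x != 0} ->
  (0 < mu D)%E -> (0 < \int[mu]_(x in D) (f x)%:E)%E.
Proof.
move=> mD mf f0 fne D0.
have i0 : (0 <= \int[mu]_(x in D) (f x)%:E)%E.
  by apply: integral_ge0 => x Dx; rewrite lee_fin f0.
rewrite lt_neqAle i0 andbT eq_sym; apply/eqP => i0'.
have : ae_eq mu D (EFin \o f) (cst 0%E).
  apply/ae_eq_integral_abs => //; first exact/measurable_EFinP.
  rewrite -[RHS]i0'; apply: eq_integral => x /set_mem Dx /=.
  by rewrite ger0_norm// f0.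
move=> f_0; suff : mu.-negligible D.
  by move/(measure_negligible mD) => muD0; rewrite muD0 ltxx in D0.
have : {ae mu, forall x, ~ D x}.
  apply: filterS2 fne f_0 => x fx fx0 Dx.
  by have := fx Dx; have /= [->] := fx0 Dx; rewrite eqxx.
by rewrite /almost_everywhere; apply: negligibleS => x /= Dx; apply: contrapT => nn; apply: nn => ?.
Qed.

(* Hoelder's inequality for [phi b = phi a ^ s * phi c ^ (1 - s)], in the form of *)
(* the chord inequality that a convex function satisfies.                         *)
Lemma log_convex_integral D (phi : R -> T -> R) (M : R -> R) (a b c : R) :
  measurable D -> (forall y : R, a <= y -> measurable_fun D (phi y)) ->
  (forall (y : R) x, D x -> 0 <= phi y x) ->
  (forall (s y z : R) x, 0 < s < 1 -> a <= y -> a <= z -> D x ->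
    phi (s * y + (1 - s) * z) x = phi y x `^ s * phi z x `^ (1 - s)) ->
  (forall y : R, a <= y -> 0 < M y) ->
  (forall y : R, a <= y -> (\int[mu]_(x in D) (phi y x)%:E = (M y)%:E)%E) ->
  a < b -> b < c ->
  (c - a) * ln (M b) <= (c - b) * ln (M a) + (b - a) * ln (M c).
Proof.
move=> mD mphi phi0 phiM M0 MI ab bc.
have ca : 0 < c - a by lra.
pose s := (c - b) / (c - a).
have s1E : 1 - s = (b - a) / (c - a) by rewrite /s; field; rewrite gt_eqF.
have s0 : 0 < s by rewrite divr_gt0// subr_gt0.
have s1 : 0 < 1 - s by rewrite s1E divr_gt0// subr_gt0.
have bE : b = s * a + (1 - s) * c by rewrite s1E /s; field; rewrite gt_eqF.
have ac : a <= c by lra.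
have Ma0 := M0 a (lexx _); have Mc0 := M0 c ac; have Mb0 := M0 b (ltW ab).
pose N := M a `^ s * M c `^ (1 - s).
have N0 : 0 < N by rewrite mulr_gt0// powR_gt0.
(* Young's inequality for the normalised values [phi a / M a] and [phi c / M c]. Each has integral
   1, so the right side integrates to exactly [N]. *)
have young x : D x -> phi b x <= N * (s / M a * phi a x + (1 - s) / M c * phi c x).
  move=> Dx; rewrite {1}bE phiM//; last by rewrite s0 -subr_gt0.
  have fa := phi0 a x Dx; have fc := phi0 c x Dx.
  have da : 0 <= phi a x / M a := divr_ge0 fa (ltW Ma0).
  have dc : 0 <= phi c x / M c := divr_ge0 fc (ltW Mc0).
  have -> : phi a x `^ s = M a `^ s * (phi a x / M a) `^ s.
    by rewrite -(powRM _ (ltW Ma0) da) mulrCA (mulfV (lt0r_neq0 Ma0)) mulr1.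
  have -> : phi c x `^ (1 - s) = M c `^ (1 - s) * (phi c x / M c) `^ (1 - s).
    by rewrite -(powRM _ (ltW Mc0) dc) mulrCA (mulfV (lt0r_neq0 Mc0)) mulr1.
  rewrite mulrACA; apply: ler_wpM2l; first exact: ltW.
  have := @conjugate_powR R ((phi a x / M a) `^ s) ((phi c x / M c) `^ (1 - s))
    s^-1 (1 - s)^-1 (powR_ge0 _ _) (powR_ge0 _ _).
  rewrite !invr_gt0 !invrK => /(_ s0 s1) H.
  apply: le_trans (H (_ : s + (1 - s) = 1)) _; first by rewrite addrC subrK.
  rewrite -!powRrM (mulfV (lt0r_neq0 s0)) (mulfV (lt0r_neq0 s1)).
  rewrite (powRr1 da) (powRr1 dc) mulrAC.
  rewrite [leRHS](_ : _ = phi a x * s / M a + phi c x / M c * (1 - s)) //; ring.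
have : M b <= N.
  rewrite -lee_fin -MI; last exact: ltW.
  apply: (@le_trans _ _ (\int[mu]_(x in D)
     (N * (s / M a * phi a x + (1 - s) / M c * phi c x))%:E)%E).
    apply: ge0_le_integral => //.
    - by move=> x Dx; rewrite lee_fin phi0.
    - by apply/measurable_EFinP; apply: mphi; exact: ltW.
    - apply/measurable_EFinP; apply: measurable_funM => //.
      by apply: measurable_funD; apply: measurable_funM => //; exact: mphi.
  under eq_integral do rewrite EFinM EFinD.
  rewrite ge0_integralZl//; last 3 first.
  - apply/measurable_EFinP.
    by apply: measurable_funD; apply: measurable_funM => //; exact: mphi.
  - move=> x Dx; rewrite -EFinD lee_fin addr_ge0// mulr_ge0 ?phi0//.
      by rewrite divr_ge0// ltW.
    by rewrite divr_ge0// ltW.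
  - by rewrite lee_fin ltW.
  rewrite ge0_integralD//; last 4 first.
  - by move=> x Dx; rewrite lee_fin mulr_ge0 ?phi0// divr_ge0// ltW.
  - by apply/measurable_EFinP; apply: measurable_funM => //; exact: mphi.
  - by move=> x Dx; rewrite lee_fin mulr_ge0 ?phi0// divr_ge0// ltW.
  - by apply/measurable_EFinP; apply: measurable_funM => //; exact: mphi.
  under eq_integral do rewrite EFinM.
  under [X in (_ * (_ + X) <= _)%E]eq_integral do rewrite EFinM.
  rewrite !ge0_integralZl//; last 6 first.
  - by apply/measurable_EFinP; exact: mphi.
  - by move=> x Dx; rewrite lee_fin phi0.
  - by rewrite lee_fin divr_ge0// ltW.
  - by apply/measurable_EFinP; exact: mphi.
  - by move=> x Dx; rewrite lee_fin phi0.
  - by rewrite lee_fin divr_ge0// ltW.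
  rewrite !MI// -!EFinM.
  by rewrite !divfK ?gt_eqF// addrC subrK mulr1.
rewrite -ler_ln ?posrE// lnM ?posrE ?powR_gt0// !ln_powR => H.
have -> : c - b = s * (c - a) by rewrite /s divfK// gt_eqF.
have -> : b - a = (1 - s) * (c - a) by rewrite s1E divfK// gt_eqF.
apply: le_trans (ler_wpM2l (ltW ca) H) _.
by rewrite le_eqVlt; apply/orP; left; apply/eqP; ring.
Qed.
End integral_lemmas.

(** The slope of a convex function over [[y, y + x]] lies between those over the adjacent unit
    intervals. Unit length matters: increments over such intervals are what a functional equation
    supplies. *)
Lemma chord_slopes {R : realType} (H : R -> R) (y0 y x : R) :
  (forall a b c : R, y0 <= a -> a < b -> b < c ->
    (c - a) * H b <= (c - b) * H a + (b - a) * H c) ->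
  y0 <= y - 1 -> 0 < x ->
  x * (H y - H (y - 1)) <= H (y + x) - H y <= x * (H (y + x + 1) - H (y + x)).
Proof.
move=> chord y1 x0; apply/andP; split.
  have := chord (y - 1) y (y + x) y1; rewrite ltrBlDr !ltrDl ltr01 x0 => /(_ isT isT); nra.
have := chord y (y + x) (y + x + 1).
rewrite !ltrDl x0 ltr01 => /(_ _ isT isT) H'.
have {}/H' : y0 <= y by lra.
nra.
Qed.

(** * The Gamma function *)

Section gamma.
Context {R : realType}.
Implicit Types (x y a b t : R).
Notation leb := (@lebesgue_measure R).

Let gint x t : R := t `^ (x - 1) * expR (- t).

Lemma measurable_gamma_integrand (D : set R) x : measurable_fun D (gint x).
Proof.
apply: measurable_funS measurableT (@subsetT _ _) _.
apply: measurable_funM; first exact: measurable_powR.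
exact: measurableT_comp (@measurable_expR R) (measurableT_comp (@oppr_measurable R _) _).
Qed.

Lemma is_derive_expRN t : is_derive t 1 (fun t : R => - expR (- t)) (expR (- t)).
Proof.
have D : is_derive t 1 (fun t : R => expR (- t)) (- expR (- t)).
  have := @is_derive1_comp _ (@expR R) (fun t : R => - t) t (expR (- t)) (- 1).
  rewrite mulrN1.
  by apply.
have -> : (fun t : R => - expR (- t)) = - (fun t : R => expR (- t)) by [].
by apply: is_derive_eq; rewrite opprK.
Qed.

Lemma powR_within_continuous x a b : 0 < a ->
  {within `[a, b], continuous (fun t : R => t `^ x)}.
Proof.
move=> a0; apply: derivable_within_continuous => t /[!in_itv]/= /andP[at_ _].
by apply: ex_derive; apply: is_derive1_powR; exact: lt_le_trans at_.
Qed.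

Lemma is_derive_LRcontinuous (F f : R -> R) a b :
  (forall t : R, a <= t <= b -> is_derive t 1 F (f t)) -> a < b ->
  derivable_oo_LRcontinuous F a b.
Proof.
move=> dF ab; have dc t : a <= t <= b -> {for t, continuous F}.
  move=> tab; apply/differentiable_continuous/derivable1_diffP.
  by apply: ex_derive; exact: dF.
split.
- move=> t /[!in_itv]/= /andP[/ltW ? /ltW ?].
  by apply: ex_derive; apply: dF; apply/andP.
- by apply: cvg_at_right_filter; apply: dc; rewrite lexx ltW.
- by apply: cvg_at_left_filter; apply: dc; rewrite lexx ltW.
Qed.

(** Confined to a compact interval away from 0, where the integrand is continuous even for [x < 1];
    the boundary term is disposed of in [gamma_boundary_cvg]. *)
Lemma gamma_by_parts x a b : 0 < a -> a < b ->
  (\int[leb]_(t in `[a, b]) (gint (x + 1) t)%:E =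
   (a `^ x * expR (- a) - b `^ x * expR (- b))%:E +
   x%:E * \int[leb]_(t in `[a, b]) (gint x t)%:E)%E.
Proof.
move=> a0 ab.
have pos t : a <= t <= b -> 0 < t by move=> /andP[+ _]; exact: lt_le_trans.
have cexp : {within `[a, b], continuous (fun t : R => expR (- t))}.
  apply: derivable_within_continuous => t _.
  have -> : (fun t : R => expR (- t)) = - (fun t : R => - expR (- t)).
    by apply/funext => z; rewrite fctE opprK.
  by apply: derivableN; apply: ex_derive; exact: is_derive_expRN.
have dF t : a <= t <= b -> is_derive t 1 (fun t : R => t `^ x) (x * t `^ (x - 1)).
  by move=> tab; apply: is_derive1_powR; exact: pos.
have oo (t : R) : t \in `]a, b[ -> a <= t <= b.
  by rewrite in_itv/= => /andP[/ltW -> /ltW ->].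
have cg : {within `[a, b], continuous (gint x)}.
  apply/subspace_continuousP => t tab; apply: cvgM.
    by have /subspace_continuousP := @powR_within_continuous (x - 1) a b a0; apply.
  by have /subspace_continuousP := cexp; apply.
have ig : leb.-integrable `[a, b] (EFin \o gint x).
  by apply: continuous_compact_integrable => //; exact: segment_compact.
rewrite [LHS](_ : _ = \int[leb]_(t in `[a, b]) (t `^ x * expR (- t))%:E)%E; last first.
  by apply: eq_integral => t _; rewrite /gint addrK.
rewrite (@integration_by_parts R (fun t => t `^ x) (fun t => - expR (- t))
   (fun t => x * t `^ (x - 1)) (fun t => expR (- t)) a b ab) //.
- rewrite [X in (_ - X)%E](_ : _ = (- x)%:E * \int[leb]_(t in `[a, b]) (gint x t)%:E)%E.
    rewrite EFinN mulNe oppeK; congr (_%:E + _)%E; ring.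
  rewrite -integralZl//; apply: eq_integral => t _.
  by rewrite -EFinM /gint; congr (_%:E); ring.
- apply/subspace_continuousP => t tab; apply: cvgM; first exact: cvg_cst.
  by have /subspace_continuousP := @powR_within_continuous (x - 1) a b a0; apply.
- exact: is_derive_LRcontinuous dF ab.
- by move=> t /oo tab; rewrite derive1E; have [_ ->] := dF t tab.
- apply: is_derive_LRcontinuous ab => t _; exact: is_derive_expRN.
- by move=> t _; rewrite derive1E; have [_ ->] := is_derive_expRN t.
Qed.

(** The offset 2 keeps the left end strictly below the right one already at [n = 0], as
    [gamma_by_parts] demands. *)
Let itv_n n : set R := `[(n.+2%:R)^-1, n.+2%:R]%classic.

Lemma bigcup_gamma_itv : \bigcup_n itv_n n = `]0, +oo[%classic.
Proof.
apply/seteqP; split => [t [n _]|t].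
  rewrite /itv_n/= !in_itv/= andbT => /andP[+ _].
  by apply: lt_le_trans; rewrite invr_gt0.
rewrite /= in_itv/= andbT => t0.
exists (Num.truncn (t + t^-1)) => //; rewrite /itv_n/= in_itv/=.
have := truncnS_gt (t + t^-1); set n := Num.truncn _ => H.
have ti : 0 < t^-1 by rewrite invr_gt0.
have e : (n.+2%:R : R) = n.+1%:R + 1 by rewrite -natr1.
apply/andP; split; last by rewrite e; lra.
by rewrite -[leRHS]invrK lef_pV2 ?posrE// e; lra.
Qed.

Lemma gamma_cvg x : (\int[leb]_(t in itv_n n) (gint x t)%:E @[n --> \oo] -->
  \int[leb]_(t in `]0%R, +oo[) (gint x t)%:E)%E.
Proof.
rewrite -bigcup_gamma_itv; apply: ge0_nondecreasing_set_cvg_integral.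
- apply/nondecreasing_seqP => n; rewrite subsetEset /itv_n.
  apply: subset_itvScc; last by rewrite bnd_simp ler_nat.
  by rewrite bnd_simp lef_pV2 ?posrE// ler_nat.
- by move=> n; exact: measurable_itv.
- by move=> n; apply/measurable_EFinP; exact: measurable_gamma_integrand.
- by move=> n t _; rewrite lee_fin mulr_ge0 ?powR_ge0 ?expR_ge0.
Qed.

(** From [ln u < u] at [u = t / (2 * x)]: half of the exponential decay absorbs the power. *)
Lemma powR_expRN_le x t : 0 < x -> 0 < t ->
  t `^ x * expR (- t) <= expR (x * ln (2 * x)) * expR (- (t / 2)).
Proof.
move=> x0 t0; rewrite {1}/powR gt_eqF// -!expRD ler_expR.
have := @ln_sublinear R (t / (2 * x)).
rewrite divr_gt0 ?mulr_gt0// => /(_ isT).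
rewrite ln_div ?posrE ?mulr_gt0// => H.
have {}H : x * (ln t - ln (2 * x)) < x * (t / (2 * x)) by rewrite ltr_pM2l.
have e : x * (t / (2 * x)) = t / 2 by field; rewrite gt_eqF.
rewrite e mulrBr in H; lra.
Qed.

Lemma cvg_expRN_half : expR (- (t / 2)) @[t --> +oo] --> (0 : R).
Proof.
    apply: (@cvg_comp _ _ _ (fun t : R => t / 2) (fun x : R => expR (- x)) _ (pinfty_nbhs R)); last exact: cvgr_expR.
    by apply: gt0_cvgMly => //; exact: cvg_id.
Qed.

Lemma gamma_fin1 x : 0 < x ->
  (\int[leb]_(t in `]0%R, +oo[) (gint (x + 1) t)%:E < +oo)%E.
Proof.
move=> x0; set C := expR (x * ln (2 * x)).
have dF (t : R) : is_derive t 1 (fun t : R => - (2 * expR (- (t / 2)))) (expR (- (t / 2))).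
  have D : is_derive t 1 (fun t : R => expR (- (t / 2))) (expR (- (t / 2)) * - 2^-1).
    apply: (@is_derive1_comp _ (@expR R) (fun t : R => - (t / 2)) t).
    have -> : (fun t : R => - (t / 2)) = - (2^-1 *: @id R).
      by apply/funext => z; rewrite !fctE /GRing.scale/= mulrC.
    by apply: is_derive_eq; rewrite /GRing.scale/= mulr1.
  have -> : (fun t : R => - (2 * expR (- (t / 2)))) = - (2 *: (fun t : R => expR (- (t / 2)))) by [].
  by apply: is_derive_eq; rewrite /GRing.scale/=; field.
have ct (F : R -> R) d t : is_derive t 1 F d -> {for t, continuous F}.
  by move=> dFt; apply/differentiable_continuous/derivable1_diffP/ex_derive.
have ce : continuous (fun t : R => expR (- (t / 2))).
  move=> t; have -> : (fun t : R => expR (- (t / 2))) = (- 2^-1) *: (fun t : R => - (2 * expR (- (t / 2)))).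
    by apply/funext => z; transitivity (- 2^-1 * - (2 * expR (- (z / 2)))); first by field.
  by apply: cvgZr; exact: (ct _ _ _ (dF t)).
have E0 : (\int[leb]_(t in `[0%R, +oo[) (expR (- (t / 2)))%:E = 2%:E)%E.
  rewrite (@ge0_continuous_FTC2y R (fun t => expR (- (t / 2))) (fun t => - (2 * expR (- (t / 2)))) 0 0).
  - by rewrite mul0r oppr0 expR0 mulr1 -EFinB sub0r opprK.
  - by move=> t _; exact: expR_ge0.
  - exact: continuous_subspaceT.
  - rewrite -oppr0 -[in X in _ --> X](mulr0 2); apply: cvgN; apply: cvgMr.
    exact: cvg_expRN_half.
  - by move=> t _; apply: ex_derive; exact: dF.
  - by apply: cvg_at_right_filter; exact: (ct _ _ _ (dF 0)).
  - by move=> t _; rewrite derive1E; have [_ ->] := dF t.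
have mE (D : set (measurableTypeR R)) :
    measurable_fun D (fun t : measurableTypeR R => (expR (- (t / 2)))%:E).
  apply/measurable_EFinP; apply: measurable_funS measurableT (@subsetT _ _) _.
  exact: continuous_measurable_fun.
apply: (@le_lt_trans _ _ (C%:E * \int[leb]_(t in `[0%R, +oo[) (expR (- (t / 2)))%:E)%E).
  rewrite -ge0_integralZl//; last first.
    by rewrite lee_fin expR_ge0.
  apply: (@le_trans _ _ (\int[leb]_(t in `]0%R, +oo[) (C%:E * (expR (- (t / 2)))%:E))%E).
    apply: ge0_le_integral.
    - exact: measurable_itv.
    - by move=> t _; rewrite lee_fin mulr_ge0 ?powR_ge0 ?expR_ge0.
    - by apply/measurable_EFinP; exact: measurable_gamma_integrand.
    - by apply: measurable_funeM; exact: mE.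
    - move=> t; rewrite /= in_itv/= andbT => t0.
      by rewrite -EFinM lee_fin /gint addrK; exact: powR_expRN_le.
  apply: ge0_subset_integral.
  - exact: measurable_itv.
  - exact: measurable_itv.
  - by apply: measurable_funeM; exact: mE.
  - by move=> t _; rewrite -EFinM lee_fin mulr_ge0 ?expR_ge0.
  - by apply: subset_itvr; rewrite bnd_simp.
by rewrite E0 -EFinM ltry.
Qed.

Let gamma_integral x : \bar R := (\int[leb]_(t in `]0%R, +oo[) (gint x t)%:E)%E.

Lemma gamma_boundary_cvg x : 0 < x ->
  ((n.+2%:R^-1 : R) `^ x * expR (- n.+2%:R^-1) - n.+2%:R `^ x * expR (- n.+2%:R))
    @[n --> \oo] --> (0 : R).
Proof.
move=> x0.
have c2 : (n.+2%:R : R) @[n --> \oo] --> +oo.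
  apply/cvgryPge => A; near=> n.
  have : A <= n%:R by near: n; exact: nbhs_infty_ger.
  by move/le_trans; apply; rewrite ler_nat -addn2 leq_addr.
have i2 : (n.+2%:R^-1 : R) @[n --> \oo] --> (0 : R).
  by apply/gtr0_cvgV0 => //; exact: nearW.
rewrite -[X in _ --> X](subrr 0); apply: cvgB.
- apply: (@squeeze_cvgr _ _ _ _ (cst 0) (fun n => (n.+2%:R^-1 : R) `^ x)).
  + apply: nearW => n; apply/andP; split.
      exact: mulr_ge0 (powR_ge0 _ _) (expR_ge0 _).
    apply: ler_piMr; first exact: powR_ge0.
    by rewrite expR_le1 oppr_le0 invr_ge0.
  + exact: cvg_cst.
  + by have /cvg_at_rightP := powR_cvg0 x0; apply; split => // n; rewrite invr_gt0.
- apply: (@squeeze_cvgr _ _ _ _ (cst 0)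
    (fun n => expR (x * ln (2 * x)) * expR (- (n.+2%:R / 2)))).
  + apply: nearW => n; apply/andP; split.
      exact: mulr_ge0 (powR_ge0 _ _) (expR_ge0 _).
    exact: powR_expRN_le.
  + exact: cvg_cst.
  + rewrite -[X in _ --> X](mulr0 (expR (x * ln (2 * x)))); apply: cvgMr.
    apply: (@cvg_comp _ _ _ (fun n : nat => n.+2%:R : R) (fun t : R => expR (- (t / 2)))
      _ (pinfty_nbhs R)); [exact: c2|exact: cvg_expRN_half].
Unshelve. all: by end_near. Qed.

Lemma gamma_integral_ge0 x : (0 <= gamma_integral x)%E.
Proof.
by apply: integral_ge0 => t _; rewrite lee_fin mulr_ge0 ?powR_ge0 ?expR_ge0.
Qed.

(** Stated between extended reals, so that it holds before finiteness is known and can be used to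
    prove it. *)
Lemma gamma_integral_add1 x : 0 < x ->
  gamma_integral (x + 1) = (x%:E * gamma_integral x)%E.
Proof.
move=> x0.
pose c n : R := (n.+2%:R^-1 : R) `^ x * expR (- n.+2%:R^-1) - n.+2%:R `^ x * expR (- n.+2%:R).
have cc : (fun n => (c n)%:E) @ \oo --> 0%:E.
  by apply: cvg_EFin; [exact: nearW|exact: gamma_boundary_cvg].
have H : (fun n => ((c n)%:E + x%:E * \int[leb]_(t in itv_n n) (gint x t)%:E)%E) @ \oo -->
    (0%:E + x%:E * gamma_integral x)%E.
  apply: cvgeD; [exact: fin_num_adde_defr|exact: cc|].
  by apply: cvgeZl => //; exact: gamma_cvg.
rewrite add0e in H.
apply: cvg_unique H => //.
rewrite (_ : (fun n => _) = (fun n => \int[leb]_(t in itv_n n) (gint (x + 1) t)%:E)%E).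
  exact: gamma_cvg.
apply/funext => n; rewrite [RHS]gamma_by_parts//.
by rewrite (@lt_trans _ _ 1)// ?invf_lt1// ltr1n.
Qed.

(** [gamma_fin1] treats [x + 1], where the integrand is bounded near 0. The functional equation
    carries finiteness down to [x]: an infinite value there would be infinite at [x + 1] too. *)
Lemma gamma_integral_fin x : 0 < x -> (gamma_integral x < +oo)%E.
Proof.
move=> x0; have := gamma_fin1 x0.
rewrite -/(gamma_integral (x + 1)) gamma_integral_add1//.
case: (gamma_integral x) (gamma_integral_ge0 x) => [r _ _|_|//]; first exact: ltry.
by rewrite gt0_muley ?lte_fin.
Qed.

(** [Gamma] is a real-valued integral, which would be 0 if the extended one were infinite;
    finiteness makes the two agree. *)
Lemma GammaE x : 0 < x -> gamma_integral x = (Gamma x)%:E.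
Proof.
move=> x0; rewrite /Gamma /Rintegral fineK// ge0_fin_numE ?gamma_integral_ge0//.
exact: gamma_integral_fin.
Qed.

Lemma Gamma_gt0 x : 0 < x -> 0 < Gamma x.
Proof.
move=> x0; rewrite -lte_fin -GammaE//; apply: integral_gt0.
- exact: measurable_itv.
- exact: measurable_gamma_integrand.
- by move=> t _; rewrite mulr_ge0 ?powR_ge0 ?expR_ge0.
- apply: aeW => t; rewrite /= in_itv/= andbT => t0.
  by rewrite gt_eqF// mulr_gt0 ?powR_gt0 ?expR_gt0.
- by rewrite [X in (_ < X)%E](@lebesgue_measure_itv R `]0, +oo[) /= ltry oppr0 adde0 ltry.
Qed.

Lemma Gamma_add1 x : 0 < x -> Gamma (x + 1) = x * Gamma x.
Proof.
move=> x0; apply: EFin_inj; rewrite EFinM -!GammaE ?addr_gt0//.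
exact: gamma_integral_add1.
Qed.

Lemma ln_Gamma_add1 x : 0 < x -> ln (Gamma (x + 1)) = ln x + ln (Gamma x).
Proof. by move=> x0; rewrite Gamma_add1// lnM// posrE// Gamma_gt0. Qed.

(** Hoelder's inequality: at each [t > 0] the integrand interpolates geometrically in its parameter.
    The open half-line excludes [t = 0], where powers take conventional values. *)
Lemma ln_Gamma_chord a b c : 0 < a -> a < b -> b < c ->
  (c - a) * ln (Gamma b) <= (c - b) * ln (Gamma a) + (b - a) * ln (Gamma c).
Proof.
move=> a0; apply: (@log_convex_integral _ _ R leb `]0, +oo[%classic gint) => //.
- by move=> y _; exact: measurable_gamma_integrand.
- by move=> y t _; rewrite mulr_ge0 ?powR_ge0 ?expR_ge0.
- move=> s y z t /andP[s0 s1] _ _; rewrite /= in_itv/= andbT => t0.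
  rewrite !powRM ?powR_ge0 ?expR_ge0// mulrACA; congr (_ * _).
    rewrite -!powRrM -powRD; last by apply/implyP => _; rewrite gt_eqF.
    by congr (_ `^ _); ring.
  by rewrite -!expRM -expRD; congr expR; ring.
- by move=> y ay; apply: Gamma_gt0; exact: lt_le_trans ay.
- by move=> y ay; apply: GammaE; exact: lt_le_trans ay.
Qed.

(** The recurrence evaluates the two outer slopes of [chord_slopes]: they are [ln (y - 1)] and
    [ln (y + x)]. *)
Lemma log_recurrence_bounds (H : R -> R) x y :
  (forall a b c : R, 0 < a -> a < b -> b < c ->
    (c - a) * H b <= (c - b) * H a + (b - a) * H c) ->
  (forall z : R, 0 < z -> H (z + 1) = ln z + H z) -> 1 < y -> 0 < x ->
  x * ln (y - 1) <= H (y + x) - H y <= x * ln (y + x).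
Proof.
move=> chord rec y1 x0.
have y0 : 0 < y - 1 by rewrite subr_gt0.
have := @chord_slopes R H (y - 1) y x.
have e1 : H y = ln (y - 1) + H (y - 1) by rewrite -rec// subrK.
rewrite (rec (y + x)); last by lra.
rewrite e1 !addrK => h; apply: h => // a b c ya; apply: chord.
exact: lt_le_trans ya.
Qed.

End gamma.

(** * Functions with the convexity and the recurrence of [ln Gamma] *)

Section log_recurrence.
Context {R : realType} (H : R -> R).
Hypothesis H_chord : forall a b c : R, 0 < a -> a < b -> b < c ->
  (c - a) * H b <= (c - b) * H a + (b - a) * H c.
Hypothesis H_rec : forall z : R, 0 < z -> H (z + 1) = ln z + H z.
Implicit Types (a b c x : R).

Lemma cvg_ln_natrD c : (ln (n%:R + c) - ln n%:R : R) @[n --> \oo] --> (0 : R).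
Proof.
have inv0 : (1 + c * n%:R^-1 : R) @[n --> \oo] --> (1 : R).
  rewrite -[X in _ --> X](addr0 1) -[X in _ --> _ + X](mulr0 c).
  apply: cvgD; first exact: cvg_cst.
  apply: cvgMr; apply/gtr0_cvgV0; last exact: cvgr_idn.
  by near=> n; rewrite ltr0n; near: n; exact: nbhs_infty_gt.
have : ln (1 + c * n%:R^-1 : R) @[n --> \oo] --> ln (1 : R).
  by apply: continuous_cvg inv0; exact: continuous_ln.
rewrite ln1; apply: cvg_trans; apply: near_eq_cvg; near=> n.
have n0 : (0 : R) < n%:R by rewrite ltr0n; near: n; exact: nbhs_infty_gt.
have nc : 0 < n%:R + c.
  have : `|c| < n%:R by near: n; exact: nbhs_infty_gtr.
  by rewrite ltr_norml => /andP[+ _]; lra.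
rewrite -ln_div ?posrE//; congr ln; field; exact: lt0r_neq0.
Unshelve. all: by end_near. Qed.

(** Squeezed by [log_recurrence_bounds], whose two logarithms differ from [ln n] by [o(1)]. Negative
    [x] reduces to positive by exchanging the end points. *)
Lemma log_recurrence_cvg b x :
  (H (n%:R + b + x) - H (n%:R + b) - x * ln n%:R) @[n --> \oo] --> (0 : R).
Proof.
wlog x0 : b x / 0 < x => [hw|].
  have [x0|x0|x0] := ltgtP 0 x; first exact: hw.
    have := hw (b + x) (- x); rewrite oppr_gt0 => /(_ x0) /cvgN.
    rewrite oppr0; apply: cvg_trans; apply: near_eq_cvg; apply: nearW => n.
    by rewrite fctE (addrA n%:R b x) addrK; ring.
  rewrite (_ : (fun _ => _) = cst 0); first exact: cvg_cst.
  by apply/funext => n; rewrite -x0 addr0 subrr mul0r subrr.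
have lo : x * (ln (n%:R + (b - 1)) - ln n%:R) @[n --> \oo] --> (0 : R).
  by rewrite -[X in _ --> X](mulr0 x); apply: cvgMr; exact: cvg_ln_natrD.
have hi : x * (ln (n%:R + (b + x)) - ln n%:R) @[n --> \oo] --> (0 : R).
  by rewrite -[X in _ --> X](mulr0 x); apply: cvgMr; exact: cvg_ln_natrD.
apply: squeeze_cvgr lo hi; near=> n.
have nb : 1 < n%:R + b.
  have : 1 + `|b| < n%:R by near: n; exact: nbhs_infty_gtr.
  by have := ler_norm (- b); rewrite normrN; lra.
have := log_recurrence_bounds H_chord H_rec nb x0; rewrite -!addrA !mulrBr.
by move=> /andP[h1 h2]; apply/andP; split; lra.
Unshelve. all: by end_near. Qed.

Lemma log_recurrence_addn a n : 0 < a ->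
  H (n%:R + a) = H a + \sum_(0 <= m < n) ln (m%:R + a).
Proof.
move=> a0; elim: n => [|n IHn]; first by rewrite add0r big_geq// addr0.
rewrite big_nat_recr//= addrA -IHn -natr1 addrAC H_rec ?ltr_wpDl//; exact: addrC.
Qed.

(** Unrolling the recurrence [n] times from [a + x] and from [a] expresses the increment at [n + a],
    which is [x * ln n + o(1)], through the increment at [a]: Gauss's product formula in logarithmic
    form. *)
Lemma log_recurrence_gauss a x : 1 <= a -> `|x| <= 2^-1 ->
  (x * ln n%:R - \sum_(0 <= m < n) ln (1 + x / (m%:R + a))) @[n --> \oo]
     --> H (a + x) - H a.
Proof.
rewrite ler_norml => a1 /andP[x1 x2].
have a0 : 0 < a by lra.
have ax0 : 0 < a + x by lra.
have lim := @log_recurrence_cvg a x.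
rewrite -[X in _ --> X]subr0.
rewrite (_ : (fun n : nat => _) = (fun n => H (a + x) - H a -
  (H (n%:R + a + x) - H (n%:R + a) - x * ln n%:R))); last first.
  apply/funext => n.
  rewrite -(addrA n%:R a x) (log_recurrence_addn n ax0) (log_recurrence_addn n a0).
  suff -> : \sum_(0 <= m < n) ln (1 + x / (m%:R + a)) =
    \sum_(0 <= m < n) ln (m%:R + (a + x)) - \sum_(0 <= m < n) ln (m%:R + a) by lra.
  rewrite -sumrB; apply: eq_bigr => m _.
  have m0 : (0 : R) <= m%:R by [].
  have ma : 0 < m%:R + a by lra.
  have max : 0 < m%:R + (a + x) by lra.
  rewrite -ln_div ?posrE//; congr ln; field; exact: lt0r_neq0.
by apply: cvgB lim; exact: cvg_cst.
Qed.

Lemma log_recurrence_taylor a : 1 <= a -> exists c, forall P x, `|x| <= 2^-1 ->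
  `|H (a + x) - H a - c * x -
    \sum_(i < P) (- x) ^+ i.+2 / i.+2%:R * hurwitz_zeta i.+2 a| <=
  4 * `|x| ^+ P.+2.
Proof.
by move=> a1; apply: gauss_limit_taylor => // x; exact: log_recurrence_gauss.
Qed.
End log_recurrence.

(** * Taylor series of [ln Gamma] and the value of [digamma] *)

Section gamma_taylor.
Context {R : realType}.
Implicit Types (a b c x : R).
Let lnG x : R := ln (Gamma x).

Lemma is_derive_quadratic (f : R -> R) a c C e : 0 < e ->
  (forall x : R, `|x| <= e -> `|f (a + x) - f a - c * x| <= C * `|x| ^+ 2) ->
  is_derive a 1 f c.
Proof.
move=> e0 H.
have C0 : 0 <= C.
  have := H e; rewrite (gtr0_norm e0) lexx => /(_ isT) /(le_trans (normr_ge0 _)).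
  by rewrite pmulr_lge0// exprn_gt0.
suff D : h^-1 *: (f (h *: 1 + a) - f a) @[h --> 0^'] --> c.
  by split; [apply/cvg_ex; exists c|apply/cvg_lim].
apply/cvgrPdist_le => eps eps0; near=> h.
have h0 : h != 0 by near: h; exact: nbhs_dnbhs_neq.
have hpos : 0 < `|h| by rewrite normr_gt0.
have he : `|h| <= e.
  by near: h; apply: dnbhs0_le.
have hC : `|h| * C <= eps.
  have : `|h| <= eps / (C + 1) by near: h; apply: dnbhs0_le; rewrite divr_gt0// ltr_wpDl.
  rewrite ler_pdivlMr ?ltr_wpDl//; apply: le_trans.
  by rewrite ler_wpM2l// lerDl.
rewrite distrC [h *: 1]mulr1 (addrC h a).
have -> : h^-1 *: (f (a + h) - f a) - c = h^-1 * (f (a + h) - f a - c * h).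
  by rewrite /GRing.scale/=; field.
rewrite normrM normfV ler_pdivrMl//.
apply: le_trans (H h he) _; rewrite expr2 mulrCA ler_pM2l//.
by rewrite mulrC.
Unshelve. all: by end_near. Qed.

(** [digamma] is defined through the derivative of [Gamma] itself, whose differentiability comes
    from here: near [a], [Gamma] is [expR] of [lnG], and the quadratic bound makes [lnG]
    differentiable at [a]. *)
Lemma digammaE a c : 1 <= a ->
  (forall x : R, `|x| <= 2^-1 -> `|lnG (a + x) - lnG a - c * x| <= 4 * `|x| ^+ 2) ->
  digamma a = c.
Proof.
move=> a1 H; have a0 : 0 < a by lra.
have D : is_derive a 1 lnG c.
  by apply: (@is_derive_quadratic lnG a c 4 2^-1) => //.
have De : is_derive a 1 (fun x => expR (lnG x)) (expR (lnG a) * c).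
  exact: (@is_derive1_comp _ (@expR R) lnG a).
have e : {near a, (fun x => expR (lnG x)) =1 Gamma}.
  near=> x; rewrite /lnG lnK// posrE Gamma_gt0//.
  by near: x; exact: lt_nbhsr.
rewrite /digamma derive1E -(near_eq_derive (1 : R) e).
rewrite derive_val /lnG lnK ?posrE ?Gamma_gt0// mulrAC mulfV ?mul1r//.
by rewrite lt0r_neq0// Gamma_gt0.
Unshelve. all: by end_near. Qed.

Lemma ln_Gamma_taylor a x : 1 <= a -> `|x| <= 2^-1 ->
  (\sum_(1 <= p < n) hurwitz_zeta p a * ((- x) ^+ p / p%:R)) @[n --> \oo]
    --> lnG (a + x) - lnG a.
Proof.
move=> a1 x2.
have [c Hc] := @log_recurrence_taylor R lnG ln_Gamma_chord ln_Gamma_add1 a a1.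
(* The case [P = 0] of the bound. The convention for [hurwitz_zeta 1] makes the term [p = 1], that
   is [hurwitz_zeta 1 a * (- x)], equal to [c * x], so one formula covers all [p]. *)
have dg : hurwitz_zeta 1 a = - c.
  rewrite /hurwitz_zeta eqxx; congr (- _); apply: (@digammaE a c a1) => y y2.
  by have := Hc 0 y y2; rewrite big_ord0 subr0.
(* The partial sum below [P + 2] is the linear term plus [P] terms of order at least 2, which is the
   shape of [Hc]. *)
rewrite -(@cvg_shiftn 2); apply/cvgrPdist_le => e e0; near=> P.
rewrite /= big_ltn ?addn2// dg.
rewrite big_add1 /= big_add1/= big_mkord.
rewrite expr1 divr1 mulrNN opprD addrA.
under eq_bigr do rewrite mulrC.
apply: le_trans (Hc P x x2) _.
suff : 4 * (2^-1 : R) ^+ P <= e.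
  apply: le_trans; rewrite ler_pM2l//.
  rewrite -addn2 exprD; apply: (@le_trans _ _ (`|x| ^+ P * 1)).
    rewrite ler_wpM2l ?exprn_ge0// exprn_ile1//; lra.
  by rewrite mulr1 lerXn2r ?nnegrE.
near: P.
have H : (4 * (2^-1 : R) ^+ P) @[P --> \oo] --> (0 : R).
  rewrite -[X in _ --> X](mulr0 4); apply: cvgMr; apply: cvg_expr.
  by rewrite ger0_norm// invf_lt1// ltr1n.
have /cvgrPdist_le/(_ e e0) := H.
apply: filterS => P; rewrite sub0r normrN; apply: le_trans; exact: ler_norm.
Unshelve. all: by end_near. Qed.

End gamma_taylor.

(** * Integration over the unit cube *)

Section translation.
Context {R : realType}.
Notation leb := (@lebesgue_measure R).
Notation T := (measurableTypeR R).
Implicit Types (a : R) (D : set T) (f : T -> \bar R).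

Let shift_ a : T -> T := fun x => x + a.

Lemma measurable_shift a : measurable_fun setT (shift_ a).
Proof. by apply: measurable_funD. Qed.

HB.instance Definition _ a := isMeasurableFun.Build _ _ _ _ (shift_ a) (measurable_shift a).

Lemma lebesgue_measure_shift a D : measurable D ->
  pushforward leb (shift_ a) D = leb D.
Proof.
move=> mD; apply/esym/lebesgue_measure_unique => //= _ [[b c]] _ <-.
rewrite /pushforward (_ : shift_ a @^-1` _ = `](b - a), (c - a)]%classic); last first.
  by apply/seteqP; split => x /=; rewrite !in_itv/= /shift_ ltrBlDr lerBrDr.
rewrite !lebesgue_measure_itv/= !lte_fin ltrD2r.
by case: ifPn => // _; rewrite -!EFinB; congr (_%:E); ring.
Qed.

Lemma ge0_integral_shift a D f : measurable D ->
  measurable_fun D f -> (forall x, 0 <= f x)%E ->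
  (\int[leb]_(x in D) f x = \int[leb]_(x in [set x : R | D (x + a)%R]) f (x + a)%R)%E.
Proof.
move=> mD mf f0.
transitivity (\int[pushforward leb (shift_ a)]_(x in D) f x)%E.
  by apply: eq_measure_integral => A mA _; exact/esym/lebesgue_measure_shift.
by rewrite ge0_integral_pushforward.
Qed.

Lemma periodic_truncn (g : R -> \bar R) : (forall x, g (x + 1) = g x) ->
  forall a, exists b, 0 <= b < 1 /\ forall x, g (x + a) = g (x + b).
Proof.
move=> gp a.
have gn n x : g (x + n%:R) = g x.
  by elim: n => [|n IHn]; rewrite ?addr0// -natr1 addrA gp.
have gz (z : int) x : g (x + z%:~R) = g x.
  case: z => n; first exact: gn.
  by rewrite NegzE mulrNz -(gn n.+1) subrK.
have /andP[fl1 fl2] := @floor_itv R a.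
exists (a - (Num.floor a)%:~R); split.
  by rewrite subr_ge0 fl1 ltrBlDr addrC -intrD1.
by move=> x; rewrite addrA -[in LHS](subrK (Num.floor a)%:~R (x + a)) gz.
Qed.

(** By periodicity a shift [b] in [[0, 1[] suffices. Then []b, 1 + b]] is cut at 1 and the piece
    beyond 1 is moved back to []0, b]]. *)
Lemma integral_periodic_shift (g : R -> \bar R) a :
  measurable_fun setT g -> (forall x, 0 <= g x)%E -> (forall x, g (x + 1) = g x) ->
  (\int[leb]_(x in `[0%R, 1%R]) g (x + a)%R = \int[leb]_(x in `[0%R, 1%R]) g x)%E.
Proof.
move=> mg g0 gp.
have [b [/andP[b0 b1] ab]] := periodic_truncn gp a.
under eq_integral do rewrite ab.
have mgs (D : set T) : measurable_fun D g by exact: measurable_funS mg.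
have shf (u v c : R) : (\int[leb]_(x in `](u + c)%R, (v + c)%R]) g x =
    \int[leb]_(x in `]u, v]) g (x + c)%R)%E.
  rewrite (@ge0_integral_shift c _ g (measurable_itv _) (mgs _) g0).
  congr (integral _ _ _); apply/seteqP; split => x /=;
    by rewrite !in_itv/= ltrD2r lerD2r.
have spl (u v w : R) : u <= v -> v <= w ->
   (\int[leb]_(x in `]u, w]) g x =
    \int[leb]_(x in `]u, v]) g x + \int[leb]_(x in `]v, w]) g x)%E.
  move=> uv vw; rewrite -ge0_integral_setU//=.
  - by rewrite -itv_bndbnd_setU// bnd_simp.
  - apply/disj_setPS => x [] /=; rewrite !in_itv/= => /andP[_ xv] /andP[vx _].
    by rewrite ltNge xv in vx.
(* Half-open intervals make the cut a disjoint union. *)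
rewrite -integral_itv_obnd_cbnd; last first.
  by apply: measurableT_comp mg _; apply: measurable_funS (measurable_shift b).
rewrite -[RHS]integral_itv_obnd_cbnd//; last exact: mgs.
rewrite -shf add0r (spl b 1 (1 + b))//; [|exact: ltW|by rewrite lerDl].
have e := shf 0 b 1; rewrite add0r (addrC b) in e.
rewrite e (spl 0 b 1)//; last exact: ltW.
by rewrite addeC; congr (_ + _)%E; apply: eq_integral => x _; exact: gp.
Qed.
End translation.

Section cube_integral.
Context {R : realType}.
Notation leb := (@lebesgue_measure R).
Notation T := (measurableTypeR R).
Implicit Types (n : nat) (x a : R).

Definition cube_integral n (F : n.-tuple T -> \bar R) : \bar R :=
  (\int[lebesgue_tuple R n]_(t in @unit_cube R n) F t)%E.

Lemma measurable_unit_cube n : measurable (@unit_cube R n).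
Proof.
rewrite (_ : @unit_cube R n = \bigcap_(j in [set: 'I_n])
    (@tnth n T ^~ j) @^-1` `[0, 1]%classic).
  apply: fin_bigcap_measurable => [|j _]; first exact: finite_finset.
  by rewrite -[X in measurable X]setTI; exact: measurable_tnth.
by apply/seteqP; split => t H j; [move=> _; exact: H|exact: H].
Qed.

Lemma unit_cube_cons n x (t : n.-tuple T) :
  unit_cube (tuple_cons (x, t)) <-> x \in `[0, 1] /\ unit_cube t.
Proof.
split => [H|[x01 tc] j].
  split; first by have := H ord0; rewrite (tnth_nth 0).
  by move=> j; have := H (lift ord0 j); rewrite !(tnth_nth 0).
by case: (unliftP ord0 j) => [i|] ->; [have := tc i|]; rewrite !(tnth_nth 0).
Qed.

Lemma tnth_tuple_cons0 n x (t : n.-tuple T) : tnth (tuple_cons (x, t)) ord0 = x.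
Proof. by rewrite (tnth_nth 0). Qed.

Lemma tnth_tuple_consS n x (t : n.-tuple T) (i : 'I_n) :
  tnth (tuple_cons (x, t)) (lift ord0 i) = tnth t i.
Proof. by rewrite !(tnth_nth 0). Qed.

Lemma measurable_cube_integral d (Y : measurableType d) n (G : Y * n.-tuple T -> \bar R) :
  measurable_fun setT G -> (forall z, 0 <= G z)%E ->
  measurable_fun setT (fun y => cube_integral (fun t => G (y, t))).
Proof.
move=> mG G0.
rewrite (_ : (fun y => _) = fubini_F (lebesgue_tuple R n) (G \_ (setT `*` @unit_cube R n))).
  apply: measurable_fun_fubini_tonelli_F; last by apply: erestrict_ge0.
  have mD : measurable ([set: Y] `*` @unit_cube R n).
    by apply: measurableX => //; exact: measurable_unit_cube.
  by apply/(measurable_restrictT _ mD); exact: measurable_funTS.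
apply/funext => y; rewrite /cube_integral integral_mkcond /fubini_F.
apply: eq_integral => t _; rewrite !patchE.
congr (if _ then _ else _); apply/idP/idP; rewrite !inE /=.
  by move=> ?; split.
by case.
Qed.

Lemma cube_integralE n (F : n.+1.-tuple T -> \bar R) :
  measurable_fun setT F -> (forall t, 0 <= F t)%E ->
  cube_integral F = (\int[(leb \x lebesgue_tuple R n)%E]_z
     (F \_ (@unit_cube R n.+1) \o @tuple_cons R n) z)%E.
Proof.
move=> mF F0.
rewrite /cube_integral integral_mkcond.
transitivity (\int[pushforward (leb \x lebesgue_tuple R n)%E (@tuple_cons R n)]_t
   (F \_ (@unit_cube R n.+1)) t)%E; first by [].
rewrite ge0_integral_pushforward//.
  exact: measurable_tuple_cons.
  apply/(measurable_restrictT _ (@measurable_unit_cube n.+1)).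
  exact: measurable_funTS.
  by move=> t _; apply: erestrict_ge0.
Qed.

Lemma restrict_tuple_cons n (F : n.+1.-tuple T -> \bar R) x (t : n.-tuple T) :
  (F \_ (@unit_cube R n.+1)) (tuple_cons (x, t)) =
  if x \in `[0, 1] then ((fun s => F (tuple_cons (x, s))) \_ (@unit_cube R n)) t
  else 0%E.
Proof.
rewrite !patchE; case: ifPn => [/set_mem/unit_cube_cons[x01 tc]|].
  by rewrite x01 mem_set.
move=> /negP tc; case: ifPn => // x01; case: ifPn => // /set_mem tc'.
by exfalso; apply: tc; apply/mem_set/unit_cube_cons.
Qed.

Lemma measurable_restrict_tuple_cons n (F : n.+1.-tuple T -> \bar R) :
  measurable_fun setT F ->
  measurable_fun setT (F \_ (@unit_cube R n.+1) \o @tuple_cons R n).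
Proof.
move=> mF; apply: measurableT_comp; last exact: measurable_tuple_cons.
apply/(measurable_restrictT _ (@measurable_unit_cube n.+1)).
exact: measurable_funTS.
Qed.

Lemma cube_integral_consl n (F : n.+1.-tuple T -> \bar R) :
  measurable_fun setT F -> (forall t, 0 <= F t)%E ->
  cube_integral F = (\int[leb]_(x in `[0%R, 1%R])
    cube_integral (fun t => F (tuple_cons (x, t))))%E.
Proof.
move=> mF F0; rewrite cube_integralE// fubini_tonelli1; last 2 first.
- exact: measurable_restrict_tuple_cons.
- by move=> z; apply: erestrict_ge0.
rewrite [RHS]integral_mkcond; apply: eq_integral => x _.
rewrite /fubini_F patchE /=; under eq_integral do rewrite restrict_tuple_cons.
rewrite mem_setE.
by case: ifPn => x01; rewrite ?integral0// -integral_mkcond.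
Qed.

(** The first coordinate is integrated innermost: the order for integrating by parts in [ord0] with
    the other coordinates frozen. *)
Lemma cube_integral_consr n (F : n.+1.-tuple T -> \bar R) :
  measurable_fun setT F -> (forall t, 0 <= F t)%E ->
  cube_integral F = cube_integral (fun t =>
    \int[leb]_(x in `[0%R, 1%R]) F (tuple_cons (x, t)))%E.
Proof.
move=> mF F0; rewrite cube_integralE// fubini_tonelli2; last 2 first.
- exact: measurable_restrict_tuple_cons.
- by move=> z; apply: erestrict_ge0.
rewrite [RHS]/cube_integral [RHS]integral_mkcond; apply: eq_integral => t _.
rewrite /fubini_G patchE /=; under eq_integral do rewrite restrict_tuple_cons patchE.
case: ifPn => tc; last first.
  by rewrite integral0_eq// => x _; case: ifP.
rewrite [RHS]integral_mkcond; apply: eq_integral => x _; rewrite patchE.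
by congr (if _ then _ else _); apply/idP/idP; rewrite inE.
Qed.

Lemma cube_integral0 (F : 0.-tuple T -> \bar R) : measurable_fun setT F ->
  cube_integral F = F [tuple].
Proof.
move=> mF.
rewrite /cube_integral (_ : @unit_cube R 0 = setT).
  by have := @integral_dirac _ _ ([tuple] : 0.-tuple T) R _ measurableT F mF; rewrite diracT mul1e.
by apply/seteqP; split => // t _ [].
Qed.

Lemma eq_cube_integral n (F G : n.-tuple T -> \bar R) :
  F =1 G -> cube_integral F = cube_integral G.
Proof. by move=> FG; congr cube_integral; apply/funext. Qed.

Lemma lebesgue_measure01 : leb `[0%R, 1%R]%classic = 1%E.
Proof. by rewrite lebesgue_measure_itv/= lte01 oppr0 adde0. Qed.

Lemma cube_integral_cst n (c : \bar R) : (0 <= c)%E ->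
  cube_integral (fun _ : n.-tuple T => c) = c.
Proof.
move=> c0; elim: n => [|n IHn]; first by rewrite cube_integral0.
rewrite cube_integral_consl//; under eq_integral do rewrite IHn.
rewrite [LHS](@integral_cst _ _ _ leb `[0, 1]%classic (measurable_itv _) c).
by rewrite -[RHS]mule1; congr (_ * _)%E; exact: lebesgue_measure01.
Qed.

Definition tuple_perm n (s : 'S_n) (t : n.-tuple T) : n.-tuple T :=
  [tuple tnth t (s i) | i < n].

Lemma tnth_tuple_perm n (s : 'S_n) (t : n.-tuple T) i :
  tnth (tuple_perm s t) i = tnth t (s i).
Proof. by rewrite tnth_mktuple. Qed.

Lemma measurable_tuple_perm n (s : 'S_n) : measurable_fun setT (tuple_perm s).
Proof.
apply/measurable_fun_tnthP => i.
rewrite (_ : _ \o _ = @tnth n T ^~ (s i)); first exact: measurable_tnth.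
by apply/funext => t /=; rewrite tnth_tuple_perm.
Qed.

Lemma tuple_permM n (s s' : 'S_n) (t : n.-tuple T) :
  tuple_perm (s * s')%g t = tuple_perm s (tuple_perm s' t).
Proof.
by apply: eq_from_tnth => i; rewrite !tnth_tuple_perm permM.
Qed.

Let perm_invariant n (s : 'S_n) := forall F : n.-tuple T -> \bar R,
  measurable_fun setT F -> (forall t, 0 <= F t)%E ->
  cube_integral (F \o tuple_perm s) = cube_integral F.

Let perm_invariantM n (s s' : 'S_n) :
  perm_invariant s -> perm_invariant s' -> perm_invariant (s * s')%g.
Proof.
move=> Hs Hs' F mF F0.
rewrite -(Hs F mF F0) -[RHS]Hs'//.
- by apply: eq_cube_integral => t /=; rewrite tuple_permM.
- by apply: measurableT_comp mF _; exact: measurable_tuple_perm.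
- by move=> t; exact: F0.
Qed.

Let measurable_cons_l n x : measurable_fun setT (fun t : n.-tuple T => tuple_cons (x, t)).
Proof. by apply: (@measurable_cons _ _ _ _ (cst x) n id) => //; exact: measurable_id. Qed.

(** The base of permutation invariance: Tonelli's theorem in the two leading coordinates, with the
    remaining ones integrated inside. *)
Let perm_invariant01 n : perm_invariant (tperm (ord0 : 'I_n.+2) (lift ord0 ord0)).
Proof.
move=> F mF F0.
have mFs : measurable_fun setT (F \o tuple_perm (tperm ord0 (lift ord0 (@ord0 n)))).
  by apply: measurableT_comp mF _; exact: measurable_tuple_perm.
have iter (G : n.+2.-tuple T -> \bar R) : measurable_fun setT G -> (forall t, 0 <= G t)%E ->
    cube_integral G = (\int[leb]_(x in `[0%R, 1%R]) \int[leb]_(y in `[0%R, 1%R])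
      cube_integral (fun t => G (tuple_cons (x, tuple_cons (y, t)))))%E.
  move=> mG G0; rewrite cube_integral_consl//; apply: eq_integral => x _.
  rewrite cube_integral_consl//.
  by apply: measurableT_comp mG _; exact: measurable_cons_l.
rewrite (iter _ mFs (fun t => F0 _)) (iter _ mF F0).
have swap x y (t : n.-tuple T) :
    (F \o tuple_perm (tperm ord0 (lift ord0 (@ord0 n)))) (tuple_cons (x, tuple_cons (y, t)))
    = F (tuple_cons (y, tuple_cons (x, t))).
  congr F; apply: eq_from_tnth => i; rewrite tnth_tuple_perm.
  case: tpermP => [->|->|/eqP i0 /eqP i1].
  - by rewrite tnth_tuple_consS !tnth_tuple_cons0.
  - by rewrite tnth_tuple_consS !tnth_tuple_cons0.
  - case: (unliftP ord0 i) i0 i1 => [j ->|->]; last by rewrite eqxx.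
    case: (unliftP ord0 j) => [k ->|->]; last by rewrite eqxx.
    by rewrite !tnth_tuple_consS.
under eq_integral do under eq_integral do
  rewrite (eq_cube_integral (fun t => swap _ _ t)).
pose G (z : T * T) := cube_integral (fun t => F (tuple_cons (z.1, tuple_cons (z.2, t)))).
have mG : measurable_fun setT G.
  apply: (@measurable_cube_integral _ (T * T)%type n
     (fun w => F (tuple_cons (w.1.1, tuple_cons (w.1.2, w.2))))) => //.
  apply: measurableT_comp mF _; apply: measurable_cons.
    exact: measurableT_comp measurable_fst measurable_fst.
  apply: measurable_cons; last exact: measurable_snd.
  exact: measurableT_comp measurable_snd measurable_fst.
pose G1 : T * T -> \bar R := G \_ (`[0, 1]%classic `*` `[0, 1]%classic).
have mG1 : measurable_fun setT G1.
  have mD : measurable (`[0, 1]%classic `*` `[0, 1]%classic : set (T * T)).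
    exact: measurableX.
  by apply/(measurable_restrictT _ mD); exact: measurable_funTS.
have G10 z : (0 <= G1 z)%E.
  by apply: erestrict_ge0 => w _; apply: integral_ge0 => t _; exact: F0.
have G1E x y : G1 (x, y) = if x \in `[0, 1] then if y \in `[0, 1] then G (x, y) else 0%E else 0%E.
  rewrite /G1 patchE; case: ifPn => [/set_mem[/= -> ->]//|/negP H].
  by case: ifPn => // x01; case: ifPn => // y01; exfalso; apply: H; apply/mem_set; split.
have := @fubini_tonelli _ _ T T R leb leb G1 mG1 G10.
set I1 := (X in X = _ -> _); set I2 := (X in _ = X -> _).
have e1 : I1 = (\int[leb]_(x in `[0%R, 1%R]) \int[leb]_(y in `[0%R, 1%R]) G (x, y))%E.
  rewrite [RHS]integral_mkcond; apply: eq_integral => x _; rewrite patchE mem_setE.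
  under eq_integral do rewrite G1E.
  case: ifPn => x01; last by rewrite integral0.
  by rewrite [RHS]integral_mkcond; apply: eq_integral => y _; rewrite patchE mem_setE.
have e2 : I2 = (\int[leb]_(x in `[0%R, 1%R]) \int[leb]_(y in `[0%R, 1%R]) G (y, x))%E.
  rewrite [RHS]integral_mkcond; apply: eq_integral => x _; rewrite patchE mem_setE.
  under eq_integral do rewrite G1E.
  case: ifPn => x01; last by rewrite integral0_eq// => y _; case: ifP.
  by rewrite [RHS]integral_mkcond; apply: eq_integral => y _; rewrite patchE mem_setE.
rewrite e1 e2 => H; exact: (esym H).
Qed.

Let perm_invariant_lift n (i j : 'I_n) : perm_invariant (tperm i j) ->
  perm_invariant (tperm (lift ord0 i) (lift ord0 j)).
Proof.
move=> H F mF F0.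
have mFs : measurable_fun setT (F \o tuple_perm (tperm (lift ord0 i) (lift ord0 j))).
  by apply: measurableT_comp mF _; exact: measurable_tuple_perm.
rewrite (cube_integral_consl mFs (fun t => F0 _)) (cube_integral_consl mF F0).
apply: eq_integral => x _; rewrite -[RHS]H//; last first.
  by apply: measurableT_comp mF _; exact: measurable_cons_l.
apply: eq_cube_integral => t /=; congr F.
apply: eq_from_tnth => k; rewrite tnth_tuple_perm.
case: (unliftP ord0 k) => [m ->|->].
  rewrite tnth_tuple_consS tnth_tuple_perm.
  have -> : tperm (lift ord0 i) (lift ord0 j) (lift ord0 m) = lift ord0 (tperm i j m).
    case: (tpermP i j m) => [->|->|/eqP mi /eqP mj]; rewrite ?tpermL ?tpermR//.
    by rewrite tpermD// eq_sym (inj_eq lift_inj).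
  by rewrite tnth_tuple_consS.
by rewrite tpermD// tnth_tuple_cons0.
Qed.

(** Induction on the dimension. A transposition fixing [ord0] acts on the tail; [(0 1)] is Tonelli's
    theorem; any other [(0 k)] is conjugate under [(0 1)] to [(1 k)], which fixes [ord0]. *)
Lemma cube_integral_tperm n (i j : 'I_n) (F : n.-tuple T -> \bar R) :
  measurable_fun setT F -> (forall t, 0 <= F t)%E ->
  cube_integral (F \o tuple_perm (tperm i j)) = cube_integral F.
Proof.
suff : perm_invariant (tperm i j) by apply.
elim: n i j {F} => [|n IHn] i j; first by case: i.
have inv1 : perm_invariant (1%g : 'S_n.+1).
  move=> F mF F0; apply: eq_cube_integral => t /=; congr F.
  by apply: eq_from_tnth => k; rewrite tnth_tuple_perm perm1.
have inv0 (k : 'I_n) : perm_invariant (tperm ord0 (lift ord0 k)).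
  case: n k IHn {i j inv1} => [[]//|n] k IHn.
  case: (unliftP ord0 k) => [m ->|->]; last exact: perm_invariant01.
  have -> : tperm ord0 (lift ord0 (lift ord0 m)) =
      (tperm ord0 (lift ord0 ord0) * tperm (lift ord0 ord0) (lift ord0 (lift ord0 m)) *
       tperm ord0 (lift ord0 ord0))%g.
    have := tpermJ (lift ord0 ord0) (lift ord0 (lift ord0 m)) (tperm ord0 (lift ord0 (@ord0 n))).
    rewrite tpermR tpermD// conjgE tpermV => e.
    by rewrite -mulgA e.
  apply: perm_invariantM; last exact: perm_invariant01.
  apply: perm_invariantM; first exact: perm_invariant01.
  by apply: perm_invariant_lift; exact: IHn.
case: (unliftP ord0 i) => [i' ->|->]; case: (unliftP ord0 j) => [j' ->|->].
- exact: perm_invariant_lift.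
- by rewrite tpermC; exact: inv0.
- exact: inv0.
- by rewrite tperm1.
Qed.

End cube_integral.

Section cube_integral_theory.
Context {R : realType}.
Notation leb := (@lebesgue_measure R).
Notation T := (measurableTypeR R).
Implicit Types (n : nat) (x a : R).

Lemma lebesgue_tuple_unit_cube n : lebesgue_tuple R n (@unit_cube R n) = 1%E.
Proof.
rewrite -(@cube_integral_cst R n 1%E lee01) /cube_integral.
rewrite [RHS](@integral_cst _ _ _ _ _ (@measurable_unit_cube R n) 1%E).
by rewrite mul1e.
Qed.

Lemma integral01_cst (c : \bar R) : (\int[leb]_(x in `[0%R, 1%R]) c = c)%E.
Proof.
rewrite [LHS](@integral_cst _ _ _ leb `[0, 1]%classic (measurable_itv _) c).
by rewrite -[RHS]mule1; congr (_ * _)%E; exact: lebesgue_measure01.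
Qed.

Definition coordinate_periodic n (F : n.-tuple T -> \bar R) :=
  forall s t, (forall i, tnth s i = tnth t i \/ tnth s i = tnth t i + 1) -> F s = F t.

Definition tuple_shift n a (t : n.-tuple T) : n.-tuple T :=
  [tuple tnth t i + a | i < n].

Lemma tnth_tuple_shift n a (t : n.-tuple T) i : tnth (tuple_shift a t) i = tnth t i + a.
Proof. by rewrite tnth_mktuple. Qed.

Lemma measurable_tuple_shift n a : measurable_fun setT (@tuple_shift n a).
Proof.
apply/measurable_fun_tnthP => i.
rewrite (_ : _ \o _ = (fun x : T => x + a) \o @tnth n T ^~ i).
  by apply: measurableT_comp (measurable_shift a) _; exact: measurable_tnth.
by apply/funext => t /=; rewrite tnth_tuple_shift.
Qed.

Lemma measurable_tuple_consr n x : measurable_fun setT (fun t : n.-tuple T => tuple_cons (x, t)).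
Proof. by apply: (@measurable_cons _ _ _ _ (cst x) n id) => //; exact: measurable_id. Qed.

Lemma measurable_tuple_consl n (t : n.-tuple T) : measurable_fun setT (fun x : T => tuple_cons (x, t)).
Proof. by apply: (@measurable_cons _ _ _ _ id n (cst t)) => //; exact: measurable_id. Qed.

Lemma cube_integral_shift n a (F : n.-tuple T -> \bar R) :
  measurable_fun setT F -> (forall t, 0 <= F t)%E -> coordinate_periodic F ->
  cube_integral (F \o tuple_shift a) = cube_integral F.
Proof.
elim: n F => [|n IHn] F mF F0 FP.
  by apply: eq_cube_integral => t /=; congr F; apply: eq_from_tnth => -[].
have mFs : measurable_fun setT (F \o tuple_shift a).
  by apply: measurableT_comp mF _; exact: measurable_tuple_shift.
rewrite (cube_integral_consl mFs (fun t => F0 _)) (cube_integral_consl mF F0).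
pose g x := cube_integral (fun t => F (tuple_cons (x, t))).
transitivity (\int[leb]_(x in `[0%R, 1%R]) g (x + a)%R)%E.
  apply: eq_integral => x _; rewrite /g -[RHS]IHn.
  - apply: eq_cube_integral => t /=; congr F; apply: eq_from_tnth => i.
    rewrite tnth_tuple_shift; case: (unliftP ord0 i) => [j ->|->].
      by rewrite !tnth_tuple_consS tnth_tuple_shift.
    by rewrite !tnth_tuple_cons0.
  - by apply: measurableT_comp mF _; exact: measurable_tuple_consr.
  - by move=> t; exact: F0.
  - move=> s t st; apply: FP => i; case: (unliftP ord0 i) => [j ->|->].
      by rewrite !tnth_tuple_consS.
    by left; rewrite !tnth_tuple_cons0.
apply: integral_periodic_shift.
- apply: (@measurable_cube_integral _ _ T n (F \o @tuple_cons R n)).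
    by apply: measurableT_comp mF _; exact: measurable_tuple_cons.
  by move=> z; exact: F0.
- by move=> x; apply: integral_ge0 => t _; exact: F0.
- move=> x; apply: eq_cube_integral => t; apply: FP => i.
  case: (unliftP ord0 i) => [j ->|->].
    by left; rewrite !tnth_tuple_consS.
  by right; rewrite !tnth_tuple_cons0.
Qed.

Lemma cube_integral_marginal1 n (i : 'I_n) (g : R -> \bar R) :
  measurable_fun setT g -> (forall x, 0 <= g x)%E ->
  cube_integral (fun t : n.-tuple T => g (tnth t i)) = (\int[leb]_(x in `[0%R, 1%R]) g x)%E.
Proof.
move=> mg g0; elim: n i => [[]//|n IHn] i.
have mgi : measurable_fun setT (fun t : n.+1.-tuple T => g (tnth t i)).
  by apply: (measurableT_comp mg); exact: measurable_tnth.
rewrite (cube_integral_consl mgi (fun t => g0 _)).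
case: (unliftP ord0 i) => [j ->|->].
  rewrite -[RHS]integral01_cst; apply: eq_integral => x _.
  rewrite -(IHn j); apply: eq_cube_integral => t.
  by rewrite tnth_tuple_consS.
apply: eq_integral => x _; rewrite -[RHS](@cube_integral_cst R n (g x))//.
Qed.

(** With the earlier coordinate frozen, the difference is a translate of the later one, and
    periodicity removes the translation; evenness handles the opposite order. This reduces
    integrability and null sets of pair factors to one dimension. *)
Lemma cube_integral_marginal2 n (i j : 'I_n) (g : R -> \bar R) :
  measurable_fun setT g -> (forall x, 0 <= g x)%E -> (forall x, g (x + 1) = g x) ->
  (forall x, g (- x) = g x) -> i != j ->
  cube_integral (fun t : n.-tuple T => g (tnth t i - tnth t j)) =
    (\int[leb]_(x in `[0%R, 1%R]) g x)%E.
Proof.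
move=> mg g0 gp gN.
have mgij m (k k' : 'I_m) : measurable_fun setT (fun t : m.-tuple T => g (tnth t k - tnth t k')).
  apply: (measurableT_comp mg); apply: measurable_funB; exact: measurable_tnth.
have key m (k : 'I_m) :
    cube_integral (fun t : m.+1.-tuple T => g (tnth t (lift ord0 k) - tnth t ord0)) =
    (\int[leb]_(x in `[0%R, 1%R]) g x)%E.
  rewrite (cube_integral_consl (mgij _ _ _) (fun t => g0 _)).
  rewrite -[RHS]integral01_cst; apply: eq_integral => x _.
  rewrite -(integral_periodic_shift (- x) mg g0 gp).
  rewrite -(@cube_integral_marginal1 m k (fun y => g (y - x)))//; last first.
    by apply: (measurableT_comp mg); exact: (measurable_shift (- x)).
  by apply: eq_cube_integral => t; rewrite tnth_tuple_consS tnth_tuple_cons0.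
elim: n i j => [[]//|n IHn] i j.
case: (unliftP ord0 i) => [i' ->|->]; case: (unliftP ord0 j) => [j' ->|->]; last by rewrite eqxx.
- rewrite (inj_eq lift_inj) => ij.
  rewrite (cube_integral_consl (mgij _ _ _) (fun t => g0 _)).
  rewrite -[RHS]integral01_cst; apply: eq_integral => x _.
  rewrite -(IHn i' j' ij); apply: eq_cube_integral => t.
  by rewrite !tnth_tuple_consS.
- by move=> _; exact: key.
- move=> _; rewrite -(key n j'); apply: eq_cube_integral => t.
  by rewrite -gN opprB.
Qed.

Lemma cube_integral_tperm_real n (i j : 'I_n) (f : n.-tuple T -> R) :
  measurable_fun setT f ->
  cube_integral (fun t => (f (tuple_perm (tperm i j) t))%:E) =
  cube_integral (fun t => (f t)%:E).
Proof.
move=> mf; have mfE : measurable_fun setT (EFin \o f) by exact/measurable_EFinP.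
rewrite /cube_integral integralE [RHS]integralE; congr (_ - _)%E.
  rewrite -[RHS](@cube_integral_tperm _ _ i j _ (measurable_funepos mfE) (funepos_ge0 _)).
  by rewrite /cube_integral; apply: eq_integral => t _; rewrite /= !funeposE.
rewrite -[RHS](@cube_integral_tperm _ _ i j _ (measurable_funeneg mfE) (funeneg_ge0 _)).
by rewrite /cube_integral; apply: eq_integral => t _; rewrite /= !funenegE.
Qed.

Lemma cube_integrable_bounded n (f : n.-tuple T -> R) (C : R) :
  measurable_fun setT f -> (forall t, `|f t| <= C) ->
  (lebesgue_tuple R n).-integrable (@unit_cube R n) (EFin \o f).
Proof.
move=> mf fC.
apply: measurable_bounded_integrable.
- exact: measurable_unit_cube.
- by rewrite [X in (X < _)%E]lebesgue_tuple_unit_cube ltry.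
- exact: measurable_funTS.
- exists C; split; first exact: num_real.
  by move=> M CM t _ /=; exact: le_trans (fC t) (ltW CM).
Qed.

Lemma integrable01_bounded (f : T -> R) (C : R) :
  measurable_fun setT f -> (forall t, `|f t| <= C) ->
  leb.-integrable `[0, 1]%classic (EFin \o f).
Proof.
move=> mf fC; apply: measurable_bounded_integrable => //.
- by rewrite [X in (X < _)%E]lebesgue_measure01 ltry.
- exact: measurable_funTS.
- exists C; split; first exact: num_real.
  by move=> M CM t _ /=; exact: le_trans (fC t) (ltW CM).
Qed.

(** The iterated integral formulas concern nonnegative functions, so the bound [C] is added: [f + C]
    has slice integrals [C], and [C] is subtracted again at the end. *)
Lemma cube_integral_slice0 n (f : n.+1.-tuple T -> R) (C : R) :
  measurable_fun setT f -> (forall t, `|f t| <= C) ->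
  (forall t, \int[leb]_(x in `[0%R, 1%R]) (f (tuple_cons (x, t)))%:E = 0)%E ->
  cube_integral (fun t => (f t)%:E) = 0%E.
Proof.
move=> mf fC f0.
have C0 : 0 <= C by apply: le_trans (fC [tuple 0 | i < n.+1]); exact: normr_ge0.
have i1 : (lebesgue_tuple R n.+1).-integrable (@unit_cube R n.+1) (EFin \o f).
  exact: cube_integrable_bounded mf fC.
have C1 (S : Type) (s : S) : `|cst C s| <= C by rewrite ger0_norm.
have iC : (lebesgue_tuple R n.+1).-integrable (@unit_cube R n.+1) (EFin \o cst C).
  exact: cube_integrable_bounded (measurable_cst _) (C1 _).
have e : cube_integral (fun t : n.+1.-tuple T => ((f t)%:E + C%:E)%E) = C%:E.
  rewrite cube_integral_consr; last 2 first.
  - by apply/measurable_EFinP; exact: measurable_funD.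
  - by move=> t; rewrite lee_fin -lerBlDr sub0r; have := fC t; rewrite ler_norml => /andP[].
  rewrite -[RHS](@cube_integral_cst R n)//; apply: eq_cube_integral => t.
  have if1 : leb.-integrable `[0, 1]%classic (EFin \o (fun x : T => f (tuple_cons (x, t)))).
    apply: integrable01_bounded (fun x => fC _).
    by apply: (measurableT_comp mf); exact: measurable_tuple_consl.
  have ic1 : leb.-integrable `[0, 1]%classic (EFin \o (cst C : T -> R)).
    exact: integrable01_bounded (measurable_cst _) (C1 _).
  have := @integralD _ _ _ leb `[0, 1]%classic (measurable_itv _) _ _ if1 ic1.
  move=> /= ->.
  by rewrite f0 add0e integral01_cst.
have := @integralD _ _ _ (lebesgue_tuple R n.+1) _ (@measurable_unit_cube R n.+1) _ _ i1 iC.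
rewrite -/(cube_integral _) e -/(cube_integral _) -/(cube_integral _).
rewrite (_ : cube_integral (EFin \o cst C) = C%:E); last exact: (@cube_integral_cst R n.+1 C%:E C0).
have fin : cube_integral (EFin \o f) \is a fin_num.
  by apply: integrable_fin_num => //; exact: measurable_unit_cube.
rewrite -[X in _ -> X = _](fineK fin) -[X in _ = (X + _)%E -> _](fineK fin) -EFinD.
by move=> [e']; congr (_%:E); lra.
Qed.

End cube_integral_theory.

(** * The weight on the circle *)

Section chord_square.
Context {R : realType}.
Notation leb := (@lebesgue_measure R).
Notation T := (measurableTypeR R).
Implicit Types (x y a e : R).

(* The squared length [|1 - e^(2 pi i x)|^2] of a chord of the unit circle. *)
Definition chord2 x : R := 2 - 2 * cos (2 * pi * x).

Lemma cos_2pi_add1 x : cos (2 * pi * (x + 1)) = cos (2 * pi * x).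
Proof. by rewrite mulrDr mulr1 mulr_natl mulr2n addrA !cosDpi opprK. Qed.

Lemma sin_2pi_add1 x : sin (2 * pi * (x + 1)) = sin (2 * pi * x).
Proof. by rewrite mulrDr mulr1 mulr_natl mulr2n addrA !sinDpi opprK. Qed.

Lemma chord2_add1 x : chord2 (x + 1) = chord2 x.
Proof. by rewrite /chord2 cos_2pi_add1. Qed.

Lemma chord2N x : chord2 (- x) = chord2 x.
Proof. by rewrite /chord2 mulrN cosN. Qed.

Lemma chord2_ge0 x : 0 <= chord2 x.
Proof. by rewrite /chord2; have := cos_le1 (2 * pi * x); lra. Qed.

Lemma chord2_le4 x : chord2 x <= 4.
Proof. by rewrite /chord2; have := cos_geN1 (2 * pi * x); lra. Qed.

Lemma sin2_chord2 x : (2 * sin (2 * pi * x)) ^+ 2 = chord2 x * (4 - chord2 x).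
Proof.
have := cos2Dsin2 (2 * pi * x); rewrite /chord2.
move: (cos _) (sin _) => c s H; have H' : s ^+ 2 = 1 - c ^+ 2 by rewrite -H; ring.
by rewrite exprMn H'; ring.
Qed.

Lemma is_derive_mul2pi x : is_derive x 1 (fun x : R => 2 * pi * x) (2 * pi).
Proof.
have -> : (fun x : R => 2 * pi * x) = (2 * pi) *: @id R by [].
by apply: is_derive_eq; rewrite /GRing.scale/= mulr1.
Qed.

Lemma is_derive_sin2pi x :
  is_derive x 1 (fun x : R => sin (2 * pi * x)) (2 * pi * cos (2 * pi * x)).
Proof.
apply: (@is_derive_eq _ _ _ _ _ _ _ (cos (2 * pi * x) * (2 * pi))); last exact: mulrC.
exact: (@is_derive1_comp _ (@sin R) (fun x : R => 2 * pi * x) x _ _ (is_derive_sin _) (is_derive_mul2pi x)).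
Qed.

Lemma is_derive_cos2pi x :
  is_derive x 1 (fun x : R => cos (2 * pi * x)) (- (2 * pi * sin (2 * pi * x))).
Proof.
apply: (@is_derive_eq _ _ _ _ _ _ _ (- sin (2 * pi * x) * (2 * pi))); last ring.
exact: (@is_derive1_comp _ (@cos R) (fun x : R => 2 * pi * x) x _ _ (is_derive_cos _) (is_derive_mul2pi x)).
Qed.

Lemma is_derive_chord2 x : is_derive x 1 chord2 (4 * pi * sin (2 * pi * x)).
Proof.
have -> : chord2 = cst 2 - 2 *: (fun x : R => cos (2 * pi * x)) by [].
have D := is_derive_cos2pi x.
by apply: is_derive_eq; rewrite /GRing.scale/= sub0r; ring.
Qed.

Lemma is_derive_shiftr (f : R -> R) x y d : is_derive (x - y) 1 f d ->
  is_derive x 1 (fun z : R => f (z - y)) d.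
Proof.
move=> D; have Ds : is_derive x 1 (fun z : R => z - y) 1.
  have -> : (fun z : R => z - y) = @id R - cst y by [].
  by apply: is_derive_eq; rewrite subr0.
by have := @is_derive1_comp _ f (fun z : R => z - y) x _ _ D Ds; rewrite mulr1.
Qed.

Lemma derivable_continuous (f df : R -> R) :
  (forall x : R, is_derive x 1 f (df x)) -> continuous f.
Proof.
move=> D x; apply/differentiable_continuous/derivable1_diffP.
by apply: ex_derive; exact: D.
Qed.

Lemma continuous_cos2pi : continuous (fun x : R => cos (2 * pi * x)).
Proof. exact: derivable_continuous is_derive_cos2pi. Qed.

Lemma continuous_sin2pi : continuous (fun x : R => sin (2 * pi * x)).
Proof. exact: derivable_continuous is_derive_sin2pi. Qed.

Lemma continuous_chord2 : continuous chord2.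
Proof. exact: derivable_continuous is_derive_chord2. Qed.

Lemma measurable_chord2 : measurable_fun setT chord2.
Proof. exact: continuous_measurable_fun continuous_chord2. Qed.

Lemma is_derive_chord2_powR a e x : 0 < e ->
  is_derive x 1 (fun x => (chord2 x + e) `^ a)
   ((chord2 x + e) `^ a * (a * (4 * pi * sin (2 * pi * x)) / (chord2 x + e))).
Proof.
move=> e0; have pos : 0 < chord2 x + e by rewrite ltr_wpDl// chord2_ge0.
have D1 : is_derive x 1 (fun x => chord2 x + e) (4 * pi * sin (2 * pi * x)).
  have -> : (fun x => chord2 x + e) = chord2 + cst e by [].
  have D := is_derive_chord2 x.
  by apply: is_derive_eq; rewrite addr0.
have := @is_derive1_comp _ (fun z => z `^ a) (fun x => chord2 x + e) x _ _ (is_derive1_powR a pos) D1.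
rewrite powRB; last by apply/implyP => _; rewrite gt_eqF.
rewrite powRr1; last exact: ltW.
by congr is_derive; field; rewrite gt_eqF.
Qed.

Lemma is_derive_affine (F : R -> R) p c x d : is_derive x 1 F d ->
  is_derive x 1 (fun x => p * F x + c * x) (p * d + c).
Proof.
move=> D; have := @is_deriveD _ _ _ (p *: F) (c *: @id R) x 1 _ _
  (@is_deriveZ _ _ _ F p x 1 d D) (@is_deriveZ _ _ _ (@id R) c x 1 1 (is_derive_id x 1)).
by move=> {}D; apply: is_derive_eq D _; rewrite [c *: 1]mulr1.
Qed.

Lemma integral01_derive (F f : R -> R) : (forall x : R, is_derive x 1 F (f x)) ->
  continuous f -> (\int[leb]_(x in `[0%R, 1%R]) (f x)%:E = (F 1 - F 0)%:E)%E.
Proof.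
move=> D cf; rewrite (@continuous_FTC2 R f F 0 1)//.
- exact: continuous_subspaceT.
- by apply: is_derive_LRcontinuous ltr01 => t _; exact: D.
- by move=> t _; rewrite derive1E; have [_ ->] := D t.
Qed.

(** [U] vanishes to second order at the integers, so even at [e = 0] the exponent [- 4^-1] produces
    only a singularity of type [|x| ^ (- 1 / 2)], which is integrable. *)
Let q e x : R := (chord2 x + e) `^ (- 4^-1).

(* Uniform in [e]: up to the additive constant, the integrand is dominated by the *)
(* derivative of the 1-periodic function [sin (2 pi x) * (U x + e) ^ (- 1 / 4)].  *)
Lemma integral_chord2_eps_le e : 0 < e -> e <= 1 ->
  (\int[leb]_(x in `[0%R, 1%R]) (q e x)%:E <= 5%:E)%E.
Proof.
move=> e0 e1.
have pos x : 0 < chord2 x + e by rewrite ltr_wpDl// chord2_ge0.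
pose g x := - 4^-1 * (4 * pi * sin (2 * pi * x)) / (chord2 x + e).
have dq x : is_derive x 1 (q e) (q e x * g x) by exact: is_derive_chord2_powR.
pose F x := sin (2 * pi * x) * q e x.
pose f x := 2 * pi * cos (2 * pi * x) * q e x + sin (2 * pi * x) * (q e x * g x).
have dF x : is_derive x 1 F (f x).
  have -> : F = (fun x => sin (2 * pi * x)) * q e by [].
  have D1 := is_derive_sin2pi x; have D2 := dq x.
  by apply: is_derive_eq; rewrite /GRing.scale/= /f addrC; congr (_ + _); exact: mulrC.
have cq : continuous (q e) by exact: derivable_continuous dq.
have cg : continuous g.
  move=> x; apply: cvgM.
    apply: cvgMr; apply: cvgMr; exact: continuous_sin2pi.
  apply: cvgV; first by rewrite gt_eqF.
  by apply: cvgD; [exact: continuous_chord2|exact: cvg_cst].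
have cf : continuous f.
  move=> x; apply: cvgD.
    by apply: cvgM (cq x); apply: cvgMr; exact: continuous_cos2pi.
  apply: cvgM; first exact: continuous_sin2pi.
  by apply: cvgM (cq x) (cg x).
have pi0 : 0 < (pi : R) := pi_gt0 R.
have bound x : q e x <= pi^-1 * f x + 5.
  have q0 : 0 <= q e x by exact: powR_ge0.
  have E : pi^-1 * f x = q e x * (2 - chord2 x - (chord2 x / (chord2 x + e)) * (4 - chord2 x) / 4).
    have := sin2_chord2 x; rewrite /f /g => H.
    have -> : chord2 x / (chord2 x + e) * (4 - chord2 x) / 4 =
       (2 * sin (2 * pi * x)) ^+ 2 / (chord2 x + e) / 4 by rewrite H; ring.
    have -> : 2 - chord2 x = 2 * cos (2 * pi * x) by rewrite /chord2; ring.
    have p1 : (pi : R) != 0 by rewrite gt_eqF.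
    have p2 : chord2 x + e != 0 by rewrite gt_eqF.
    move: (cos _) (sin _) (q e x) (chord2 x + e) p2 => c s Q u p2.
    by move: (pi : R) p1 => p p1; field; rewrite p1 p2.
  (* [U x + e] is at most [4 + 1], and its power [3 / 4] is at most 5: this is the additive constant
     of [bound]. *)
  have Uq : chord2 x * q e x <= 5.
    have u5 : chord2 x + e <= 5 by have := chord2_le4 x; lra.
    apply: (@le_trans _ _ ((chord2 x + e) * q e x)).
      by apply: ler_wpM2r => //; rewrite lerDl ltW.
    have -> : (chord2 x + e) * q e x = (chord2 x + e) `^ (1 - 4^-1).
      rewrite powRD; last by apply/implyP => _; rewrite gt_eqF.
      by rewrite powRr1// ltW.
    apply: (@le_trans _ _ (5 `^ (1 - 4^-1))).
      apply: ge0_ler_powR; [lra|by rewrite nnegrE ltW|by rewrite nnegrE|exact: u5].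
    by apply: ler1_powR; lra.
  have r1 : chord2 x / (chord2 x + e) <= 1.
    by rewrite ler_pdivrMr// mul1r lerDl ltW.
  have r0 : 0 <= chord2 x / (chord2 x + e) by rewrite divr_ge0 ?chord2_ge0// ltW.
  have u4 : 0 <= 4 - chord2 x by rewrite subr_ge0 chord2_le4.
  have u0 := chord2_ge0 x.
  have r4 : chord2 x / (chord2 x + e) * (4 - chord2 x) <= 4.
    apply: (@le_trans _ _ (1 * (4 - chord2 x))); first exact: ler_wpM2r.
    lra.
  (* The subtracted quotient is at most 1, so the bracket of [E] without [- chord2 x] is at least 1;
     the omitted [chord2 x * q e x] is the term bounded by 5. *)
  have : q e x * 1 <= q e x * (2 - chord2 x / (chord2 x + e) * (4 - chord2 x) / 4).
    by apply: ler_wpM2l => //; lra.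
  rewrite E; lra.
have mq : measurable_fun (`[0%R, 1%R]%classic : set T) (fun x => (q e x)%:E).
  by apply/measurable_EFinP; apply: measurable_funTS; exact: continuous_measurable_fun.
have ch : continuous (fun x => pi^-1 * f x + 5).
  by move=> x; apply: cvgD (@cvg_cst _ _ _ _ _); apply: cvgMr; exact: cf.
apply: (@le_trans _ _ (\int[leb]_(x in `[0%R, 1%R]) (pi^-1 * f x + 5)%:E)%E).
  apply: ge0_le_integral => //.
  - by move=> x _; rewrite lee_fin; exact: powR_ge0.
  - by apply/measurable_EFinP; apply: measurable_funTS; exact: continuous_measurable_fun.
  - by move=> x _; rewrite lee_fin.
have dG x : is_derive x 1 (fun x => pi^-1 * F x + 5 * x) (pi^-1 * f x + 5).
  exact: is_derive_affine.
rewrite (integral01_derive dG ch) lee_fin /F.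
have := sin_2pi_add1 0; rewrite add0r => ->.
by rewrite mulr0 sin0 !mul0r !mulr0 add0r mulr1 addr0 subr0.
Qed.

(** Monotone convergence along [e = 1 / (n + 1)], from the bound 5 that does not depend on [e]. *)
Lemma integral_chord2_lty :
  (\int[leb]_(x in `[0%R, 1%R]) (chord2 x `^ (- 4^-1))%:E < +oo)%E.
Proof.
pose e n : R := n.+1%:R^-1.
have e0 n : 0 < e n by rewrite invr_gt0.
have e1 n : e n <= 1 by rewrite invf_le1// ler1n.
have pos n x : 0 < chord2 x + e n by rewrite ltr_wpDl// chord2_ge0.
have mq n : measurable_fun (`[0%R, 1%R]%classic : set T) (fun x => (q (e n) x)%:E).
  apply/measurable_EFinP; apply: measurable_funTS; apply: (measurableT_comp (measurable_powR (- 4^-1))).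
  by apply: measurable_funD => //; exact: measurable_chord2.
have nd x : {homo (fun n => (q (e n) x)%:E) : n m / (n <= m)%N >-> (n <= m)%E}.
  move=> n m nm; rewrite lee_fin /q !powRN lef_pV2 ?posrE ?powR_gt0//.
  apply: ge0_ler_powR; [by rewrite invr_ge0|by rewrite nnegrE ltW|by rewrite nnegrE ltW|].
  by rewrite lerD2l lef_pV2 ?posrE// ler_nat ltnS.
apply: (@le_lt_trans _ _ 5%:E); last exact: ltry.
apply: (@le_trans _ _ (\int[leb]_(x in `[0%R, 1%R]) limn (fun n => (q (e n) x)%:E))%E).
  apply: ge0_le_integral => //.
  - by move=> x _; rewrite lee_fin powR_ge0.
  - apply/measurable_EFinP; apply: measurable_funTS; apply: (measurableT_comp (measurable_powR (- 4^-1))).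
    exact: measurable_chord2.
  - apply: (emeasurable_fun_cvg (fun n x => (q (e n) x)%:E)) => // x _.
    by apply: ereal_nondecreasing_is_cvgn; exact: nd.
  - move=> x _; have := chord2_ge0 x; rewrite le_eqVlt => /predU1P[u0|u0].
      (* At a zero of [chord2] the power is 0 by convention while the limit is infinite; the
         inequality has the right direction. *)
      rewrite -u0 powR0 ?oppr_eq0 ?invr_eq0 ?pnatr_eq0//.
      apply: lime_ge; first by apply: ereal_nondecreasing_is_cvgn; exact: nd.
      by apply: nearW => n; rewrite lee_fin powR_ge0.
    suff : (fun n => (q (e n) x)%:E) @ \oo --> (chord2 x `^ (- 4^-1))%:E.
      by move/cvg_lim => ->.
    apply: cvg_EFin; first exact: nearW.
    have ce : (chord2 x + e n) @[n --> \oo] --> chord2 x.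
      rewrite -[X in _ --> X]addr0; apply: cvgD; first exact: cvg_cst.
      exact: cvg_harmonic.
    have ct : {for chord2 x, continuous (fun y : R => y `^ (- 4^-1))}.
      apply/differentiable_continuous/derivable1_diffP.
      by apply: ex_derive; exact: is_derive1_powR.
    exact: (cvg_comp _ _ ce ct).
have /cvg_lim <- // := @cvg_monotone_convergence _ _ R leb `[0%R, 1%R]%classic (measurable_itv _)
  (fun n x => (q (e n) x)%:E) mq (fun n x _ => powR_ge0 _ _) (fun x _ n m => @nd x n m).
apply: lime_le.
  apply: ereal_nondecreasing_is_cvgn => n m nm; apply: ge0_le_integral => //.
  - by move=> x _; rewrite lee_fin powR_ge0.
  - by move=> x _; exact: nd.
by apply: nearW => n; exact: integral_chord2_eps_le.
Qed.

End chord_square.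

Section circle_weight.
Context {R : realType}.
Notation leb := (@lebesgue_measure R).
Notation T := (measurableTypeR R).
Notation U := (@chord2 R).
Implicit Types (n : nat) (x y a k e d : R).

(* The shift [e > 0] makes the integrand smooth when [a] or [k] is negative; the  *)
(* integration by parts takes place there and is followed by [e --> 0].           *)
Definition circle_weight n a k e (t : n.-tuple T) : R :=
  (\prod_(j < n) (U (tnth t j) + e) `^ a) *
  \prod_(i < n) \prod_(j < n | (i < j)%N) (U (tnth t i - tnth t j) + e) `^ k.

Lemma circle_weight_ge0 n a k e (t : n.-tuple T) : 0 <= circle_weight a k e t.
Proof.
by apply: mulr_ge0; apply: prodr_ge0 => i _; [|apply: prodr_ge0 => j _]; exact: powR_ge0.
Qed.

Lemma chord2_add_gt0 e x : 0 < e -> 0 < U x + e.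
Proof. by move=> e0; rewrite ltr_wpDl// chord2_ge0. Qed.

Lemma measurable_chord2_powR e a : measurable_fun setT (fun x => (U x + e) `^ a).
Proof.
apply: (measurableT_comp (measurable_powR a)).
by apply: measurable_funD => //; exact: measurable_chord2.
Qed.

Lemma measurable_circle_weight n a k e : measurable_fun setT (@circle_weight n a k e).
Proof.
apply: measurable_funM.
  apply: measurable_prod => j _.
  by apply: (measurableT_comp (measurable_chord2_powR e a)); exact: measurable_tnth.
apply: measurable_prod => i _.
under eq_fun do rewrite big_mkcond/=.
apply: measurable_prod => j _; case: (i < j)%N; last exact: measurable_cst.
apply: (measurableT_comp (measurable_chord2_powR e k)).
by apply: measurable_funB; exact: measurable_tnth.
Qed.

Lemma circle_weight_cons n a k e x (t : n.-tuple T) :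
  circle_weight a k e (tuple_cons (x, t)) =
  (U x + e) `^ a * \prod_(j < n) (U (x - tnth t j) + e) `^ k * circle_weight a k e t.
Proof.
pose s := tuple_cons (x, t).
have e1 : \prod_(j < n.+1) (U (tnth s j) + e) `^ a =
    (U x + e) `^ a * \prod_(j < n) (U (tnth t j) + e) `^ a.
  rewrite big_ord_recl tnth_tuple_cons0; congr (_ * _).
  by apply: eq_bigr => j _; rewrite tnth_tuple_consS.
have e2 : \prod_(i < n.+1) \prod_(j < n.+1 | (i < j)%N) (U (tnth s i - tnth s j) + e) `^ k =
    (\prod_(j < n) (U (x - tnth t j) + e) `^ k) *
    \prod_(i < n) \prod_(j < n | (i < j)%N) (U (tnth t i - tnth t j) + e) `^ k.
  rewrite big_ord_recl; congr (_ * _).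
    rewrite big_mkcond big_ord_recl /= mul1r; apply: eq_bigr => j _.
    by rewrite tnth_tuple_cons0 tnth_tuple_consS.
  apply: eq_bigr => i _; rewrite big_mkcond big_ord_recl /= mul1r [RHS]big_mkcond.
  by apply: eq_bigr => j _; rewrite !tnth_tuple_consS.
by rewrite /circle_weight e1 e2 mulrACA !mulrA.
Qed.

(** The product over [i < j] is not visibly symmetric, but its square is the product over all
    [j != i], which is. Nonnegativity allows the square root to be taken. *)
Lemma prod_lt_perm n (G : 'I_n -> 'I_n -> R) (s : 'S_n) :
  (forall i j, G i j = G j i) -> (forall i j, 0 <= G i j) ->
  \prod_(i < n) \prod_(j < n | (i < j)%N) G (s i) (s j) =
  \prod_(i < n) \prod_(j < n | (i < j)%N) G i j.
Proof.
move=> GC G0.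
have sq (F : 'I_n -> 'I_n -> R) : (forall i j, F i j = F j i) ->
    (\prod_(i < n) \prod_(j < n | (i < j)%N) F i j) ^+ 2 =
    \prod_(i < n) \prod_(j < n | j != i) F i j.
  move=> FC; rewrite expr2 {2}(exchange_big_dep xpredT)//= -big_split/=.
  apply: eq_bigr => i _; rewrite [RHS](bigID (fun j : 'I_n => (i < j)%N))/=; congr (_ * _).
    by apply: eq_bigl => j; rewrite -(inj_eq val_inj); case: ltngtP.
  apply: eq_big => [j|j _]; last exact: FC.
  by rewrite -(inj_eq val_inj); case: ltngtP.
have ge0 (F : 'I_n -> 'I_n -> R) : (forall i j, 0 <= F i j) ->
    0 <= \prod_(i < n) \prod_(j < n | (i < j)%N) F i j.
  by move=> F0; apply: prodr_ge0 => i _; apply: prodr_ge0 => j _.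
apply/eqP; rewrite -(@eqrXn2 _ 2)// ?ge0//.
rewrite (sq (fun i j => G (s i) (s j)))// sq//; apply/eqP.
rewrite [RHS](reindex_inj (@perm_inj _ s))/=; apply: eq_bigr => i _.
rewrite [RHS](reindex_inj (@perm_inj _ s))/=; apply: eq_bigl => j.
by rewrite (inj_eq perm_inj).
Qed.

Lemma circle_weight_perm n a k e (s : 'S_n) (t : n.-tuple T) :
  circle_weight a k e (tuple_perm s t) = circle_weight a k e t.
Proof.
rewrite /circle_weight; congr (_ * _).
  under eq_bigr do rewrite tnth_tuple_perm.
  by rewrite [RHS](reindex_inj (@perm_inj _ s)).
under eq_bigr do under eq_bigr do rewrite !tnth_tuple_perm.
rewrite (prod_lt_perm s (G := fun i j => (U (tnth t i - tnth t j) + e) `^ k))//.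
  by move=> i j; rewrite -chord2N opprB.
by move=> i j; exact: powR_ge0.
Qed.

Lemma chord2_powR_bounded a e : 0 < e -> exists C, 0 <= C /\
  forall x, (U x + e) `^ a <= C.
Proof.
(* [U x + e] ranges over [[e, 4 + e]] and a power is monotone there; the sum of the two end values
   covers both signs of [a]. *)
move=> e0; exists (e `^ a + (4 + e) `^ a); split; first by rewrite addr_ge0 ?powR_ge0.
move=> x; have u0 := chord2_ge0 x; have u4 := chord2_le4 x.
have e4 : 0 < 4 + e by lra.
have [a0|a0] := leP 0 a.
  apply: (@le_trans _ _ ((4 + e) `^ a)); last by rewrite lerDr powR_ge0.
  have p := chord2_add_gt0 x e0.
  apply: ge0_ler_powR => //; [by rewrite nnegrE ltW|by rewrite nnegrE ltW|lra].
apply: (@le_trans _ _ (e `^ a)); last by rewrite lerDl powR_ge0.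
rewrite -[a]opprK !(powRN _ (- a)) lef_pV2 ?posrE ?powR_gt0 ?chord2_add_gt0//.
have p := chord2_add_gt0 x e0.
apply: ge0_ler_powR; [lra|by rewrite nnegrE ltW|by rewrite nnegrE ltW|lra].
Qed.

Lemma circle_weight_bounded n a k e : 0 < e -> exists C, 0 <= C /\
  forall t : n.-tuple T, circle_weight a k e t <= C.
Proof.
move=> e0; have [A [A0 HA]] := chord2_powR_bounded a e0.
have [K [K0 HK]] := chord2_powR_bounded k e0.
exists ((\prod_(j < n) A) * \prod_(i < n) \prod_(j < n | (i < j)%N) K); split.
  by apply: mulr_ge0; apply: prodr_ge0 => i _ //; apply: prodr_ge0.
move=> t; apply: ler_pM.
- by apply: prodr_ge0 => i _; exact: powR_ge0.
- by apply: prodr_ge0 => i _; apply: prodr_ge0 => j _; exact: powR_ge0.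
- by apply: ler_prod => i _; rewrite powR_ge0 HA.
- apply: ler_prod => i _; apply/andP; split.
    by apply: prodr_ge0 => j _; exact: powR_ge0.
  by apply: ler_prod => j _; rewrite powR_ge0 HK.
Qed.

(** No coordinate is an integer and no two agree modulo 1. Elsewhere the weight with [e = 0]
    contains powers of 0, which are 0 or 1 by convention. *)
Definition generic_position n (t : n.-tuple T) :=
  (forall j, 0 < U (tnth t j)) /\
  (forall i j, i != j -> 0 < U (tnth t i - tnth t j)).

Lemma chord2_gt0 x : 0 < x < 1 -> 0 < U x.
Proof.
move=> /andP[x0 x1]; have pi0 := pi_gt0 R.
have -> : U x = 4 * sin (pi * x) ^+ 2.
  have -> : U x = 2 - 2 * cos ((pi * x) *+ 2).
    by rewrite /chord2 mulr2n; congr (2 - 2 * cos _); ring.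
  have := cos2Dsin2 (pi * x); rewrite cos_mulr2n.
  move: (cos _) (sin _) => c s H; have -> : c ^+ 2 = 1 - s ^+ 2 by rewrite -H; ring.
  by ring.
rewrite mulr_gt0// exprn_gt0// sin_gt0_pi//; apply/andP; split; first exact: mulr_gt0.
by rewrite -[ltRHS]mulr1 ltr_pM2l.
Qed.

(** The indicator of the zeros of [U]. Its integral in one variable is 0, so the marginal lemmas
    make each failure of generic position a null set. *)
Let zero_chord x : \bar R := ((U x == 0)%:R)%:E.

Let zero_chord_int : (\int[leb]_(x in `[0%R, 1%R]) zero_chord x = 0)%E.
Proof.
have mz (D : set T) : measurable_fun D zero_chord.
  apply/measurable_EFinP; apply: measurable_funTS.
  rewrite (_ : (fun _ => _) = \1_(U @^-1` [set 0])).
    apply: measurable_indic; rewrite -[X in measurable X]setTI.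
    exact: measurable_chord2.
  apply/funext => x; rewrite indicE; congr ((nat_of_bool _)%:R).
  by apply/eqP/idP => [u0|/set_mem//]; exact/mem_set.
rewrite -integral_itv_bndo_bndc; last exact: mz.
rewrite -integral_itv_obnd_cbnd; last exact: mz.
apply: integral0_eq => x /=; rewrite in_itv/= => /chord2_gt0 u0.
by rewrite /zero_chord gt_eqF.
Qed.

Lemma ae_generic_position n :
  {ae lebesgue_tuple R n, forall t, @unit_cube R n t -> generic_position t}.
Proof.
have mz : measurable_fun setT zero_chord.
  apply/measurable_EFinP.
  rewrite (_ : (fun _ => _) = \1_(U @^-1` [set 0])).
    apply: measurable_indic; rewrite -[X in measurable X]setTI.
    exact: measurable_chord2.
  apply/funext => x; rewrite indicE; congr ((nat_of_bool _)%:R).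
  by apply/eqP/idP => [u0|/set_mem//]; exact/mem_set.
have z0 x : (0 <= zero_chord x)%E by rewrite lee_fin.
have ae (f : n.-tuple T -> R) : measurable_fun setT f ->
    cube_integral (fun t => zero_chord (f t)) = 0%E ->
    {ae lebesgue_tuple R n, forall t, @unit_cube R n t -> 0 < U (f t)}.
  move=> mf f0.
  have : ae_eq (lebesgue_tuple R n) (@unit_cube R n) (fun t => zero_chord (f t)) (cst 0%E).
    apply/(ae_eq_integral_abs _ (@measurable_unit_cube R n)).
      by apply: measurable_funTS; exact: measurableT_comp mz mf.
    by rewrite -[RHS]f0; apply: eq_integral => t _; rewrite gee0_abs.
  apply: filterS => t H tc; have := H tc; rewrite /zero_chord => -[].
  case: eqP => [_ /eqP|/eqP u0 _]; first by rewrite oner_eq0.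
  by rewrite lt_neqAle eq_sym u0 chord2_ge0.
have h1 : {ae lebesgue_tuple R n, forall t, forall j, @unit_cube R n t -> 0 < U (tnth t j)}.
  apply: filter_forall => j; apply: ae; first exact: measurable_tnth.
  by rewrite cube_integral_marginal1.
have h2 : {ae lebesgue_tuple R n, forall t, forall (p : 'I_n * 'I_n),
    @unit_cube R n t -> p.1 != p.2 -> 0 < U (tnth t p.1 - tnth t p.2)}.
  apply: filter_forall => -[i j] /=; have [_|ij] := eqVneq i j.
    by apply: nearW.
  have : {ae lebesgue_tuple R n, forall t, @unit_cube R n t -> 0 < U (tnth t i - tnth t j)}.
    apply: ae; first by apply: measurable_funB; exact: measurable_tnth.
    rewrite cube_integral_marginal2//.
      by move=> x; rewrite /zero_chord chord2_add1.
    by move=> x; rewrite /zero_chord chord2N.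
  by apply: filterS => t H tc _; exact: H.
apply: filterS2 h1 h2 => t H1 H2 tc; split => [j|i j]; first exact: H1.
exact: (H2 (i, j)).
Qed.

End circle_weight.

Lemma cvg_rprod {R : realType} {T I : Type} (F : set_system T) (FF : Filter F)
    (r : seq I) (P : pred I) (f : I -> T -> R) (l : I -> R) :
  (forall i, P i -> f i x @[x --> F] --> l i) ->
  \prod_(i <- r | P i) f i x @[x --> F] --> \prod_(i <- r | P i) l i.
Proof.
move=> fl; elim: r => [|i r IHr].
  rewrite big_nil (_ : (fun _ => _) = cst 1); first exact: cvg_cst.
  by apply/funext => x; rewrite big_nil.
rewrite big_cons (_ : (fun _ => _) = (fun x => if P i then
  f i x * \prod_(j <- r | P j) f j x else \prod_(j <- r | P j) f j x)).
  by case: ifPn => // Pi; apply: cvgM => //; exact: fl.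
by apply/funext => x; rewrite big_cons.
Qed.

Lemma ler_prod_const {R : realType} n (P : pred 'I_n) (f : 'I_n -> R) (c : R) :
  1 <= c -> (forall i, P i -> 0 <= f i <= c) -> \prod_(i | P i) f i <= c ^+ n.
Proof.
move=> c1 fc; have c0 : 0 <= c by lra.
apply: (@le_trans _ _ (\prod_(i < n) c)); last by rewrite prodr_const card_ord.
rewrite big_mkcond; apply: ler_prod => i _; case: ifPn => [/fc//|_].
by rewrite ler01.
Qed.

(** * An integrable majorant and the limit [e --> 0] *)

Section circle_weight_limit.
Context {R : realType}.
Notation leb := (@lebesgue_measure R).
Notation T := (measurableTypeR R).
Notation U := (@chord2 R).
Implicit Types (n : nat) (x y a k e d : R).

Let q x : R := U x `^ (- 4^-1).

(** A sum of singular functions, unlike their product, is integrable by one-dimensional integrals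
    alone, and it dominates each of them. The summand 1 makes its powers increase with the
    exponent. *)
Definition chord_majorant n (t : n.-tuple T) : R :=
  1 + (\sum_(j < n) q (tnth t j) +
       \sum_(p : 'I_n * 'I_n | p.1 != p.2) q (tnth t p.1 - tnth t p.2)).

Let measurable_q : measurable_fun setT q.
Proof. exact: (measurableT_comp (measurable_powR (- 4^-1)) measurable_chord2). Qed.

Lemma chord_majorant_integrable n :
  (lebesgue_tuple R n).-integrable (@unit_cube R n) (EFin \o @chord_majorant n).
Proof.
have mC := @measurable_unit_cube R n.
have iq (f : n.-tuple T -> R) : measurable_fun setT f ->
    cube_integral (fun t => (q (f t))%:E) = (\int[leb]_(x in `[0%R, 1%R]) (q x)%:E)%E ->
    (lebesgue_tuple R n).-integrable (@unit_cube R n) (fun t => (q (f t))%:E).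
  move=> mf e; apply/integrableP; split.
    by apply: measurable_funTS; apply/measurable_EFinP; exact: measurableT_comp.
  under eq_integral do rewrite gee0_abs ?lee_fin ?powR_ge0//.
  by rewrite -/(cube_integral _) e; exact: integral_chord2_lty.
have mqE : measurable_fun setT (EFin \o q) by exact/measurable_EFinP.
have q0 x : (0 <= (EFin \o q) x)%E by rewrite lee_fin powR_ge0.
rewrite (_ : EFin \o _ = (fun t => 1%E + (\sum_(j < n) (q (tnth t j))%:E +
    \sum_(p : 'I_n * 'I_n | p.1 != p.2) (q (tnth t p.1 - tnth t p.2))%:E))%E); last first.
  by apply/funext => t; rewrite /chord_majorant /= !EFinD !sumEFin.
apply: integrableD => //.
  by apply: (@cube_integrable_bounded _ _ (cst 1) 1) => // t; rewrite normr1.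
apply: integrableD => //; apply: integrable_sum => //.
  move=> j _; apply: iq; first exact: measurable_tnth.
  exact: (@cube_integral_marginal1 _ _ j (EFin \o q)).
move=> [i j] /= ij; apply: iq; first by apply: measurable_funB; exact: measurable_tnth.
apply: (@cube_integral_marginal2 _ _ i j (EFin \o q)) => //.
  by move=> x /=; rewrite /q chord2_add1.
by move=> x /=; rewrite /q chord2N.
Qed.

Lemma chord_majorant_ge1 n (t : n.-tuple T) : 1 <= chord_majorant t.
Proof.
by rewrite lerDl addr_ge0// sumr_ge0// => i _; exact: powR_ge0.
Qed.

Let q_le_majorant1 n (t : n.-tuple T) j : q (tnth t j) <= chord_majorant t.
Proof.
rewrite /chord_majorant (bigD1 j)//= addrCA -!addrA lerDl.
by rewrite !addr_ge0// ?sumr_ge0// => i _; exact: powR_ge0.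
Qed.

Let q_le_majorant2 n (t : n.-tuple T) i j : i != j ->
  q (tnth t i - tnth t j) <= chord_majorant t.
Proof.
move=> ij; rewrite /chord_majorant (bigD1 (i, j))//= addrA [X in _ <= X]addrCA lerDl.
by rewrite !addr_ge0// ?sumr_ge0// => p _; exact: powR_ge0.
Qed.

(** The exponent is split as [(a + d) + (- d)]. The first part is nonnegative and [u + e <= 5]; for
    the second, [(u + e) ^ (- d)] is at most [u ^ (- d)], the [4 * d]-th power of
    [u ^ (- 1 / 4)]. *)
Let factor_le a d e u m : 0 < u -> u <= 4 -> 0 <= e <= 1 -> 0 <= d -> - d <= a ->
  1 <= m -> u `^ (- 4^-1) <= m -> (u + e) `^ a <= 5 `^ (a + d) * m `^ (4 * d).
Proof.
move=> u0 u4 /andP[e0 e1] d0 da m1 um.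
have ue : 0 < u + e by lra.
have -> : a = (a + d) + (- d) by ring.
rewrite powRD; last by apply/implyP => _; rewrite gt_eqF.
rewrite subrK; apply: ler_pM; rewrite ?powR_ge0//.
  by apply: ge0_ler_powR; rewrite ?nnegrE; lra.
apply: (@le_trans _ _ (u `^ (- d))).
  rewrite !powRN lef_pV2 ?posrE ?powR_gt0//.
  by apply: ge0_ler_powR; rewrite ?nnegrE; lra.
have -> : - d = - 4^-1 * (4 * d) by field.
rewrite (powRrM u); apply: ge0_ler_powR; rewrite ?nnegrE ?powR_ge0//; lra.
Qed.

(* Each of the at most [n + n * n] factors is at most a constant times the        *)
(* [4 * d]-th power of the majorant, hence the condition on [d].                  *)
Lemma circle_weight_le_majorant n a k d : 0 <= d -> 4 * d * (n + n * n)%:R <= 1 ->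
  - d <= a -> - d <= k -> exists C, 0 <= C /\ forall e (t : n.-tuple T),
    0 <= e <= 1 -> generic_position t -> circle_weight a k e t <= C * chord_majorant t.
Proof.
move=> d0 dn da dk.
exists ((5 `^ (a + d)) ^+ n * ((5 `^ (k + d)) ^+ n) ^+ n); split.
  by rewrite mulr_ge0 ?exprn_ge0// powR_ge0.
move=> e t e01 [g1 g2]; set m := chord_majorant t.
have m1 : 1 <= m := chord_majorant_ge1 t.
have M1 : 1 <= m `^ (4 * d).
  by rewrite -[leLHS](powRr0 m); apply: ler_powR => //; lra.
have C1 b : - d <= b -> 1 <= (5 : R) `^ (b + d) * m `^ (4 * d).
  move=> db; rewrite -[leLHS]mulr1; apply: ler_pM => //.
  by rewrite -[leLHS](powRr0 5); apply: ler_powR; lra.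
apply: (@le_trans _ _ ((5 `^ (a + d) * m `^ (4 * d)) ^+ n *
   ((5 `^ (k + d) * m `^ (4 * d)) ^+ n) ^+ n)).
  apply: ler_pM.
  - by apply: prodr_ge0 => i _; exact: powR_ge0.
  - by apply: prodr_ge0 => i _; apply: prodr_ge0 => j _; exact: powR_ge0.
  - apply: ler_prod_const; first exact: C1.
    move=> j _; rewrite powR_ge0/=; apply: factor_le => //; first exact: chord2_le4.
    exact: q_le_majorant1.
  - apply: ler_prod_const.
      by apply: exprn_ege1; exact: C1.
    move=> i _; apply/andP; split; first by apply: prodr_ge0 => j _; exact: powR_ge0.
    apply: ler_prod_const; first exact: C1.
    move=> j ij; rewrite powR_ge0/=.
    have nij : i != j by rewrite -(inj_eq val_inj) neq_ltn ij.
    apply: factor_le => //; [exact: g2|exact: chord2_le4|exact: q_le_majorant2].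
rewrite !exprMn mulrACA -!mulrA; apply: ler_wpM2l; first by rewrite exprn_ge0// powR_ge0.
apply: ler_wpM2l; first by rewrite !exprn_ge0// powR_ge0.
rewrite -exprM -exprD -powR_mulrn ?powR_ge0// -powRrM.
rewrite -[leRHS](@powRr1 _ m); last by lra.
by apply: ler_powR.
Qed.

Lemma circle_weight_cvg n a k (t : n.-tuple T) : generic_position t ->
  circle_weight a k m.+1%:R^-1 t @[m --> \oo] --> circle_weight a k 0 t.
Proof.
move=> [g1 g2].
have cf b x : 0 < U x -> (U x + m.+1%:R^-1) `^ b @[m --> \oo] --> (U x + 0) `^ b.
  move=> u0.
  have c1 : (U x + m.+1%:R^-1) @[m --> \oo] --> U x + 0.
    by apply: cvgD; [exact: cvg_cst|exact: cvg_harmonic].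
  have c2 : {for U x + 0, continuous (fun y : R => y `^ b)}.
    apply/differentiable_continuous/derivable1_diffP.
    by apply: ex_derive; apply: is_derive1_powR; rewrite addr0.
  exact: (cvg_comp _ _ c1 c2).
apply: cvgM.
  by apply: cvg_rprod => j _; exact: cf.
apply: cvg_rprod => i _; apply: cvg_rprod => j ij; apply: cf; apply: g2.
by rewrite -(inj_eq val_inj) neq_ltn ij.
Qed.

Definition cube_mean n (f : n.-tuple T -> R) : R := fine (cube_integral (fun t => (f t)%:E)).

(** Dominated convergence under a multiple of [chord_majorant]. The factors [w m] are meant for the
    quotients [U / (U + e)] that the derivative of the regularised weight leaves behind. *)
Lemma cube_mean_cvg n a k d (h : n.-tuple T -> R) (w : nat -> n.-tuple T -> R) M :
  0 <= d -> 4 * d * (n + n * n)%:R <= 1 -> - d <= a -> - d <= k ->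
  measurable_fun setT h -> (forall t, `|h t| <= M) ->
  (forall m, measurable_fun setT (w m)) -> (forall m t, `|w m t| <= 1) ->
  (forall t, generic_position t -> w m t @[m --> \oo] --> (1 : R)) ->
  (lebesgue_tuple R n).-integrable (@unit_cube R n)
    (fun t => (h t * circle_weight a k 0 t)%:E) /\
  cube_mean (fun t => h t * w m t * circle_weight a k m.+1%:R^-1 t) @[m --> \oo] -->
  cube_mean (fun t => h t * circle_weight a k 0 t).
Proof.
move=> d0 dn da dk mh hM mw w1 wl.
have [C [C0 HC]] := circle_weight_le_majorant d0 dn da dk.
have M0 : 0 <= M by apply: le_trans (hM [tuple 0 | i < n]); exact: normr_ge0.
pose f_ m (t : n.-tuple T) := (h t * w m t * circle_weight a k m.+1%:R^-1 t)%:E.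
pose f (t : n.-tuple T) := (h t * circle_weight a k 0 t)%:E.
pose g (t : n.-tuple T) := ((M * C)%:E * (chord_majorant t)%:E)%E.
have mf_ m : measurable_fun (@unit_cube R n) (f_ m).
  apply: measurable_funTS; apply/measurable_EFinP; apply: measurable_funM.
    exact: measurable_funM.
  exact: measurable_circle_weight.
have mf : measurable_fun (@unit_cube R n) f.
  apply: measurable_funTS; apply/measurable_EFinP; apply: measurable_funM => //.
  exact: measurable_circle_weight.
have gen := ae_generic_position (R := R) n.
have f_f : {ae lebesgue_tuple R n, forall t, @unit_cube R n t -> f_ ^~ t @ \oo --> f t}.
  apply: filterS gen => t gt tc; have {}gt := gt tc.
  apply: cvg_EFin; first exact: nearW.
  apply: cvgM; last exact: circle_weight_cvg.
  by rewrite -[X in _ --> X]mulr1; apply: cvgMr; exact: wl.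
have ig : (lebesgue_tuple R n).-integrable (@unit_cube R n) g.
  by apply: integrableZl; [exact: measurable_unit_cube|exact: chord_majorant_integrable].
have f_g : {ae lebesgue_tuple R n, forall t m, @unit_cube R n t -> (`|f_ m t| <= g t)%E}.
  apply: filterS gen => t gt m tc; have {}gt := gt tc.
  have W0 := circle_weight_ge0 a k m.+1%:R^-1 t.
  have WC : circle_weight a k m.+1%:R^-1 t <= C * chord_majorant t.
    by apply: HC => //; rewrite invr_ge0 ler0n invf_le1// ler1n.
  rewrite /f_ /g -EFinM /= lee_fin; move: (circle_weight _ _ _ _) W0 WC => W W0 WC.
  rewrite !normrM (ger0_norm W0) -!mulrA; apply: ler_pM => //.
    by rewrite mulr_ge0.
  by rewrite -[leRHS]mul1r; apply: ler_pM.
have [fi _ fc] := dominated_convergence (@measurable_unit_cube R n) mf_ mf f_f ig f_g.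
split; first exact: fi.
rewrite /cube_mean; apply: fine_cvg; rewrite fineK; first exact: fc.
by apply: integrable_fin_num fi; exact: measurable_unit_cube.
Qed.

End circle_weight_limit.

Section bounded_measurable.
Context {R : realType} d (S : measurableType d).
Implicit Types (f g : S -> R) (F G : S -> R[i]).

(** For fixed [e > 0] the integrands all lie in this class, which is closed under sums and products,
    so integrability over the cube is automatic there. *)
Definition bounded_measurable f :=
  measurable_fun setT f /\ exists M : R, forall t, `|f t| <= M.

Lemma bounded_measurable_cst (c : R) : bounded_measurable (fun=> c).
Proof. by split => //; exists `|c|. Qed.

Lemma bounded_measurableD f g : bounded_measurable f -> bounded_measurable g ->
  bounded_measurable (fun t => f t + g t).
Proof.
move=> [mf [M fM]] [mg [N gN]]; split; first exact: measurable_funD.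
by exists (M + N) => t; rewrite (le_trans (ler_normD _ _))// lerD.
Qed.

Lemma bounded_measurableM f g : bounded_measurable f -> bounded_measurable g ->
  bounded_measurable (fun t => f t * g t).
Proof.
move=> [mf [M fM]] [mg [N gN]]; split; first exact: measurable_funM.
by exists (M * N) => t; rewrite normrM ler_pM.
Qed.

Lemma bounded_measurableN f : bounded_measurable f ->
  bounded_measurable (fun t => - f t).
Proof.
move=> [mf [M fM]]; split; first exact: measurableT_comp.
by exists M => t; rewrite normrN.
Qed.

Lemma bounded_measurable_sum (I : Type) (r : seq I) (f : I -> S -> R) :
  (forall i, bounded_measurable (f i)) ->
  bounded_measurable (fun t => \sum_(i <- r) f i t).
Proof.
move=> bf; elim: r => [|i r IHr].
  by under eq_fun do rewrite big_nil; exact: bounded_measurable_cst.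
by under eq_fun do rewrite big_cons; exact: bounded_measurableD.
Qed.

Definition complex_bounded_measurable F :=
  bounded_measurable (fun t => complex.Re (F t)) /\
  bounded_measurable (fun t => complex.Im (F t)).

Lemma complex_ReM (x y : R[i]) : complex.Re (x * y) =
  complex.Re x * complex.Re y - complex.Im x * complex.Im y.
Proof. by case: x y => [a b] [c d']. Qed.

Lemma complex_ImM (x y : R[i]) : complex.Im (x * y) =
  complex.Re x * complex.Im y + complex.Im x * complex.Re y.
Proof. by case: x y => [a b] [c d']. Qed.

Lemma complex_ReD (x y : R[i]) : complex.Re (x + y) = complex.Re x + complex.Re y.
Proof. by case: x y => [a b] [c d']. Qed.

Lemma complex_ImD (x y : R[i]) : complex.Im (x + y) = complex.Im x + complex.Im y.
Proof. by case: x y => [a b] [c d']. Qed.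

Lemma complex_ReN (x : R[i]) : complex.Re (- x) = - complex.Re x.
Proof. by case: x. Qed.

Lemma complex_ImN (x : R[i]) : complex.Im (- x) = - complex.Im x.
Proof. by case: x. Qed.

Lemma complex_bounded_measurableM F G :
  complex_bounded_measurable F -> complex_bounded_measurable G ->
  complex_bounded_measurable (fun t => F t * G t).
Proof.
move=> [F1 F2] [G1 G2]; split.
  under eq_fun do rewrite complex_ReM.
  by apply: bounded_measurableD; [|apply: bounded_measurableN]; exact: bounded_measurableM.
under eq_fun do rewrite complex_ImM.
by apply: bounded_measurableD; exact: bounded_measurableM.
Qed.

Lemma complex_bounded_measurable_prod (I : Type) (r : seq I) (F : I -> S -> R[i]) :
  (forall i, complex_bounded_measurable (F i)) ->
  complex_bounded_measurable (fun t => \prod_(i <- r) F i t).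
Proof.
move=> bF; elim: r => [|i r IHr].
  by under eq_fun do rewrite big_nil; split; exact: bounded_measurable_cst.
by under eq_fun do rewrite big_cons; exact: complex_bounded_measurableM.
Qed.
End bounded_measurable.

Lemma bounded_measurable_comp {R : realType} d d' (S : measurableType d)
    (S' : measurableType d') (f : S' -> R) (g : S -> S') :
  measurable_fun setT g -> bounded_measurable f -> bounded_measurable (fun t => f (g t)).
Proof.
move=> mg [mf [M fM]]; split; first exact: measurableT_comp mf mg.
by exists M => t; exact: fM.
Qed.

Section log_derivative.
Context {R : realType}.
Notation U := (@chord2 R).
Implicit Types (x e a k : R).

(* The logarithmic derivative of [U x + e], divided by [2 * pi]. *)
Definition chord_kernel e x : R := 2 * sin (2 * pi * x) / (U x + e).

Lemma is_derive_mulr (f g : R -> R) x (df dg : R) : is_derive x 1 f df ->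
  is_derive x 1 g dg -> is_derive x 1 (fun y => f y * g y) (f x * dg + df * g x).
Proof.
move=> Df Dg; apply: is_derive_eq (@is_deriveM _ _ _ _ _ _ _ _ Df Dg) _.
by rewrite /GRing.scale/= (mulrC df).
Qed.

Lemma is_derive_log_prod (I : Type) (r : seq I) (f g : I -> R -> R) x :
  (forall i, is_derive x 1 (f i) (f i x * g i x)) ->
  is_derive x 1 (fun y => \prod_(i <- r) f i y)
    ((\prod_(i <- r) f i x) * \sum_(i <- r) g i x).
Proof.
move=> D; elim: r => [|i r IHr].
  rewrite !big_nil mulr0 (_ : (fun _ => _) = cst 1); first exact: is_derive_cst.
  by apply/funext => y; rewrite big_nil.
rewrite !big_cons (_ : (fun _ => _) = f i * (fun y => \prod_(j <- r) f j y)); last first.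
  by apply/funext => y; rewrite big_cons.
have Di := D i.
apply: is_derive_eq; rewrite /GRing.scale/=; ring.
Qed.

Lemma is_derive_chord_factor a e x : 0 < e ->
  is_derive x 1 (fun x => (U x + e) `^ a)
    ((U x + e) `^ a * (2 * pi * (a * chord_kernel e x))).
Proof.
move=> e0; have D := is_derive_chord2_powR a x e0.
apply: is_derive_eq D _; congr (_ * _); rewrite /chord_kernel.
by move: (U x + e) (sin _) => u s; move: pi => p; ring.
Qed.

Lemma is_derive_chord_weight n a k e x (s : 'I_n -> R) : 0 < e ->
  is_derive x 1 (fun x => (U x + e) `^ a * \prod_(j < n) (U (x - s j) + e) `^ k)
    ((U x + e) `^ a * (\prod_(j < n) (U (x - s j) + e) `^ k) *
     (2 * pi * (a * chord_kernel e x + \sum_(j < n) k * chord_kernel e (x - s j)))).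
Proof.
move=> e0.
have D1 := is_derive_chord_factor a x e0.
have D2 : is_derive x 1 (fun y => \prod_(j < n) (U (y - s j) + e) `^ k)
    ((\prod_(j < n) (U (x - s j) + e) `^ k) *
     \sum_(j < n) 2 * pi * (k * chord_kernel e (x - s j))).
  apply: (@is_derive_log_prod _ _ (fun j y => (U (y - s j) + e) `^ k)
    (fun j y => 2 * pi * (k * chord_kernel e (y - s j)))) => j.
  apply: (@is_derive_shiftr _ (fun z => (U z + e) `^ k)).
  exact: is_derive_chord_factor.
apply: is_derive_eq (is_derive_mulr D1 D2) _; rewrite -mulr_sumr.
move: (\prod_(j < n) _) (\sum_(j < n) _) => P Q.
by move: (_ `^ a) (chord_kernel _ _) => A C; move: pi => p; ring.
Qed.

Lemma continuous_chord_kernel e : 0 < e -> continuous (chord_kernel e).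
Proof.
move=> e0 x; apply: cvgM; first by apply: cvgMr; exact: continuous_sin2pi.
apply: cvgV; first by rewrite gt_eqF// chord2_add_gt0.
by apply: cvgD; [exact: continuous_chord2|exact: cvg_cst].
Qed.

Lemma chord_kernelN e x : chord_kernel e (- x) = - chord_kernel e x.
Proof. by rewrite /chord_kernel chord2N mulrN sinN mulrN mulNr. Qed.

Lemma bounded_chord_kernel e : 0 < e -> bounded_measurable (chord_kernel e : measurableTypeR R -> R).
Proof.
move=> e0; split; first by apply: continuous_measurable_fun; exact: continuous_chord_kernel.
exists (2 / e) => x; rewrite /chord_kernel normrM.
apply: ler_pM => //; last first.
  rewrite normfV gtr0_norm ?chord2_add_gt0// lef_pV2 ?posrE ?chord2_add_gt0//.
  by rewrite lerDr chord2_ge0.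
rewrite normrM ger0_norm// ler_piMr// ler_norml.
by rewrite sin_geN1 sin_le1.
Qed.

Lemma bounded_circle_weight n a k e : 0 < e ->
  bounded_measurable (@circle_weight R n a k e).
Proof.
move=> e0; split; first exact: measurable_circle_weight.
have [C [C0 HC]] := @circle_weight_bounded R n a k e e0.
by exists C => t; rewrite ger0_norm ?circle_weight_ge0.
Qed.

End log_derivative.

Section cube_mean_linear.
Context {R : realType}.
Notation T := (measurableTypeR R).
Implicit Types (n : nat).

Definition cube_integrable n (f : n.-tuple T -> R) :=
  (lebesgue_tuple R n).-integrable (@unit_cube R n) (fun t => (f t)%:E).

Lemma cube_integrable_bm n (f : n.-tuple T -> R) : bounded_measurable f -> cube_integrable f.
Proof. by move=> [mf [M fM]]; exact: cube_integrable_bounded mf fM. Qed.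

Lemma cube_meanD n (f g : n.-tuple T -> R) : cube_integrable f -> cube_integrable g ->
  cube_mean (fun t => f t + g t) = cube_mean f + cube_mean g.
Proof.
move=> fi gi; have mC := @measurable_unit_cube R n.
rewrite /cube_mean /cube_integral; under eq_integral do rewrite EFinD.
by rewrite integralD// fineD// integrable_fin_num.
Qed.

Lemma cube_integrableD n (f g : n.-tuple T -> R) : cube_integrable f -> cube_integrable g ->
  cube_integrable (fun t => f t + g t).
Proof.
move=> fi gi; have mC := @measurable_unit_cube R n.
by rewrite /cube_integrable; under eq_fun do rewrite EFinD; exact: integrableD.
Qed.

Lemma cube_integrableZ n c (f : n.-tuple T -> R) : cube_integrable f ->
  cube_integrable (fun t => c * f t).
Proof.
move=> fi; have mC := @measurable_unit_cube R n.
by rewrite /cube_integrable; under eq_fun do rewrite EFinM; exact: integrableZl.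
Qed.

Lemma cube_meanZ n c (f : n.-tuple T -> R) : cube_integrable f ->
  cube_mean (fun t => c * f t) = c * cube_mean f.
Proof.
move=> fi; have mC := @measurable_unit_cube R n.
rewrite /cube_mean /cube_integral; under eq_integral do rewrite EFinM.
by rewrite integralZl// fineM// integrable_fin_num.
Qed.

Lemma cube_mean_sum n (I : Type) (r : seq I) (f : I -> n.-tuple T -> R) :
  (forall i, cube_integrable (f i)) ->
  cube_mean (fun t => \sum_(i <- r) f i t) = \sum_(i <- r) cube_mean (f i) /\
  cube_integrable (fun t => \sum_(i <- r) f i t).
Proof.
move=> fi; elim: r => [|i r [IH1 IH2]].
  rewrite big_nil; under eq_fun do rewrite big_nil.
  split; last by apply: cube_integrable_bm; exact: bounded_measurable_cst.
  rewrite /cube_mean (_ : cube_integral _ = 0%E)//.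
  by apply: integral0_eq.
rewrite big_cons; under eq_fun do rewrite big_cons.
by split; [rewrite cube_meanD// IH1|exact: cube_integrableD].
Qed.

Lemma eq_cube_mean n (f g : n.-tuple T -> R) : f =1 g -> cube_mean f = cube_mean g.
Proof. by move=> fg; rewrite (_ : f = g)//; apply/funext. Qed.

Lemma cube_mean0 n : cube_mean (fun _ : n.-tuple T => 0 : R) = 0.
Proof. by rewrite /cube_mean (_ : cube_integral _ = 0%E)//; exact: integral0_eq. Qed.

Lemma cube_mean_tperm n (i j : 'I_n) (f : n.-tuple T -> R) : measurable_fun setT f ->
  cube_mean (fun t => f (tuple_perm (tperm i j) t)) = cube_mean f.
Proof. by move=> mf; rewrite /cube_mean cube_integral_tperm_real. Qed.

End cube_mean_linear.

(** * Aomoto's recursion *)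

Section aomoto_step.
Context {R : realType}.
Notation T := (measurableTypeR R).
Notation U := (@chord2 R).
Notation Re := (@complex.Re R).
Notation Im := (@complex.Im R).
(* [D] is [X' / (2 pi i)] and [V] is [X * U' / (2 pi i U)].  The recursion is     *)
(* applied with [(X, Y) = (z, 1)] and with [(X, Y) = (U, z)], [z = 1 - e^(2 pi i x)]. *)
Variables (X Y D V : R -> R[i]) (sg c lam k : R).
Hypothesis dReX : forall x : R, is_derive x 1 (fun x => Re (X x)) (2 * pi * - Im (D x)).
Hypothesis dImX : forall x : R, is_derive x 1 (fun x => Im (X x)) (2 * pi * Re (D x)).
Hypothesis cReD : continuous (fun x => Re (D x)).
Hypothesis cImD : continuous (fun x => Im (D x)).
Hypothesis bX : @complex_bounded_measurable R _ T X.
Hypothesis bY : @complex_bounded_measurable R _ T Y.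
Hypothesis bD : @complex_bounded_measurable R _ T D.
Hypothesis bV : @complex_bounded_measurable R _ T V.
Hypothesis X_periodic : X 1 = X 0.
(** The logarithmic derivative of the weight has a pole where [U] vanishes. Multiplied by [X] it
    becomes [V] times [U / (U + e)], which stays bounded as [e] tends to 0. *)
Hypothesis X_sin : forall x : R,
  X x * (2 * sin (2 * pi * x))%:C%C = 'i%C * (U x)%:C%C * V x.
(** The same cancellation on the diagonals, after antisymmetrising in [x] and [y]; the remaining
    factor is again a combination of products of [X] and [Y]. *)
Hypothesis XY_sin : forall x y : R,
  (X x * Y y - X y * Y x) * (2 * sin (2 * pi * (x - y)))%:C%C =
  'i%C * (sg * U (x - y))%:C%C * (X x * Y y + X y * Y x - (Y x * Y y + Y x * Y y)).
(** This closes the recursion: the one-coordinate terms combine to [X] and [Y] alone. The sign [sg]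
    is 1 for the pair [(z, 1)] and -1 for [(U, z)]. *)
Hypothesis DV : forall x : R,
  D x + lam%:C%C * V x = sg%:C%C * ((1 + lam)%:C%C * X x - c%:C%C * Y x).
Hypothesis sg_neq0 : sg != 0.

Implicit Types (x e : R).

Let Im_mul_real (z w : R[i]) (s : R) : Im (z * s%:C%C * w) = s * Im (z * w).
Proof. by case: z w => [a b] [p q]; rewrite !complex_ImM !complex_ReM /=; ring. Qed.

Let Im_mul_i (z w : R[i]) (u : R) : Im ('i%C * u%:C%C * z * w) = u * Re (z * w).
Proof. by case: z w => [a b] [p q]; rewrite !complex_ImM !complex_ReM /=; ring. Qed.

Let ratio e x : R := U x / (U x + e).

Let X_kernel e x (w : R[i]) : Im (X x * w) * chord_kernel e x = Re (V x * w) * ratio e x.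
Proof.
have /(congr1 (fun z => Im (z * w))) := X_sin x.
rewrite Im_mul_real Im_mul_i /chord_kernel /ratio => H.
by rewrite mulrA [Im _ * _]mulrC H mulrAC mulrC.
Qed.

Let XY_kernel e x y (w : R[i]) :
  Im ((X x * Y y - X y * Y x) * w) * chord_kernel e (x - y) =
  sg * (Re ((X x * Y y + X y * Y x - (Y x * Y y + Y x * Y y)) * w) * ratio e (x - y)).
Proof.
have /(congr1 (fun z => Im (z * w))) := XY_sin x y.
rewrite Im_mul_real Im_mul_i /chord_kernel /ratio => H.
by rewrite mulrA [Im _ * _]mulrC H [Re _ * _]mulrA [Re _ * _]mulrC !mulrA.
Qed.

Let bounded_ratio e : 0 < e -> bounded_measurable (ratio e : T -> R).
Proof.
move=> e0; split.
  apply: continuous_measurable_fun => x; apply: cvgM; first exact: continuous_chord2.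
  apply: cvgV; first by rewrite gt_eqF// chord2_add_gt0.
  by apply: cvgD; [exact: continuous_chord2|exact: cvg_cst].
exists 1 => x; rewrite ger0_norm; last first.
  by rewrite divr_ge0 ?chord2_ge0// ltW// chord2_add_gt0.
by rewrite ler_pdivrMr ?chord2_add_gt0// mul1r lerDl ltW.
Qed.

Let factor (b : bool) x := if b then X x else Y x.

Let bfactor b : @complex_bounded_measurable R _ T (factor b).
Proof. by case: b. Qed.

(** Aomoto's family interpolating between the product of all [Y] and the product of all [X]. *)
Definition mixed_prod n (b : pred 'I_n) (t : n.-tuple T) : R[i] :=
  \prod_(m < n) factor (b m) (tnth t m).

Let comp_tnth n (F : R -> R[i]) (m : 'I_n) : @complex_bounded_measurable R _ T F ->
  @complex_bounded_measurable R _ (n.-tuple T) (fun t => F (tnth t m)).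
Proof.
move=> [F1 F2]; split.
  exact: bounded_measurable_comp (measurable_tnth m) F1.
exact: bounded_measurable_comp (measurable_tnth m) F2.
Qed.

Let bmixed n (b : pred 'I_n) : complex_bounded_measurable (mixed_prod b).
Proof.
by apply: complex_bounded_measurable_prod => m; apply: (@comp_tnth n (factor (b m))).
Qed.

Section fixed_dimension.
Variables (n : nat) (b : pred 'I_n.+1).
Hypothesis b0 : b ord0.
Let tailp (t : n.+1.-tuple T) : R[i] :=
  \prod_(m < n) factor (b (lift ord0 m)) (tnth t (lift ord0 m)).
Let E := mixed_prod b.
Let b' (m : 'I_n.+1) := b m && (m != ord0).
Let E' := mixed_prod b'.
Let W e := @circle_weight R n.+1 lam k e.

Let EE t : E t = X (tnth t ord0) * tailp t.
Proof. by rewrite /E /mixed_prod big_ord_recl b0. Qed.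

Let E'E t : E' t = Y (tnth t ord0) * tailp t.
Proof.
have b'0 : b' ord0 = false by rewrite /b' eqxx andbF.
rewrite /E' /mixed_prod big_ord_recl b'0; congr (_ * _).
by apply: eq_bigr => m _; rewrite /b' (eq_sym _ ord0) neq_lift andbT.
Qed.

Let btail : complex_bounded_measurable tailp.
Proof.
by apply: complex_bounded_measurable_prod => m; apply: (@comp_tnth n.+1 (factor (b (lift ord0 m)))).
Qed.

(* The partial derivative of [Im (E t) * W e t] with respect to the coordinate    *)
(* [ord0], divided by [2 * pi].                                                   *)
Let field e (t : n.+1.-tuple T) : R :=
  (Re (D (tnth t ord0) * tailp t) +
   Im (E t) * (lam * chord_kernel e (tnth t ord0) +
     \sum_(j < n) k * chord_kernel e (tnth t ord0 - tnth t (lift ord0 j)))) * W e t.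

Let kernel0 e : 0 < e ->
  bounded_measurable (fun t : n.+1.-tuple T => chord_kernel e (tnth t ord0)).
Proof.
move=> e0; exact: bounded_measurable_comp (measurable_tnth ord0) (bounded_chord_kernel e0).
Qed.

Let measurable_diff (i j : 'I_n.+1) :
  measurable_fun setT (fun t : n.+1.-tuple T => tnth t i - tnth t j).
Proof. by apply: measurable_funB; exact: measurable_tnth. Qed.

Let kernel_diff e i j : 0 < e ->
  bounded_measurable (fun t : n.+1.-tuple T => chord_kernel e (tnth t i - tnth t j)).
Proof.
move=> e0; exact: bounded_measurable_comp (measurable_diff i j) (bounded_chord_kernel e0).
Qed.

Let bfield e : 0 < e -> bounded_measurable (field e).
Proof.
move=> e0; apply: bounded_measurableM (bounded_circle_weight _ _ _ e0).
have [bE1 bE2] := bmixed b.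
have bD0 : complex_bounded_measurable (fun t : n.+1.-tuple T => D (tnth t ord0) * tailp t).
  by apply: complex_bounded_measurableM btail; exact: comp_tnth.
apply: bounded_measurableD; first by case: bD0.
apply: bounded_measurableM => //; apply: bounded_measurableD.
  by apply: bounded_measurableM (kernel0 e0); exact: bounded_measurable_cst.
apply: bounded_measurable_sum => j.
by apply: bounded_measurableM (kernel_diff _ _ e0); exact: bounded_measurable_cst.
Qed.

(** With the other coordinates frozen, [field e] is a multiple of the derivative of a function of
    [ord0] with equal values at 0 and 1, so every slice integrates to 0. *)
Let field_mean0 e : 0 < e -> cube_mean (field e) = 0.
Proof.
move=> e0; have [mf [M fM]] := bfield e0.
rewrite /cube_mean (cube_integral_slice0 mf fM)// => t.
pose cr := Re (tailp (tuple_cons (0, t))); pose ci := Im (tailp (tuple_cons (0, t))).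
pose w := @circle_weight R n lam k e t.
have tailE x : tailp (tuple_cons (x, t)) = tailp (tuple_cons (0, t)).
  by apply: eq_bigr => m _; rewrite !tnth_tuple_consS.
pose P x := Re (X x) * ci + Im (X x) * cr.
pose dP x := 2 * pi * (Re (D x) * cr - Im (D x) * ci).
have dPE (x : R) : is_derive x 1 P (dP x).
  have := is_deriveD (is_derive_mulr (dReX x) (is_derive_cst ci x 1))
                     (is_derive_mulr (dImX x) (is_derive_cst cr x 1)).
  move=> H; apply: is_derive_eq H _; rewrite /cst !mulr0 !add0r /dP.
  by move: pi => p; ring.
pose G x := (U x + e) `^ lam * \prod_(j < n) (U (x - tnth t j) + e) `^ k.
pose g x := lam * chord_kernel e x + \sum_(j < n) k * chord_kernel e (x - tnth t j).
have dG (x : R) : is_derive x 1 G (G x * (2 * pi * g x)).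
  exact: is_derive_chord_weight.
have dF (x : R) : is_derive x 1 (fun x => P x * G x) (P x * (G x * (2 * pi * g x)) + dP x * G x).
  exact: is_derive_mulr.
have cP : continuous P by exact: derivable_continuous dPE.
have cG : continuous G by exact: derivable_continuous dG.
have cdP : continuous dP.
  by move=> x; apply: cvgMr; apply: cvgB; apply: cvgMl; [exact: cReD|exact: cImD].
have cg : continuous g.
  move=> x; apply: cvgD; first by apply: cvgMr; exact: continuous_chord_kernel.
  apply: cvg_rsum => j _; apply: cvgMr.
  apply: (@cvg_comp _ _ _ (fun y : R => y - tnth t j) (chord_kernel e)).
    by apply: cvgB; [exact: cvg_id|exact: cvg_cst].
  exact: continuous_chord_kernel.
have cF : continuous (fun x => P x * (G x * (2 * pi * g x)) + dP x * G x).
  move=> x; apply: cvgD; last by apply: cvgM; [exact: cdP|exact: cG].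
  apply: cvgM; first exact: cP.
  by apply: cvgM; [exact: cG|apply: cvgMr; exact: cg].
have G1 : G 1 = G 0.
  have := chord2_add1 (0 : R); rewrite /G add0r => ->; congr (_ * _).
  apply: eq_bigr => j _.
  by rewrite -(chord2_add1 (0 - tnth t j)) [0 - _ + 1]addrAC add0r.
have := integral01_derive dF cF.
rewrite G1 (_ : P 1 = P 0); last by rewrite /P X_periodic.
rewrite subrr => I0.
pose C := (2 * pi)^-1 * w.
have fieldE x : field e (tuple_cons (x, t)) = C * (P x * (G x * (2 * pi * g x)) + dP x * G x).
  rewrite /field EE tailE tnth_tuple_cons0 /W circle_weight_cons -/w -/(G x).
  under eq_bigr do rewrite tnth_tuple_consS.
  rewrite -/(g x) complex_ReM complex_ImM -/cr -/ci -/(P x) /C /dP.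
  have p0 : (2 * pi : R) != 0 by rewrite gt_eqF// mulr_gt0// pi_gt0.
  move: (2 * pi) p0 => p p0; by field.
under eq_integral do rewrite fieldE EFinM.
rewrite integralZl//; first by rewrite I0 mule0.
apply: continuous_compact_integrable; first exact: segment_compact.
exact: continuous_subspaceT.
Qed.

Variables (d : R).
Hypothesis d0 : 0 <= d.
Hypothesis dn : 4 * d * (n.+1 + n.+1 * n.+1)%:R <= 1.
Hypothesis dlam : - d <= lam.
Hypothesis dk : - d <= k.

Let eps m : R := m.+1%:R^-1.

Let eps_gt0 m : 0 < eps m. Proof. by rewrite invr_gt0. Qed.

Let ratio_le1 e x : 0 < e -> `|ratio e x| <= 1.
Proof.
move=> e0; rewrite ger0_norm; last first.
  by rewrite divr_ge0 ?chord2_ge0// ltW// chord2_add_gt0.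
by rewrite ler_pdivrMr ?chord2_add_gt0// mul1r lerDl ltW.
Qed.

Let ratio_cvg x : 0 < U x -> ratio (eps m) x @[m --> \oo] --> (1 : R).
Proof.
move=> u0; rewrite -(mulfV (lt0r_neq0 u0)); apply: cvgMr.
apply: cvgV; first by rewrite gt_eqF.
by rewrite -[X in _ --> X]addr0; apply: cvgD; [exact: cvg_cst|exact: cvg_harmonic].
Qed.

Let weighted_cvg (h : n.+1.-tuple T -> R) (f : n.+1.-tuple T -> T) :
  bounded_measurable h -> measurable_fun setT f ->
  (forall t, generic_position t -> 0 < U (f t)) ->
  cube_mean (fun t => h t * ratio (eps m) (f t) * W (eps m) t) @[m --> \oo] -->
  cube_mean (fun t => h t * W 0 t).
Proof.
move=> [mh [M hM]] mf fU.
have := @cube_mean_cvg R n.+1 lam k d h (fun m t => ratio (eps m) (f t)) M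
  d0 dn dlam dk mh hM.
move=> /(_ _ _ _)[| | |_]; last by apply.
- move=> m; apply: (measurableT_comp _ mf); by case: (bounded_ratio (eps_gt0 m)).
- by move=> m t; exact: ratio_le1.
- by move=> t /fU; exact: ratio_cvg.
Qed.

Let weighted_integrable (h : n.+1.-tuple T -> R) : bounded_measurable h ->
  cube_integrable (fun t => h t * W 0 t) /\
  cube_mean (fun t => h t * W (eps m) t) @[m --> \oo] --> cube_mean (fun t => h t * W 0 t).
Proof.
move=> [mh [M hM]].
have := @cube_mean_cvg R n.+1 lam k d h (fun m t => 1) M d0 dn dlam dk mh hM.
move=> /(_ _ _ _)[| | |hi hc].
- by move=> m; exact: measurable_cst.
- by move=> m t; rewrite normr1.
- by move=> t _; exact: cvg_cst.
split; first exact: hi.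
by move: hc; under eq_fun do under eq_cube_mean do rewrite mulr1.
Qed.

Let rest (j : 'I_n) (t : n.+1.-tuple T) : R[i] :=
  \prod_(m < n.+1 | (m != ord0) && (m != lift ord0 j)) factor (b m) (tnth t m).

Let mixed_split (p : pred 'I_n.+1) (j : 'I_n) t :
  (forall m, m != ord0 -> p m = b m) ->
  mixed_prod p t = factor (p ord0) (tnth t ord0) *
    factor (b (lift ord0 j)) (tnth t (lift ord0 j)) * rest j t.
Proof.
move=> pb; rewrite /mixed_prod (bigD1 ord0)//= (bigD1 (lift ord0 j))//= mulrA.
rewrite (pb (lift ord0 j))//; congr (_ * _); apply: eq_bigr => m /andP[m0 _].
by rewrite pb.
Qed.

Let swap (j : 'I_n) (t : n.+1.-tuple T) := tuple_perm (tperm ord0 (lift ord0 j)) t.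

Let rest_swap j t : rest j (swap j t) = rest j t.
Proof.
apply: eq_bigr => m /andP[m0 mj]; rewrite tnth_tuple_perm tpermD//.
  by rewrite eq_sym.
by rewrite eq_sym.
Qed.

Let tnth_swap0 j t : tnth (swap j t) ord0 = tnth t (lift ord0 j).
Proof. by rewrite tnth_tuple_perm tpermL. Qed.

Let tnth_swapj j t : tnth (swap j t) (lift ord0 j) = tnth t ord0.
Proof. by rewrite tnth_tuple_perm tpermR. Qed.

Let Esplit j t : E t = X (tnth t ord0) *
  factor (b (lift ord0 j)) (tnth t (lift ord0 j)) * rest j t.
Proof. by rewrite /E (@mixed_split b j)// b0. Qed.

Let E'split j t : E' t = Y (tnth t ord0) *
  factor (b (lift ord0 j)) (tnth t (lift ord0 j)) * rest j t.
Proof.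
have b'0 : b' ord0 = false by rewrite /b' eqxx andbF.
rewrite /E' (@mixed_split b' j) ?b'0// => m m0.
by rewrite /b' m0 andbT.
Qed.

(* Exchanging the coordinates [ord0] and [j] fixes the weight and reverses the    *)
(* sign of the kernel, which leaves the combination in [XY_sin].                  *)
Let pair_term e j (t : n.+1.-tuple T) : R :=
  Im (E t) * chord_kernel e (tnth t ord0 - tnth t (lift ord0 j)) * W e t.

(** When [j] carries [Y], this is the last factor of [XY_sin] times the untouched coordinates. Its
    weighted mean at [e = 0] is twice the difference of the means of [E] and [E']. *)
Let Q j t : R[i] := E t + E (swap j t) - (E' t + E' t).

Let measurable_swap j : measurable_fun setT (swap j).
Proof. exact: measurable_tuple_perm. Qed.

Let bQ j : bounded_measurable (fun t => Re (Q j t)).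
Proof.
have [E1 _] := bmixed b; have [E'1 _] := bmixed b'.
under eq_fun do rewrite /Q !(complex_ReD, complex_ReN).
apply: bounded_measurableD.
  by apply: (bounded_measurableD E1); exact: bounded_measurable_comp (measurable_swap j) E1.
by apply: bounded_measurableN; exact: bounded_measurableD.
Qed.

Let bpair e j : 0 < e -> bounded_measurable (pair_term e j).
Proof.
move=> e0; apply: bounded_measurableM (bounded_circle_weight _ _ _ e0).
by apply: bounded_measurableM (kernel_diff _ _ e0); case: (bmixed b).
Qed.

Let pair_mean e j : 0 < e -> cube_mean (pair_term e j) =
  if b (lift ord0 j) then 0 else sg / 2 * cube_mean (fun t =>
    Re (Q j t) * ratio e (tnth t ord0 - tnth t (lift ord0 j)) * W e t).
Proof.
move=> e0; have bp := bpair j e0.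
have bps : bounded_measurable (fun t => pair_term e j (swap j t)).
  exact: bounded_measurable_comp (measurable_swap j) bp.
have sw : cube_mean (fun t => pair_term e j (swap j t)) = cube_mean (pair_term e j).
  by apply: cube_mean_tperm; case: bp.
have -> : cube_mean (pair_term e j) = 2^-1 * cube_mean (fun t => pair_term e j t + pair_term e j (swap j t)).
  by rewrite cube_meanD ?sw; [field|exact: cube_integrable_bm|exact: cube_integrable_bm].
have pointwise t : pair_term e j t + pair_term e j (swap j t) =
    Im (E t - E (swap j t)) * chord_kernel e (tnth t ord0 - tnth t (lift ord0 j)) * W e t.
  rewrite /pair_term tnth_swap0 tnth_swapj -[_ - tnth t ord0]opprB chord_kernelN.
  by rewrite /W circle_weight_perm complex_ImD complex_ImN; ring.
under eq_cube_mean do rewrite pointwise.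
(* If [j] carries [X] as well, [E] is symmetric under the exchange while the kernel is odd, so the
   mean vanishes; only coordinates carrying [Y] contribute. *)
case: ifPn => bj.
  rewrite -[RHS](mulr0 2^-1) -(cube_mean0 n.+1); congr (_ * _).
  apply: eq_cube_mean => t; rewrite !(Esplit j) tnth_swap0 tnth_swapj rest_swap bj.
  by rewrite [X in X * rest _ _ - _]mulrC subrr !mul0r.
rewrite (@eq_cube_mean R n.+1 _ (fun t => sg * (Re (Q j t) *
  ratio e (tnth t ord0 - tnth t (lift ord0 j)) * W e t))); last first.
  move=> t; have e1 : E t - E (swap j t) = (X (tnth t ord0) * Y (tnth t (lift ord0 j)) -
      X (tnth t (lift ord0 j)) * Y (tnth t ord0)) * rest j t.
    by rewrite !(Esplit j) tnth_swap0 tnth_swapj rest_swap /factor (negbTE bj) mulrBl.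
  have e2 : Q j t = (X (tnth t ord0) * Y (tnth t (lift ord0 j)) +
      X (tnth t (lift ord0 j)) * Y (tnth t ord0) -
      (Y (tnth t ord0) * Y (tnth t (lift ord0 j)) + Y (tnth t ord0) * Y (tnth t (lift ord0 j)))) * rest j t.
    rewrite /Q !(Esplit j) !(E'split j) tnth_swap0 tnth_swapj rest_swap /factor (negbTE bj).
    by rewrite mulrBl !mulrDl.
  by rewrite e1 e2 XY_kernel -mulrA.
rewrite cube_meanZ; first by rewrite mulrCA mulrA.
apply: cube_integrable_bm.
apply: bounded_measurableM (bounded_circle_weight _ _ _ e0).
apply: bounded_measurableM (bQ j) _.
exact: bounded_measurable_comp (measurable_diff _ _) (bounded_ratio e0).
Qed.

(** Real parts suffice: the factor [i] in [X_sin] and [XY_sin] turns the imaginary part that is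
    differentiated into real parts. *)
Definition mixed_mean m (p : pred 'I_m) : R :=
  cube_mean (fun t => Re (mixed_prod p t) * @circle_weight R m lam k 0 t).

Let A := mixed_mean b.
Let A' := mixed_mean b'.

Let DC t := Re (D (tnth t ord0) * tailp t).
Let VC t := Re (V (tnth t ord0) * tailp t).

Let bDC : bounded_measurable DC.
Proof.
have := complex_bounded_measurableM (@comp_tnth n.+1 D ord0 bD) btail.
by case.
Qed.

Let bVC : bounded_measurable VC.
Proof.
have := complex_bounded_measurableM (@comp_tnth n.+1 V ord0 bV) btail.
by case.
Qed.

(** The pole at [ord0] has become the bounded [ratio], and [pair_mean] does the same for the pair
    terms; each term then has a limit as [e] tends to 0. *)
Let field_split e : 0 < e ->
  cube_mean (fun t => DC t * W e t) +
  lam * cube_mean (fun t => VC t * ratio e (tnth t ord0) * W e t) +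
  \sum_(j < n) k * cube_mean (pair_term e j) = 0.
Proof.
move=> e0; rewrite -[RHS](field_mean0 e0).
have bW := bounded_circle_weight n.+1 lam k e0.
have i1 : cube_integrable (fun t => DC t * W e t).
  by apply: cube_integrable_bm; exact: bounded_measurableM.
have i2 : cube_integrable (fun t => VC t * ratio e (tnth t ord0) * W e t).
  apply: cube_integrable_bm; apply: bounded_measurableM bW; apply: bounded_measurableM bVC _.
  exact: bounded_measurable_comp (measurable_tnth ord0) (bounded_ratio e0).
have i3 j : cube_integrable (fun t => k * pair_term e j t).
  by apply: cube_integrableZ; apply: cube_integrable_bm; exact: bpair.
have [s1 s2] := @cube_mean_sum R n.+1 _ (index_enum 'I_n) _ i3.
under eq_bigr do rewrite -(cube_meanZ _ (cube_integrable_bm (bpair _ e0))).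
rewrite -s1 -cube_meanZ// -cube_meanD//; last exact: cube_integrableZ.
rewrite -cube_meanD//; last by apply: cube_integrableD => //; exact: cube_integrableZ.
apply: eq_cube_mean => t; rewrite /field mulrDl mulrDr [X in _ = _ + X]mulrDl -addrA.
congr (_ + (_ + _)).
  by rewrite [Im _ * _]mulrCA {1}EE X_kernel -!mulrA.
rewrite mulr_sumr mulr_suml; apply: eq_bigr => j _.
by rewrite /pair_term; ring.
Qed.

(** As [e] tends to 0 the vanishing mean of [field] becomes a linear relation. By [DV] the
    one-coordinate terms give [sg * ((1 + lam) * A - c * A')], and each [j] carrying [Y] adds
    [k * sg * (A - A')]; it remains to cancel [sg]. *)
Lemma aomoto_step :
  (1 + lam + k * #|[pred j : 'I_n | ~~ b (lift ord0 j)]|%:R) * A =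
  (c + k * #|[pred j : 'I_n | ~~ b (lift ord0 j)]|%:R) * A'.
Proof.
have [iD cD] := weighted_integrable bDC.
have [iV _] := weighted_integrable bVC.
have cV := @weighted_cvg VC (fun t => tnth t ord0) bVC (measurable_tnth ord0)
  (fun t gt => gt.1 ord0).
have cQ j := @weighted_cvg (fun t => Re (Q j t)) (fun t => tnth t ord0 - tnth t (lift ord0 j))
  (bQ j) (measurable_diff _ _) (fun t gt => gt.2 _ _ (neq_lift ord0 j)).
pose L := cube_mean (fun t => DC t * W 0 t) + lam * cube_mean (fun t => VC t * W 0 t) +
  \sum_(j < n) k * (if b (lift ord0 j) then 0 else sg / 2 * cube_mean (fun t => Re (Q j t) * W 0 t)).
have L0 : L = 0.
  have : (fun m : nat => 0 : R) @ \oo --> L.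
    rewrite (_ : (fun m => 0) = (fun m => cube_mean (fun t => DC t * W (eps m) t) +
      lam * cube_mean (fun t => VC t * ratio (eps m) (tnth t ord0) * W (eps m) t) +
      \sum_(j < n) k * (if b (lift ord0 j) then 0 else sg / 2 * cube_mean (fun t =>
        Re (Q j t) * ratio (eps m) (tnth t ord0 - tnth t (lift ord0 j)) * W (eps m) t)))); last first.
      apply/funext => m; rewrite -[LHS](field_split (eps_gt0 m)); congr (_ + _).
      by apply: eq_bigr => j _; rewrite (pair_mean j (eps_gt0 m)).
    apply: cvgD; first by apply: cvgD cD _; apply: cvgMr; exact: cV.
    apply: cvg_rsum => j _; apply: cvgMr.
    by case: (b _); [exact: cvg_cst|apply: cvgMr; exact: cQ].
  by move/cvg_lim => <- //; rewrite lim_cst.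
have [E1 _] := bmixed b; have [E'1 _] := bmixed b'.
have [iE _] := weighted_integrable E1.
have [iE' _] := weighted_integrable E'1.
have mE := (@measurable_circle_weight R n.+1 lam k 0).
have EA : cube_mean (fun t => Re (E t) * W 0 t) = A by [].
have EA' : cube_mean (fun t => Re (E' t) * W 0 t) = A' by [].
have QE j : cube_mean (fun t => Re (Q j t) * W 0 t) = 2 * (A - A').
  have bEs : bounded_measurable (fun t => Re (E (swap j t))).
    exact: bounded_measurable_comp (measurable_swap j) E1.
  have [iEs _] := weighted_integrable bEs.
  have AE : cube_mean (fun t => Re (E (swap j t)) * W 0 t) = A.
    have mEW : measurable_fun setT (fun t => Re (E t) * W 0 t).
      by apply: measurable_funM => //; case: E1.
    rewrite /A /mixed_mean -[RHS](cube_mean_tperm ord0 (lift ord0 j) mEW).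
    by apply: eq_cube_mean => t; rewrite /W circle_weight_perm.
  rewrite (_ : (fun t => _) = (fun t => (Re (E t) * W 0 t + Re (E (swap j t)) * W 0 t) +
     (-2) * (Re (E' t) * W 0 t))); last first.
    by apply/funext => t; rewrite /Q !(complex_ReD, complex_ReN); ring.
  rewrite cube_meanD; [|exact: cube_integrableD|exact: cube_integrableZ].
  by rewrite cube_meanD// cube_meanZ// AE EA EA'; ring.
have DVE : cube_mean (fun t => DC t * W 0 t) + lam * cube_mean (fun t => VC t * W 0 t) =
    sg * ((1 + lam) * A - c * A').
  rewrite -cube_meanZ// -cube_meanD//; last exact: cube_integrableZ.
  rewrite (_ : (fun t => _) = (fun t => (sg * (1 + lam)) * (Re (E t) * W 0 t) +
     (- (sg * c)) * (Re (E' t) * W 0 t))); last first.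
    apply/funext => t; rewrite EE E'E /DC /VC.
    have := congr1 (fun z => Re (z * tailp t)) (DV (tnth t ord0)).
    move: (X _) (Y _) (D _) (V _) (tailp t) (W 0 t) => x y z v p w H.
    transitivity (Re ((z + lam%:C%C * v) * p) * w).
      by case: z v p {H} => [z1 z2] [v1 v2] [p1 p2]; rewrite /=; ring.
    rewrite H; case: x y p {H} => [x1 x2] [y1 y2] [p1 p2].
    by rewrite !(complex_ReM, complex_ReD, complex_ReN, complex_ImM, complex_ImD, complex_ImN) /=; ring.
  rewrite cube_meanD; [|exact: cube_integrableZ|exact: cube_integrableZ].
  by rewrite !cube_meanZ// EA EA'; ring.
move: L0; rewrite /L DVE.
under eq_bigr do rewrite QE.
rewrite (eq_bigr (fun j : 'I_n => if ~~ b (lift ord0 j) then k * sg * (A - A') else 0)); last first.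
  by move=> j _; case: ifPn => _ /=; [rewrite mulr0|field].
rewrite -big_mkcond sumr_const -mulr_natr => H.
apply: (mulfI sg_neq0); apply/eqP; rewrite -subr_eq0; apply/eqP; rewrite -[RHS]H.
by ring.
Qed.

End fixed_dimension.
End aomoto_step.

Section circle_moment_recursion.
Context {R : realType}.
Notation T := (measurableTypeR R).
Notation U := (@chord2 R).
Notation Re := (@complex.Re R).
Notation Im := (@complex.Im R).
Implicit Types (x y lam k d : R) (n : nat).

Lemma mixed_mean_tperm (X Y : R -> R[i]) lam k n (p : pred 'I_n) (i j : 'I_n) :
  @complex_bounded_measurable R _ T X -> @complex_bounded_measurable R _ T Y ->
  mixed_mean X Y lam k (fun m => p (tperm i j m)) = mixed_mean X Y lam k p.
Proof.
move=> bX bY.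
have bm : complex_bounded_measurable (mixed_prod X Y p).
  apply: complex_bounded_measurable_prod => m.
  have [F1 F2] : @complex_bounded_measurable R _ T (if p m then X else Y) by case: (p m).
  split.
    have := bounded_measurable_comp (measurable_tnth m) F1.
    by congr bounded_measurable; apply/funext => t; case: (p m).
  have := bounded_measurable_comp (measurable_tnth m) F2.
  by congr bounded_measurable; apply/funext => t; case: (p m).
rewrite /mixed_mean -[RHS](cube_mean_tperm i j); last first.
  apply: measurable_funM; last exact: measurable_circle_weight.
  by case: bm => -[].
apply: eq_cube_mean => t; rewrite circle_weight_perm; congr (Re _ * _).
rewrite /mixed_prod [RHS](reindex_inj (@perm_inj _ (tperm i j))).
by apply: eq_bigr => m _; rewrite tnth_tuple_perm tpermK.
Qed.

Definition chord x : R[i] := 1 - expi2pi x.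

Lemma bounded_cos2pi : bounded_measurable (fun x : T => cos (2 * pi * x)).
Proof.
split; first exact: continuous_measurable_fun continuous_cos2pi.
by exists 1 => x; rewrite ler_norml cos_geN1 cos_le1.
Qed.

Lemma bounded_sin2pi : bounded_measurable (fun x : T => sin (2 * pi * x)).
Proof.
split; first exact: continuous_measurable_fun continuous_sin2pi.
by exists 1 => x; rewrite ler_norml sin_geN1 sin_le1.
Qed.

Lemma bounded_affine (f : T -> R) (p q : R) : bounded_measurable f ->
  bounded_measurable (fun x => p + q * f x).
Proof.
move=> bf; apply: bounded_measurableD; first exact: bounded_measurable_cst.
by apply: bounded_measurableM => //; exact: bounded_measurable_cst.
Qed.

Lemma trig_bounded (F : R -> R[i]) (p q r : R) :
  (forall x, F x = ((p + q * cos (2 * pi * x))%R +i* (r * sin (2 * pi * x))%R)%C) ->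
  @complex_bounded_measurable R _ T F.
Proof.
move=> FE; split; under eq_fun do rewrite FE /=.
  exact: bounded_affine bounded_cos2pi.
by have := bounded_affine 0 r bounded_sin2pi; under eq_fun do rewrite add0r.
Qed.

Lemma continuous_affine (f : R -> R) (p q : R) : continuous f ->
  continuous (fun x => p + q * f x).
Proof. by move=> cf x; apply: cvgD; [exact: cvg_cst|apply: cvgMr; exact: cf]. Qed.

Lemma is_derive_cstDZ (f : R -> R) (p q : R) x (df : R) : is_derive x 1 f df ->
  is_derive x 1 (fun x => p + q * f x) (q * df).
Proof.
move=> D; have := @is_deriveD _ _ _ (cst p) (q *: f) x 1 _ _
  (is_derive_cst p x 1) (@is_deriveZ _ _ _ f q x 1 df D).
by move=> {}D; apply: is_derive_eq D _; rewrite add0r.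
Qed.

Section chain.
Variables (X Y D V : R -> R[i]) (sg c lam k d : R) (n : nat).
Hypothesis bX : @complex_bounded_measurable R _ T X.
Hypothesis bY : @complex_bounded_measurable R _ T Y.
Hypothesis step : forall b : pred 'I_n.+1, b ord0 ->
  (1 + lam + k * #|[pred j : 'I_n | ~~ b (lift ord0 j)]|%:R) * mixed_mean X Y lam k b =
  (c + k * #|[pred j : 'I_n | ~~ b (lift ord0 j)]|%:R) *
    mixed_mean X Y lam k (fun m => b m && (m != ord0)).

Let below r : pred 'I_n.+1 := fun m => (m < r)%N.

(** [step] replaces [X] by [Y] at [ord0]; the transposition with [r] restores an initial segment.
    Before the replacement [n - r] coordinates carry [Y]. *)
Let chain_step r : (r < n.+1)%N ->
  (1 + lam + k * (n - r)%:R) * mixed_mean X Y lam k (below r.+1) =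
  (c + k * (n - r)%:R) * mixed_mean X Y lam k (below r).
Proof.
move=> rn; have := step (b := below r.+1) isT.
have -> : #|[pred j : 'I_n | ~~ below r.+1 (lift ord0 j)]| = (n - r)%N.
  rewrite -sum1_card.
  rewrite (eq_bigl (fun j : 'I_n => (r <= j)%N)); last first.
    by move=> j; rewrite inE /below /= /bump /= add1n ltnS -leqNgt.
  transitivity (\sum_(r <= j < n) 1)%N; first by rewrite big_geq_mkord.
  by rewrite sum_nat_const_nat muln1.
move=> ->; congr (_ * _).
rewrite -(mixed_mean_tperm lam k (below r) ord0 (Ordinal rn) bX bY).
congr mixed_mean; apply/funext => m; rewrite /below.
case: tpermP => [->|->|/eqP m0 /eqP mr] /=.
- by rewrite ltnn.
- by rewrite ltnSn -val_eqE /= lt0n.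
- by rewrite ltnS leq_eqVlt m0 andbT; move: mr; rewrite -val_eqE /= => /negbTE ->.
Qed.

(** The relations are chained in multiplied form, so a vanishing factor does no harm. The products
    run over [n - j] and are reversed at the end. *)
Lemma mixed_mean_chain :
  mixed_mean X Y lam k (fun _ : 'I_n.+1 => true) * \prod_(j < n.+1) (1 + lam + k * j%:R) =
  mixed_mean X Y lam k (fun _ : 'I_n.+1 => false) * \prod_(j < n.+1) (c + k * j%:R).
Proof.
have alg (a a' a0 P Q F G : R) : F * a' = G * a -> a * P = a0 * Q ->
    a' * (P * F) = a0 * (Q * G).
  move=> S I; transitivity (P * (F * a')); first by ring.
  by rewrite S; transitivity (G * (a * P)); [ring|rewrite I; ring].
have chain r : (r <= n.+1)%N ->
    mixed_mean X Y lam k (below r) * \prod_(j < r) (1 + lam + k * (n - j)%:R) =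
    mixed_mean X Y lam k (below 0) * \prod_(j < r) (c + k * (n - j)%:R).
  elim: r => [|r IHr] rn; first by rewrite !big_ord0.
  rewrite !big_ord_recr /=.
  exact: alg (chain_step rn) (IHr (ltnW rn)).
have := chain n.+1 (leqnn _).
have -> : below n.+1 = (fun=> true) by apply/funext => m; rewrite /below ltn_ord.
have -> : below 0 = (fun=> false) by [].
have rev (z : R) : \prod_(j < n.+1) (z + k * (n - j)%:R) = \prod_(j < n.+1) (z + k * j%:R).
  rewrite (reindex_inj rev_ord_inj) /=; apply: eq_bigr => j _.
  by rewrite subSS subKn// -ltnS.
by rewrite !rev.
Qed.

End chain.

Definition circle_mean n lam k : R := cube_mean (@circle_weight R n lam k 0).

Lemma mixed_mean_none (X Y : R -> R[i]) lam k n :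
  mixed_mean X Y lam k (fun _ : 'I_n => false) =
  cube_mean (fun t : n.-tuple T => Re (\prod_(m < n) Y (tnth t m)) * circle_weight lam k 0 t).
Proof. by []. Qed.

Lemma mixed_mean_all (X Y : R -> R[i]) lam k n :
  mixed_mean X Y lam k (fun _ : 'I_n => true) =
  cube_mean (fun t : n.-tuple T => Re (\prod_(m < n) X (tnth t m)) * circle_weight lam k 0 t).
Proof. by []. Qed.

Let sin_diff x y : sin (2 * pi * (x - y)) =
  sin (2 * pi * x) * cos (2 * pi * y) - cos (2 * pi * x) * sin (2 * pi * y).
Proof. by rewrite mulrBr sinB. Qed.

Let cos_diff x y : cos (2 * pi * (x - y)) =
  cos (2 * pi * x) * cos (2 * pi * y) + sin (2 * pi * x) * sin (2 * pi * y).
Proof. by rewrite mulrBr cosB. Qed.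

Let chordE x : chord x = ((1 - cos (2 * pi * x)) +i* (- sin (2 * pi * x)))%C.
Proof. by rewrite /chord /expi2pi; apply/eqP; rewrite eq_complex /= sub0r !eqxx. Qed.

(** The pair [(z, 1)]: here [D = z - 1] and [V = z - 2], and [D + lam * V = (1 + lam) * z - (1 + 2 *
    lam)] fixes [c]. *)
Lemma circle_mean_step1 n lam k d : 0 <= d ->
  4 * d * (n.+1 + n.+1 * n.+1)%:R <= 1 -> - d <= lam -> - d <= k ->
  cube_mean (fun t : n.+1.-tuple T =>
    Re (\prod_(m < n.+1) chord (tnth t m)) * circle_weight lam k 0 t) *
    \prod_(j < n.+1) (1 + lam + k * j%:R) =
  circle_mean n.+1 lam k * \prod_(j < n.+1) (1 + 2 * lam + k * j%:R).
Proof.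
move=> d0 dn dlam dk.
pose Y1 (x : R) : R[i] := 1.
pose V x := chord x - 2.
pose D x := chord x - 1.
have DE x : D x = ((- cos (2 * pi * x)) +i* (- sin (2 * pi * x)))%C.
  by rewrite /D chordE; apply/eqP; rewrite eq_complex /=; apply/andP; split; apply/eqP; ring.
have VE x : V x = ((- 1 - cos (2 * pi * x)) +i* (- sin (2 * pi * x)))%C.
  by rewrite /V chordE; apply/eqP; rewrite eq_complex /=; apply/andP; split; apply/eqP; ring.
have bX : @complex_bounded_measurable R _ T chord.
  by apply: (@trig_bounded _ 1 (-1) (-1)) => x; rewrite chordE !mulN1r.
have bY : @complex_bounded_measurable R _ T Y1.
  by split; exact: bounded_measurable_cst.
have bD : @complex_bounded_measurable R _ T D.
  by apply: (@trig_bounded _ 0 (-1) (-1)) => x; rewrite DE !mulN1r add0r.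
have bV : @complex_bounded_measurable R _ T V.
  by apply: (@trig_bounded _ (-1) (-1) (-1)) => x; rewrite VE !mulN1r.
have := @mixed_mean_chain chord Y1 (1 + 2 * lam) lam k n bX bY.
rewrite mixed_mean_all mixed_mean_none => ->.
  congr (_ * _); apply: eq_cube_mean => t.
  by rewrite big1 // mul1r.
move=> b b0; apply: (@aomoto_step R chord Y1 D V 1 (1 + 2 * lam) lam k _ _ _ _ bX bY bD bV
  _ _ _ _ _ n b b0 d d0 dn dlam dk).
- move=> x; rewrite DE.
  rewrite (_ : (fun x => _) = (fun x : R => 1 + (-1) * cos (2 * pi * x))); last first.
    by apply/funext => z; rewrite chordE mulN1r.
  apply: is_derive_eq (is_derive_cstDZ 1 (-1) (is_derive_cos2pi x)) _.
  by rewrite mulN1r /= !opprK.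
- move=> x; rewrite DE.
  rewrite (_ : (fun x => _) = (fun x : R => 0 + (-1) * sin (2 * pi * x))); last first.
    by apply/funext => z; rewrite chordE mulN1r add0r.
  apply: is_derive_eq (is_derive_cstDZ 0 (-1) (is_derive_sin2pi x)) _.
  by rewrite mulN1r /= mulrN.
- rewrite (_ : (fun x => _) = (fun x : R => 0 + (-1) * cos (2 * pi * x))).
    exact: continuous_affine continuous_cos2pi.
  by apply/funext => x; rewrite DE add0r mulN1r.
- rewrite (_ : (fun x => _) = (fun x : R => 0 + (-1) * sin (2 * pi * x))).
    exact: continuous_affine continuous_sin2pi.
  by apply/funext => x; rewrite DE add0r mulN1r.
- by rewrite /chord /expi2pi mulr1 mulr0 -[2 * pi]add0r mulr_natl cosD2pi sinD2pi.
- move=> x; rewrite chordE VE /chord2; have H := sin2cos2 (2 * pi * x).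
  move: (cos _) (sin _) H => cx sx H.
  apply/eqP; rewrite eq_complex /=; apply/andP; split; apply/eqP.
    by ring.
  by ring: H.
- move=> x y; rewrite /Y1 !chordE /chord2 sin_diff cos_diff.
  have Hx := sin2cos2 (2 * pi * x); have Hy := sin2cos2 (2 * pi * y).
  move: (cos (2 * pi * x)) (sin (2 * pi * x)) (cos (2 * pi * y)) (sin (2 * pi * y)) Hx Hy.
  move=> cx sx cy sy Hx Hy.
  apply/eqP; rewrite eq_complex /=; apply/andP; split; apply/eqP.
    by ring: Hx Hy.
  by ring: Hx Hy.
- move=> x; rewrite /Y1 DE VE chordE.
  move: (cos _) (sin _) => cx sx.
  by apply/eqP; rewrite eq_complex /=; apply/andP; split; apply/eqP; ring.
- exact: oner_neq0.
Qed.

(** The pair [(U, z)]: [D] and [V] both equal [2 * z - U], since [X = U] cancels the denominator of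
    [V]. Then [D + lam * V = - ((1 + lam) * U - (2 + 2 * lam) * z)] gives [sg = - 1] and [c]. *)
Lemma circle_mean_step2 n lam k d : 0 <= d ->
  4 * d * (n.+1 + n.+1 * n.+1)%:R <= 1 -> - d <= lam -> - d <= k ->
  cube_mean (fun t : n.+1.-tuple T =>
    Re (\prod_(m < n.+1) (U (tnth t m))%:C%C) * circle_weight lam k 0 t) *
    \prod_(j < n.+1) (1 + lam + k * j%:R) =
  cube_mean (fun t : n.+1.-tuple T =>
    Re (\prod_(m < n.+1) chord (tnth t m)) * circle_weight lam k 0 t) *
    \prod_(j < n.+1) (2 + 2 * lam + k * j%:R).
Proof.
move=> d0 dn dlam dk.
pose X (x : R) : R[i] := (U x)%:C%C.
pose D x := 2 * chord x - X x.
have XE x : X x = ((2 - 2 * cos (2 * pi * x)) +i* 0)%C by [].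
have DE x : D x = (0 +i* (- (2 * sin (2 * pi * x))))%C.
  rewrite /D chordE XE; move: (cos _) (sin _) => cx sx.
  by apply/eqP; rewrite eq_complex /=; apply/andP; split; apply/eqP; ring.
have bX : @complex_bounded_measurable R _ T X.
  by apply: (@trig_bounded _ 2 (-2) 0) => x; rewrite XE mulNr mul0r.
have bY : @complex_bounded_measurable R _ T chord.
  by apply: (@trig_bounded _ 1 (-1) (-1)) => x; rewrite chordE !mulN1r.
have bD : @complex_bounded_measurable R _ T D.
  by apply: (@trig_bounded _ 0 0 (-2)) => x; rewrite DE mul0r addr0 mulNr.
have := @mixed_mean_chain X chord (2 + 2 * lam) lam k n bX bY.
rewrite mixed_mean_all mixed_mean_none => -> //.
move=> b b0; apply: (@aomoto_step R X chord D D (-1) (2 + 2 * lam) lam k _ _ _ _ bX bY bD bD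
  _ _ _ _ _ n b b0 d d0 dn dlam dk).
- move=> x; rewrite DE.
  rewrite (_ : (fun x => _) = (fun x : R => 2 + (-2) * cos (2 * pi * x))); last first.
    by apply/funext => z; rewrite XE mulNr.
  apply: is_derive_eq (is_derive_cstDZ 2 (-2) (is_derive_cos2pi x)) _.
  by move: (sin _) => sx; move: pi => p /=; ring.
- move=> x; rewrite DE.
  rewrite (_ : (fun x => _) = (fun x : R => 0 + 0 * cos (2 * pi * x))); last first.
    by apply/funext => z; rewrite XE mul0r addr0.
  apply: is_derive_eq (is_derive_cstDZ 0 0 (is_derive_cos2pi x)) _.
  by rewrite mul0r /= mulr0.
- rewrite (_ : (fun x => _) = (fun x : R => 0 + 0 * cos (2 * pi * x))).
    exact: continuous_affine continuous_cos2pi.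
  by apply/funext => x; rewrite DE mul0r addr0.
- rewrite (_ : (fun x => _) = (fun x : R => 0 + (-2) * sin (2 * pi * x))).
    exact: continuous_affine continuous_sin2pi.
  by apply/funext => x; rewrite DE add0r mulNr.
- by rewrite !XE mulr1 mulr0 -[2 * pi]add0r [2 * pi]mulr_natl cosD2pi.
- move=> x; rewrite XE DE /chord2.
  move: (cos _) (sin _) => cx sx.
  by apply/eqP; rewrite eq_complex /=; apply/andP; split; apply/eqP; ring.
- move=> x y; rewrite !XE !chordE /chord2 sin_diff cos_diff.
  have Hx := sin2cos2 (2 * pi * x); have Hy := sin2cos2 (2 * pi * y).
  move: (cos (2 * pi * x)) (sin (2 * pi * x)) (cos (2 * pi * y)) (sin (2 * pi * y)) Hx Hy.
  move=> cx sx cy sy Hx Hy.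
  apply/eqP; rewrite eq_complex /=; apply/andP; split; apply/eqP.
    by ring: Hx Hy.
  by ring: Hx Hy.
- move=> x; rewrite DE XE chordE.
  move: (cos _) (sin _) => cx sx.
  by apply/eqP; rewrite eq_complex /=; apply/andP; split; apply/eqP; ring.
- by rewrite oppr_eq0 oner_neq0.
Qed.

Lemma circle_weight_add1 n lam k (t : n.-tuple T) : 0 < lam + 1 ->
  Re (\prod_(m < n) (U (tnth t m))%:C%C) * circle_weight lam k 0 t =
  circle_weight (lam + 1) k 0 t.
Proof.
move=> lam1; rewrite -rmorph_prod /= /circle_weight mulrA; congr (_ * _).
rewrite -big_split /=; apply: eq_bigr => j _; rewrite addr0.
have := @chord2_ge0 R (tnth t j); rewrite le_eqVlt => /orP[/eqP <-|U0].
  (* At a zero of [U] both sides vanish, because the exponent [lam + 1] is not 0. *)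
  by rewrite mul0r powR0 // gt_eqF.
by rewrite powRD ?gt_eqF// ?implybT// powRr1 1?ltW// mulrC.
Qed.

Lemma circle_mean_add1 n lam k d : 0 <= d ->
  4 * d * (n.+1 + n.+1 * n.+1)%:R <= 1 -> - d <= lam -> - d <= k ->
  circle_mean n.+1 (lam + 1) k * \prod_(j < n.+1) (1 + lam + k * j%:R) ^+ 2 =
  circle_mean n.+1 lam k *
    \prod_(j < n.+1) ((1 + 2 * lam + k * j%:R) * (2 + 2 * lam + k * j%:R)).
Proof.
move=> d0 dn dlam dk.
(* The cube condition forces [d <= 1 / 8], as [n.+1 + n.+1 * n.+1] is at least 2. *)
have lam1 : 0 < lam + 1.
  have N2 : 2 <= (n.+1 + n.+1 * n.+1)%:R :> R by rewrite ler_nat; lia.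
  have : 4 * d * 2 <= 1 by apply: le_trans dn; rewrite ler_wpM2l// mulr_ge0.
  by move: dlam; lra.
have S1 := circle_mean_step1 d0 dn dlam dk; have S2 := circle_mean_step2 d0 dn dlam dk.
rewrite (@eq_cube_mean _ _ _ (circle_weight (lam + 1) k 0)) in S2; last first.
  by move=> t; exact: circle_weight_add1.
rewrite -/(circle_mean _ _ _) in S2; rewrite prodrXl big_split /= [RHS]mulrA -S1.
by rewrite expr2 mulrA S2 mulrAC.
Qed.

End circle_moment_recursion.

(** * The Morris integral *)

Section circle_mean_convex.
Context {R : realType}.
Notation T := (measurableTypeR R).
Notation U := (@chord2 R).
Implicit Types (lam k d : R) (n : nat).

Lemma generic_circle_weight_gt0 n a k (t : n.-tuple T) : generic_position t ->
  0 < circle_weight a k 0 t :> R.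
Proof.
move=> [G1 G2]; apply: mulr_gt0.
  by apply: prodr_gt0 => j _; rewrite addr0 powR_gt0.
apply: prodr_gt0 => i _; apply: prodr_gt0 => j ji; rewrite addr0 powR_gt0// G2//.
by rewrite neq_ltn ji.
Qed.

Lemma circle_mean_integral n lam k d : 0 <= d -> 4 * d * (n + n * n)%:R <= 1 ->
  - d <= lam -> - d <= k ->
  cube_integral (fun t : n.-tuple T => (circle_weight lam k 0 t)%:E) =
  (circle_mean n lam k)%:E.
Proof.
move=> d0 dn dlam dk.
have [int _] := @cube_mean_cvg R n lam k d (fun=> 1) (fun _ _ => 1) 1 d0 dn dlam dk
  (measurable_cst _) (fun _ => ltac:(by rewrite normr1)) (fun=> measurable_cst _)
  (fun _ _ => ltac:(by rewrite normr1)) (fun _ _ => cvg_cst _).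
rewrite /circle_mean /cube_mean fineK// /cube_integral.
have := integrable_fin_num (@measurable_unit_cube R n) int.
by congr (_ \is a fin_num); apply: eq_integral => t _; rewrite mul1r.
Qed.

Lemma circle_mean_gt0 n lam k d : 0 <= d -> 4 * d * (n + n * n)%:R <= 1 ->
  - d <= lam -> - d <= k -> 0 < circle_mean n lam k.
Proof.
move=> d0 dn dlam dk; rewrite -lte_fin -(circle_mean_integral d0 dn dlam dk).
rewrite /cube_integral; apply: (@integral_gt0 _ _ R (lebesgue_tuple R n)).
- exact: measurable_unit_cube.
- by apply: measurable_funTS; exact: measurable_circle_weight.
- by move=> t _; exact: circle_weight_ge0.
- apply: filterS (ae_generic_position (R := R) n) => t gt tc.
  by rewrite gt_eqF// generic_circle_weight_gt0//; exact: gt.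
- exact: (eq_ind 1%E (fun z => 0 < z)%E lte01 _ (esym (lebesgue_tuple_unit_cube n))).
Qed.

Lemma circle_weight_geometric n k s y z (t : n.-tuple T) : 0 < s < 1 ->
  (forall j, 0 < U (tnth t j)) ->
  circle_weight (s * y + (1 - s) * z) k 0 t =
  circle_weight y k 0 t `^ s * circle_weight z k 0 t `^ (1 - s).
Proof.
move=> /andP[s0 s1] t0; rewrite /circle_weight.
set K := (X in _ * X).
have K0 : 0 <= K by apply: prodr_ge0 => i _; apply: prodr_ge0 => j _; exact: powR_ge0.
have prod0 (a : R) : 0 <= \prod_(j < n) (U (tnth t j) + 0) `^ a.
  by apply: prodr_ge0 => j _; exact: powR_ge0.
rewrite !powRM// mulrACA -[in RHS]powRD; last by rewrite subrKC oner_eq0.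
rewrite subrKC powRr1//; congr (_ * _).
have powR_prod (a b : R) :
    (\prod_(j < n) (U (tnth t j) + 0) `^ a) `^ b = \prod_(j < n) (U (tnth t j) + 0) `^ (a * b).
  suff [] : 0 <= \prod_(j < n) (U (tnth t j) + 0) `^ a /\
    (\prod_(j < n) (U (tnth t j) + 0) `^ a) `^ b = \prod_(j < n) (U (tnth t j) + 0) `^ (a * b) by [].
  apply: (big_rec2 (fun p q : R => 0 <= p /\ p `^ b = q)).
    by split; rewrite ?powR1.
  by move=> j p q _ [q0 <-]; split; rewrite ?mulr_ge0 ?powR_ge0// powRM ?powR_ge0// powRrM.
rewrite !powR_prod -big_split /=; apply: eq_bigr => j _.
by rewrite addr0 -powRD ?(gt_eqF (t0 j)) ?implybT// mulrC [_ * z]mulrC.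
Qed.

Lemma ln_circle_mean_chord n k d (a b c : R) : 0 <= d ->
  4 * d * (n + n * n)%:R <= 1 -> - d <= k -> - d <= a -> a < b -> b < c ->
  (c - a) * ln (circle_mean n b k) <=
  (c - b) * ln (circle_mean n a k) + (b - a) * ln (circle_mean n c k).
Proof.
move=> d0 dn dk da ab bc.
(* The pointwise interpolation identity can fail at zeros of [U] when the interpolated exponent is
   0, since then [0 ^ 0 = 1]. The null set where the weight with exponents 1 vanishes is therefore
   removed from the cube. *)
pose Z (t : n.-tuple T) := circle_weight 1 1 0 t : R.
have mZ : measurable (Z @^-1` [set 0]).
  by rewrite -[X in measurable X]setTI; apply: measurable_circle_weight => //.
have mN : measurable (@unit_cube R n `&` Z @^-1` [set 0]).
  by apply: measurableI => //; exact: measurable_unit_cube.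
have N0 : lebesgue_tuple R n (@unit_cube R n `&` Z @^-1` [set 0]) = 0%E.
  apply: measure_negligible => //.
  apply: negligibleS (ae_generic_position (R := R) n) => t /= [tc Z0] gt.
  by have := generic_circle_weight_gt0 1 1 (gt tc); rewrite -/(Z t) Z0 ltxx.
apply: (@log_convex_integral _ _ _ (lebesgue_tuple R n)
  (@unit_cube R n `\` (@unit_cube R n `&` Z @^-1` [set 0]))
  (fun lam t => circle_weight lam k 0 t) (fun lam => circle_mean n lam k)) => //.
- by apply: measurableD => //; exact: measurable_unit_cube.
- by move=> y _; apply: measurable_funTS; exact: measurable_circle_weight.
- by move=> y t _; exact: circle_weight_ge0.
- move=> s y z t s01 _ _ [tc tZ]; apply: circle_weight_geometric => // j.
  rewrite lt_neqAle chord2_ge0 andbT eq_sym; apply/eqP => Uj0; apply: tZ; split => //=.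
  by rewrite /Z /circle_weight (bigD1 j)//= Uj0 addr0 powR0 ?oner_eq0// !mul0r.
- by move=> y ay; apply: (@circle_mean_gt0 n y k d) => //; exact: le_trans ay.
- move=> y ay; rewrite -ge0_negligible_integral//.
  + by apply: (@circle_mean_integral n y k d) => //; exact: le_trans ay.
  + exact: measurable_unit_cube.
  + apply: measurable_funTS; apply/measurable_EFinP; exact: measurable_circle_weight.
  + by move=> t _; rewrite lee_fin circle_weight_ge0.
Qed.

End circle_mean_convex.

(** * Uniqueness after Bohr and Mollerup *)

Section uniqueness.
Context {R : realType}.
Implicit Types (lam k d a b c x : R) (n : nat).

(* The argument of Bohr and Mollerup: [H - K] is 1-periodic, and the increments   *)
(* of [H] are squeezed between chord slopes with the same limit as those of [K].  *)
Lemma chord_increment_unique (H K : R -> R) y0 c :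
  (forall a b e : R, y0 <= a -> a < b -> b < e ->
    (e - a) * H b <= (e - b) * H a + (b - a) * H e) ->
  (forall a : R, y0 <= a -> H (a + 1) - H a = K (a + 1) - K a) ->
  (forall a x : R, (K (m%:R + a + x) - K (m%:R + a)) @[m --> \oo] --> x * c) ->
  forall a x : R, y0 <= a -> 0 < x -> H (a + x) - H a = K (a + x) - K a.
Proof.
move=> Hchord HK Klim a x ya x0.
have shift (z : R) m : y0 <= z -> H (m%:R + z) - K (m%:R + z) = H z - K z.
  move=> yz; elim: m => [|m IHm]; first by rewrite add0r.
  have ym : y0 <= m%:R + z by apply: le_trans yz _; rewrite lerDr.
  by rewrite -IHm -natr1 addrAC; have := HK _ ym; lra.
pose E := H (a + x) - H a - (K (a + x) - K a).
have yx : y0 <= a + x by rewrite (le_trans ya)// lerDl ltW.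
have HE m : H (m%:R + a + x) - H (m%:R + a) = E + (K (m%:R + a + x) - K (m%:R + a)).
  by rewrite -addrA; have := shift _ m ya; have := shift _ m yx; rewrite /E; lra.
have HS m z : y0 <= z -> H (m%:R + z + 1) - H (m%:R + z) = K (m%:R + z + 1) - K (m%:R + z).
  by move=> yz; apply: HK; apply: le_trans yz _; rewrite lerDr.
have lower : (x * (K (m%:R + a + 1) - K (m%:R + a)) @[m --> \oo] --> x * (1 * c)).
  by apply: cvgMr; exact: Klim.
have upper : (x * (K (m%:R + (a + x) + 1) - K (m%:R + (a + x))) @[m --> \oo] --> x * (1 * c)).
  by apply: cvgMr; exact: Klim.
have mid : (E + (K (m.+1%:R + a + x) - K (m.+1%:R + a)) @[m --> \oo] --> E + x * c).
  by apply: cvgD; [exact: cvg_cst|have Kx := Klim a x; rewrite -cvg_shiftS in Kx; exact: Kx].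
(* The base point is [m.+1 + a], so that the unit interval to its left starts at [m + a], still
   above [y0]. *)
have slopes m : x * (K (m%:R + a + 1) - K (m%:R + a)) <=
    E + (K (m.+1%:R + a + x) - K (m.+1%:R + a)) <=
    x * (K (m.+1%:R + (a + x) + 1) - K (m.+1%:R + (a + x))).
  have ym : y0 <= m.+1%:R + a - 1.
    by rewrite -natr1 addrAC addrK; apply: le_trans ya _; rewrite lerDr.
  have := chord_slopes Hchord ym x0; rewrite HE.
  by rewrite -[m.+1%:R + a + x]addrA HS// -natr1 [_ + 1 + a]addrAC addrK HS.
suff : E = 0 by rewrite /E => /subr0_eq.
apply/eqP; rewrite eq_le; apply/andP; split.
- have : E + x * c <= x * (1 * c).
    apply: ler_cvg_to mid (_ : (x * (K (m.+1%:R + (a + x) + 1) - K (m.+1%:R + (a + x)))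
      @[m --> \oo] --> _)) _; last by apply: nearW => m; case/andP: (slopes m).
    by rewrite (cvg_shiftS (fun m : nat => x * (K (m%:R + (a + x) + 1) - K (m%:R + (a + x))))).
  by rewrite mul1r gerDr.
- have : x * (1 * c) <= E + x * c.
    by apply: ler_cvg_to lower mid _; apply: nearW => m; case/andP: (slopes m).
  by rewrite mul1r lerDr.
Qed.

Definition ln_Gamma_quotient n k a : R :=
  \sum_(j < n) (ln (Gamma (1 + 2 * a + k * j%:R)) - 2 * ln (Gamma (1 + a + k * j%:R))).

Lemma cvg_doublen : (2 * m)%N @[m --> \oo] --> \oo.
Proof.
by apply/cvgnyPge => A; exists A => // m /= Am; rewrite mul2n -addnn; apply: leq_trans Am (leq_addr _ _).
Qed.

(** An increment of [ln Gamma] is its step times the logarithm of the base point, up to [o(1)]: here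
    [2 * x * ln (2 * m)] against [2 * (x * ln m)]. The logarithms of [m] cancel and [2 * x * ln 2]
    remains for each [j]. *)
Lemma ln_Gamma_quotient_cvg n k a x :
  (ln_Gamma_quotient n k (m%:R + a + x) - ln_Gamma_quotient n k (m%:R + a))
    @[m --> \oo] --> x * (n%:R * (2 * ln 2)).
Proof.
have -> : x * (n%:R * (2 * ln 2)) = \sum_(j < n) (2 * x * ln 2).
  by rewrite sumr_const card_ord -[RHS]mulr_natr; ring.
pose L (z : R) := ln (Gamma z).
have Lchord (y z w : R) : 0 < y -> y < z -> z < w ->
  (w - y) * L z <= (w - z) * L y + (z - y) * L w := @ln_Gamma_chord R y z w.
have Lrec (z : R) : 0 < z -> L (z + 1) = ln z + L z := @ln_Gamma_add1 R z.
have limL := log_recurrence_cvg Lchord Lrec.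
rewrite (_ : (fun m => _) = fun m : nat => \sum_(j < n)
    ((L (1 + 2 * (m%:R + a + x) + k * j%:R) - 2 * L (1 + (m%:R + a + x) + k * j%:R)) -
     (L (1 + 2 * (m%:R + a) + k * j%:R) - 2 * L (1 + (m%:R + a) + k * j%:R)))); last first.
  by apply/funext => m; rewrite /ln_Gamma_quotient -sumrB.
move: L {Lchord Lrec} limL => L limL.
apply: cvg_rsum => j _; set s := k * j%:R.
pose u b y (m : nat) : R := L (m%:R + b + y) - L (m%:R + b) - y * ln m%:R.
have lim2 : u (1 + 2 * a + s) (2 * x) (2 * m)%N @[m --> \oo] --> (0 : R).
  apply: (@cvg_comp _ _ _ (fun m => 2 * m)%N (u (1 + 2 * a + s) (2 * x)) _ _ _ cvg_doublen).
  exact: limL.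
have lim1 := limL (1 + a + s) x.
have lim : (u (1 + 2 * a + s) (2 * x) (2 * m)%N - 2 * u (1 + a + s) x m + 2 * x * ln 2)
    @[m --> \oo] --> 0 - 2 * 0 + 2 * x * ln 2.
  apply: cvgD; last exact: cvg_cst.
  by apply: cvgB => //; apply: cvgMr.
rewrite mulr0 subr0 add0r in lim.
apply: cvg_trans lim; apply: near_eq_cvg; exists 1%N => // m /= m0.
have mgt0 : 0 < m%:R :> R by rewrite ltr0n.
rewrite /u natrM lnM// ?posrE ?mulr_gt0//.
have -> : 1 + 2 * (m%:R + a + x) + s = 2%:R * m%:R + (1 + 2 * a + s) + 2 * x by ring.
have -> : 1 + 2 * (m%:R + a) + s = 2%:R * m%:R + (1 + 2 * a + s) by ring.
have -> : 1 + (m%:R + a + x) + s = m%:R + (1 + a + s) + x by ring.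
have -> : 1 + (m%:R + a) + s = m%:R + (1 + a + s) by ring.
by move: (L _) (L _) (L _) (L _) (ln _) (ln _) => *; ring.
Qed.

End uniqueness.

Section morris.
Context {R : realType}.
Notation T := (measurableTypeR R).
Notation U := (@chord2 R).
Notation lnG x := (ln (Gamma x)).
Implicit Types (lam k d a b c x : R) (n : nat).

Lemma ln_prod (I : Type) (r : seq I) (f : I -> R) : (forall i, 0 < f i) ->
  ln (\prod_(i <- r) f i) = \sum_(i <- r) ln (f i).
Proof.
move=> f0; elim: r => [|i r IHr]; first by rewrite !big_nil ln1.
by rewrite !big_cons lnM ?posrE ?prodr_gt0// IHr.
Qed.

Lemma ln_circle_mean_increment n lam k d : 0 <= d ->
  4 * d * (n.+1 + n.+1 * n.+1)%:R <= 1 -> - d <= lam -> - d <= k ->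
  ln (circle_mean n.+1 lam k) - ln (circle_mean n.+1 0 k) =
  ln_Gamma_quotient n.+1 k lam - ln_Gamma_quotient n.+1 k 0.
Proof.
move=> d0 dn dlam dk.
(* This keeps the Gamma arguments positive: [1 + 2 * a + k * j] exceeds 0 for every [a >= - d]. *)
have kj (j : 'I_n.+1) : 2 * d - 1 < k * j%:R.
  have N : 4 * n%:R + 3 <= (n.+1 + n.+1 * n.+1)%:R * 2 :> R.
    by rewrite -!natrM -natrD ler_nat; lia.
  have dN : d * (4 * n%:R + 3) * 2 <= 1.
    have := ler_wpM2l d0 N; move: dn; move: (_ + _ * _)%:R => p; lra.
  have jn : d * j%:R <= d * n%:R by rewrite ler_wpM2l// ler_nat -ltnS.
  have kj : - d * j%:R <= k * j%:R by rewrite ler_wpM2r.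
  have dn0 : 0 <= d * n%:R by rewrite mulr_ge0.
  by move: (n%:R : R) (j%:R : R) dN jn kj dn0 => p q; lra.
have rec a : - d <= a -> ln (circle_mean n.+1 (a + 1) k) - ln (circle_mean n.+1 a k) =
    ln_Gamma_quotient n.+1 k (a + 1) - ln_Gamma_quotient n.+1 k a.
  move=> da.
  have M1 : 0 < circle_mean n.+1 a k := circle_mean_gt0 d0 dn da dk.
  have M2 : 0 < circle_mean n.+1 (a + 1) k.
    by apply: (circle_mean_gt0 d0 dn) => //; lra.
  have P1 (j : 'I_n.+1) : 0 < 1 + a + k * j%:R by have := kj j; lra.
  have P2 (j : 'I_n.+1) : 0 < 1 + 2 * a + k * j%:R by have := kj j; lra.
  have P3 (j : 'I_n.+1) : 0 < 2 + 2 * a + k * j%:R by have := kj j; lra.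
  have := congr1 (@ln R) (circle_mean_add1 d0 dn da dk).
  rewrite !lnM ?posrE//; first last.
  - by apply: prodr_gt0 => j _; rewrite exprn_gt0.
  - by apply: prodr_gt0 => j _; rewrite mulr_gt0.
  rewrite !ln_prod => [|j|j]; [|by rewrite mulr_gt0|by rewrite exprn_gt0].
  have alg (p q r s : R) : p + q = r + s -> p - r = s - q by lra.
  move=> /alg ->; rewrite /ln_Gamma_quotient -!sumrB; apply: eq_bigr => j _.
  rewrite lnM ?posrE// lnXn// mulr2n.
  have alg1 (L : R -> R) : (forall z : R, 0 < z -> L (z + 1) = ln z + L z) ->
      ln (1 + 2 * a + k * j%:R) + ln (2 + 2 * a + k * j%:R) -
        (ln (1 + a + k * j%:R) + ln (1 + a + k * j%:R)) =
      L (1 + 2 * (a + 1) + k * j%:R) - 2 * L (1 + (a + 1) + k * j%:R) -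
      (L (1 + 2 * a + k * j%:R) - 2 * L (1 + a + k * j%:R)).
    move: (P1 j) (P2 j) (P3 j); move: (k * j%:R) => z p1 p2 p3 Lrec.
    have -> : 1 + 2 * (a + 1) + z = 1 + 2 * a + z + 1 + 1 by ring.
    have -> : 1 + (a + 1) + z = 1 + a + z + 1 by ring.
    have E2 : 2 + 2 * a + z = 1 + 2 * a + z + 1 by ring.
    rewrite E2 in p3 *; rewrite !Lrec//.
    by move: (ln _) (ln _) (ln _) (L _) (L _) => *; ring.
  exact: alg1 (fun z => lnG z) (@ln_Gamma_add1 R).
have incr a x : - d <= a -> 0 < x ->
    ln (circle_mean n.+1 (a + x) k) - ln (circle_mean n.+1 a k) =
    ln_Gamma_quotient n.+1 k (a + x) - ln_Gamma_quotient n.+1 k a.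
  apply: (@chord_increment_unique R (fun a => ln (circle_mean n.+1 a k))
    (ln_Gamma_quotient n.+1 k) (- d) (n.+1%:R * (2 * ln 2)) _ rec).
  - by move=> p q r dp pq qr; exact: (ln_circle_mean_chord d0 dn).
  - by move=> b y; exact: ln_Gamma_quotient_cvg.
have alg (H K : R -> R) : (forall a x : R, - d <= a -> 0 < x ->
    H (a + x) - H a = K (a + x) - K a) -> H lam - H 0 = K lam - K 0.
  move=> HK; case: (ltgtP lam 0) => [l0|l0|->]; last by rewrite !subrr.
  - have l1 : 0 < - lam by rewrite oppr_gt0.
    by apply: oppr_inj; rewrite !opprB -(subrr lam) HK.
  - have d1 : - d <= 0 by rewrite oppr_le0.
    by rewrite -[lam]add0r HK.
exact: alg (fun a => ln (circle_mean n.+1 a k)) (ln_Gamma_quotient n.+1 k) incr.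
Qed.

Lemma circle_weight_periodic n a k :
  coordinate_periodic (fun t : n.-tuple T => (circle_weight a k 0 t)%:E).
Proof.
move=> s t st; congr (_%:E); rewrite /circle_weight.
congr (_ * _); apply: eq_bigr => i _.
  by case: (st i) => ->; rewrite ?chord2_add1.
apply: eq_bigr => j _; congr ((_ + _) `^ _).
have sub1 x : U (x - 1) = U x by rewrite -[in RHS](subrK 1 x) chord2_add1.
case: (st i) => ->; case: (st j) => -> //.
- by rewrite opprD addrA sub1.
- by rewrite addrAC chord2_add1.
- by congr U; ring.
Qed.

(** At [lambda = 0] the first coordinate [x] occurs only in pair factors. Translating the others by
    [- x] turns [U (x - t_j)] into one-coordinate factors with exponent [k]. *)
Lemma circle_mean_rotation n k : circle_mean n.+1 0 k = circle_mean n k k.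
Proof.
rewrite /circle_mean /cube_mean; congr fine.
rewrite cube_integral_consl; last 2 first.
- by apply/measurable_EFinP; exact: measurable_circle_weight.
- by move=> t; rewrite lee_fin circle_weight_ge0.
rewrite -[RHS](@integral01_cst R).
apply: (@eq_integral _ _ _ (@lebesgue_measure R)) => x _.
rewrite -(@cube_integral_shift _ _ (- x) (fun t => (circle_weight k k 0 t)%:E)); last 3 first.
- by apply/measurable_EFinP; exact: measurable_circle_weight.
- by move=> t; rewrite lee_fin circle_weight_ge0.
- exact: circle_weight_periodic.
apply: eq_cube_integral => t; rewrite circle_weight_cons powRr0 mul1r /=; congr (_%:E).
rewrite /circle_weight; under [in RHS]eq_bigr do rewrite tnth_tuple_shift -chord2N opprB.
rewrite [X in _ * (X * _)]big1 ?mul1r => [|j _]; last exact: powRr0.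
congr (_ * _); apply: eq_bigr => i _; apply: eq_bigr => j _.
by rewrite !tnth_tuple_shift; congr ((U _ + _) `^ _); ring.
Qed.

Lemma circle_mean0 lam k : circle_mean 0 lam k = 1.
Proof.
rewrite /circle_mean /cube_mean cube_integral0; last first.
  by apply/measurable_EFinP; exact: measurable_circle_weight.
by rewrite /circle_weight !big_ord0 mulr1.
Qed.

(** Read off the total mass 1 of the exponential density of rate 1. *)
Lemma Gamma1 : Gamma (1 : R) = 1.
Proof.
apply: EFin_inj; rewrite -GammaE// subrr.
rewrite -(@integral_exponential_pdf R 1 ltr01) [RHS](_ : _ =
  \int[lebesgue_measure]_(x in `[0%R, +oo[) (expR (- x))%:E)%E; last first.
  rewrite [RHS]integral_mkcond; apply: eq_integral => x _.
  rewrite /exponential_pdf !patchE.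
  by case: ifP => // _; rewrite mul1r mulN1r.
rewrite -[RHS]integral_itv_obnd_cbnd; last first.
  apply: measurable_funTS; apply/measurable_EFinP.
  by apply: measurableT_comp => //; exact: measurable_oppr.
apply: eq_integral => x /set_mem; rewrite /= in_itv /= andbT => x0.
by rewrite powRr0 mul1r.
Qed.

Lemma le_cube_condition d m n : 0 <= d -> (m <= n)%N ->
  4 * d * (n + n * n)%:R <= 1 -> 4 * d * (m + m * m)%:R <= 1.
Proof.
move=> d0 mn; apply: le_trans; rewrite ler_wpM2l ?mulr_ge0//.
by rewrite ler_nat leq_add// leq_mul.
Qed.

Lemma ln_circle_mean_shift n lam k d : 0 <= d -> 4 * d * (n + n * n)%:R <= 1 ->
  - d <= lam -> - d <= k ->
  ln (circle_mean n lam k) =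
  ln (circle_mean n 0 k) + ln_Gamma_quotient n k lam - ln_Gamma_quotient n k 0.
Proof.
case: n => [|n] d0 dn dlam dk.
  have Q a : ln_Gamma_quotient 0 k a = 0 by exact: big_ord0.
  rewrite (circle_mean0 lam) (circle_mean0 0).
  by move: (ln_Gamma_quotient 0 k) Q => q Q; rewrite !Q addr0 subr0.
have alg (p q r s : R) : p - q = r - s -> p = q + r - s by lra.
exact: alg (ln_circle_mean_increment d0 dn dlam dk).
Qed.

(* Dyson's constant term identity. *)
Lemma ln_circle_mean_dyson n k d : 0 <= d -> 4 * d * (n + n * n)%:R <= 1 ->
  - d <= k -> ln (circle_mean n 0 k) = lnG (1 + k * n%:R) - n%:R * lnG (1 + k).
Proof.
move=> d0 dn dk; elim: n dn => [|n IHn] dn.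
  by rewrite circle_mean0 mulr0 addr0 Gamma1 ln1 mul0r subrr.
have {}dn := le_cube_condition d0 (leqnSn n) dn.
rewrite circle_mean_rotation (ln_circle_mean_shift d0 dn dk dk) (IHn dn).
have gen (L : R -> R) : L 1 = 0 ->
    L (1 + k * n%:R) - n%:R * L (1 + k) +
    (\sum_(j < n) (L (1 + 2 * k + k * j%:R) - 2 * L (1 + k + k * j%:R))) -
    (\sum_(j < n) (L (1 + 2 * 0 + k * j%:R) - 2 * L (1 + 0 + k * j%:R))) =
    L (1 + k * n.+1%:R) - n.+1%:R * L (1 + k).
  move=> L1; rewrite -addrA -sumrB.
  (* At [lambda = k] all arguments lie on the progression [1 + k * j], so the summand is a second
     difference; the sum telescopes to [D n - D 0]. *)
  pose D j := L (1 + k * j.+1%:R) - L (1 + k * j%:R).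
  rewrite (eq_bigr (fun j : 'I_n => D j.+1 - D j)); last first.
    move=> j _; rewrite /D.
    have -> : 1 + 2 * k + k * j%:R = 1 + k * j.+2%:R by rewrite -!natr1; ring.
    have -> : 1 + k + k * j%:R = 1 + k * j.+1%:R by rewrite -!natr1; ring.
    by rewrite mulr0 !addr0; move: (L _) (L _) (L _) => *; ring.
  rewrite -(big_mkord xpredT (fun j => D j.+1 - D j)) telescope_sumr// /D.
  rewrite mulr0 mulr1 addr0 L1 -[n.+1%:R]natr1.
  by move: (L _) (L _) (L _) => *; ring.
by apply: (gen (fun z => lnG z)); rewrite Gamma1 ln1.
Qed.

(** The quotient at [lambda = 0] is minus the sum of [ln (Gamma (1 + k * j))] over [j < n], and
    Dyson's identity supplies [j = n]. Hence the bound [n.+1], and the Bernoulli polynomial at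
    [l + 1] in the expansion. *)
Theorem ln_circle_mean n lam k d : 0 <= d -> 4 * d * (n + n * n)%:R <= 1 ->
  - d <= lam -> - d <= k ->
  ln (circle_mean n lam k) =
  ln_Gamma_quotient n k lam + \sum_(j < n.+1) lnG (1 + k * j%:R) - n%:R * lnG (1 + k).
Proof.
move=> d0 dn dlam dk; rewrite (ln_circle_mean_shift d0 dn dlam dk) (ln_circle_mean_dyson d0 dn dk).
rewrite big_ord_recr /=.
have -> : ln_Gamma_quotient n k 0 = - \sum_(j < n) lnG (1 + k * j%:R).
  have gen (L : R -> R) : \sum_(j < n) (L (1 + 2 * 0 + k * j%:R) - 2 * L (1 + 0 + k * j%:R)) =
      - \sum_(j < n) L (1 + k * j%:R).
    rewrite -sumrN; apply: eq_bigr => j _.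
    by rewrite mulr0 addr0; move: (L _) => *; ring.
  exact: gen (fun z => lnG z).
have alg (p q r s : R) : p - q + r - - s = r + (s + p) - q by ring.
exact: alg.
Qed.

End morris.

(** * Expansion of the log-moments *)

Section log_moments.
Context {R : realType}.
Notation T := (measurableTypeR R).
Notation U := (@chord2 R).
Notation lnG x := (ln (Gamma x)).
Implicit Types (lam k d a b c x mu : R) (n : nat).

Lemma normc_chord x : Normc.normc (1 - expi2pi x) = Num.sqrt (U x).
Proof.
rewrite /expi2pi /=; congr Num.sqrt; rewrite /chord2.
have := sin2cos2 (2 * pi * x); move: (cos _) (sin _) => cx sx H.
by ring: H.
Qed.

Lemma normc_expi2piB x y : Normc.normc (expi2pi x - expi2pi y) = Num.sqrt (U (x - y)).
Proof.
rewrite /expi2pi /=; congr Num.sqrt; rewrite /chord2 mulrBr cosB.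
have := sin2cos2 (2 * pi * x); have := sin2cos2 (2 * pi * y).
move: (cos _) (sin _) (cos _) (sin _) => cx sx cy sy Hy Hx.
by ring: Hx Hy.
Qed.

Lemma powR_sqrt x a : 0 <= x -> Num.sqrt x `^ a = x `^ (a / 2).
Proof. by move=> x0; rewrite -powR12_sqrt// -powRrM mulrC. Qed.

Lemma circle_moment_cube_integral lam n mu :
  circle_moment (fun s : R => Normc.normc (1 - expi2pi s) `^ (2 * lam)) n mu =
  cube_integral (fun t : n.-tuple T => (circle_weight lam (- (mu / 2)) 0 t)%:E).
Proof.
apply: eq_cube_integral => t; congr (_%:E); congr (_ * _).
  apply: eq_bigr => j _; rewrite normc_chord powR_sqrt ?chord2_ge0// addr0.
  by congr (_ `^ _); field.
have E (i j : 'I_n) : Normc.normc (expi2pi (tnth t i) - expi2pi (tnth t j)) `^ (- mu) =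
    (U (tnth t i - tnth t j) + 0) `^ (- (mu / 2)).
  rewrite normc_expi2piB powR_sqrt ?chord2_ge0// addr0.
  by congr (_ `^ _); field.
by apply: eq_bigr => i _; apply: eq_bigr => j _; rewrite E.
Qed.

Definition power_sum n p : R := \sum_(j < n) j%:R ^+ p.

(** Each increment is [- (mu / 2) * j], and [|mu| * n <= 1] keeps it within the radius [1 / 2] of
    [ln_Gamma_taylor]; exchanging the sums produces the power sums. *)
Lemma ln_Gamma_taylor_sum n a mu : 1 <= a -> `|mu| * n%:R <= 1 ->
  (\sum_(1 <= p < m) hurwitz_zeta p a * power_sum n.+1 p * ((mu / 2) ^+ p / p%:R)) @[m --> \oo]
  --> \sum_(j < n.+1) (lnG (a - mu / 2 * j%:R) - lnG a).
Proof.
move=> a1 mun.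
rewrite (_ : (fun m => _) = fun m => \sum_(j < n.+1) \sum_(1 <= p < m)
    hurwitz_zeta p a * ((- (- (mu / 2 * j%:R))) ^+ p / p%:R)); last first.
  apply/funext => m; rewrite exchange_big /=; apply: eq_bigr => p _.
  rewrite /power_sum mulr_sumr mulr_suml.
  by apply: eq_bigr => j _; rewrite opprK !exprMn; ring.
apply: cvg_rsum => j _; apply: ln_Gamma_taylor => //.
rewrite normrN normrM normrM [`|2^-1|]ger0_norm// [`|j%:R|]ger0_norm//.
have jn : j%:R <= n%:R :> R by rewrite ler_nat -ltnS.
have := ler_wpM2l (normr_ge0 mu) jn; lra.
Qed.

Lemma log_moment_coefE lam n p : (0 < p)%N ->
  log_moment_coef lam n.+1 p = (p%:R * 2 ^+ p)^-1 *
  (hurwitz_zeta p (1 + 2 * lam) * power_sum n.+1 p -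
   2 * (hurwitz_zeta p (1 + lam) * power_sum n.+1 p) +
   hurwitz_zeta p 1 * power_sum n.+2 p - n.+1%:R * hurwitz_zeta p 1).
Proof.
by move=> p0; rewrite /log_moment_coef !bernoulli_poly_sum -!/(power_sum _ _); congr (_ * _); ring.
Qed.

(** With [d = |mu| / 2] the first bound is the cube condition [4 * d * (n + n * n) <= 1]; the second
    keeps the Taylor expansions within radius [1 / 2]. *)
Lemma near0_small (n : nat) : \forall mu \near (0 : R),
  2 * `|mu| * (n + n * n)%:R <= 1 /\ `|mu| * n%:R <= 1.
Proof.
have e0 : 0 < (2 * (n + n * n).+1%:R)^-1 :> R by rewrite invr_gt0 mulr_gt0.
have : \forall mu \near (0 : R), `|mu| <= (2 * (n + n * n).+1%:R)^-1.
  by exists (2 * (n + n * n).+1%:R)^-1 => // y; rewrite /= sub0r normrN => /ltW.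
apply: filterS => mu H.
have {}H : `|mu| * (2 * (n + n * n).+1%:R) <= 1 by rewrite -ler_pdivlMr ?mulr_gt0// div1r.
have H1 : (n + n * n)%:R <= (n + n * n).+1%:R :> R by rewrite ler_nat.
have H2 : n%:R <= (n + n * n).+1%:R :> R by rewrite ler_nat; lia.
have := ler_wpM2l (normr_ge0 mu) H1; have := ler_wpM2l (normr_ge0 mu) H2.
have H0 : 0 <= `|mu| * (n + n * n).+1%:R by rewrite mulr_ge0.
move: H H0; move: ((n + n * n).+1%:R) ((n + n * n)%:R) (n%:R) (`|mu|) => x y z w.
by split; lra.
Qed.

Lemma log_circle_moment lam n mu : 0 <= lam ->
  2 * `|mu| * (n.+1 + n.+1 * n.+1)%:R <= 1 -> `|mu| * n.+1%:R <= 1 ->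
  exists2 s : R,
    (\sum_(1 <= p < m) log_moment_coef lam n.+1 p * mu ^+ p) @[m --> \oo] --> s &
    lne (circle_moment (fun s : R => Normc.normc (1 - expi2pi s) `^ (2 * lam)) n.+1 mu) =
    (n.+1%:R * (lnG (1 + 2 * lam) - 2 * lnG (1 + lam)) + s)%:E.
Proof.
move=> lam0 mu1 mu2.
pose d := `|mu| / 2.
have d0 : 0 <= d by rewrite divr_ge0.
have dn : 4 * d * (n.+1 + n.+1 * n.+1)%:R <= 1.
  by rewrite (_ : 4 * d = 2 * `|mu|)// /d; field.
have dlam : - d <= lam by rewrite (le_trans _ lam0)// oppr_le0.
have dk : - d <= - (mu / 2) by rewrite lerN2 ler_wpM2r// ler_norm.
have mu3 : `|mu| * n%:R <= 1.
  by apply: le_trans mu2; rewrite ler_wpM2l// ler_nat.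
have mu4 : `|mu| * 1%:R <= 1.
  by apply: le_trans mu2; rewrite ler_wpM2l// ler_nat.
have a1 : 1 <= 1 + 2 * lam by rewrite lerDl mulr_ge0.
have a2 : 1 <= 1 + lam by rewrite lerDl.
(* Four expansions: two for the Gamma quotient, one for the sum of [ln (Gamma (1 + k * j))], which
   runs one term further, and one for the single [ln (Gamma (1 - mu / 2))], which yields the term
   [- l * zeta(p)]. *)
pose S1 := \sum_(j < n.+1) (lnG (1 + 2 * lam - mu / 2 * j%:R) - lnG (1 + 2 * lam)).
pose S2 := \sum_(j < n.+1) (lnG (1 + lam - mu / 2 * j%:R) - lnG (1 + lam)).
pose S3 := \sum_(j < n.+2) (lnG (1 - mu / 2 * j%:R) - lnG 1).
pose S4 := lnG (1 - mu / 2) - lnG 1.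
exists (S1 - 2 * S2 + S3 - n.+1%:R * S4).
  have L1 := ln_Gamma_taylor_sum a1 mu3.
  have L2 := ln_Gamma_taylor_sum a2 mu3.
  have L3 := ln_Gamma_taylor_sum (lexx 1) mu2.
  have L4 : (\sum_(1 <= p < m) hurwitz_zeta p 1 * ((- (- (mu / 2))) ^+ p / p%:R)) @[m --> \oo]
      --> S4.
    apply: ln_Gamma_taylor => //.
    by rewrite normrN normrM [`|2^-1|]ger0_norm//; move: mu4; lra.
  have comb (u1 u2 u3 u4 : nat -> R) (l1 l2 l3 l4 : R) :
      u1 @ \oo --> l1 -> u2 @ \oo --> l2 -> u3 @ \oo --> l3 -> u4 @ \oo --> l4 ->
      (u1 m - 2 * u2 m + u3 m - n.+1%:R * u4 m) @[m --> \oo] -->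
      l1 - 2 * l2 + l3 - n.+1%:R * l4.
    move=> h1 h2 h3 h4; apply: cvgB; last exact: cvgMr.
    by apply: cvgD => //; apply: cvgB => //; exact: cvgMr.
  have := comb _ _ _ _ _ _ _ _ L1 L2 L3 L4.
  apply: cvg_trans; apply: near_eq_cvg; apply: nearW => m.
  rewrite /= !mulr_sumr -sumrB -big_split -sumrB /=; apply: eq_big_nat => p /andP[p0 _].
  have pn0 : p%:R != 0 :> R by rewrite pnatr_eq0 -lt0n.
  have tn0 : 2 ^+ p != 0 :> R by rewrite expf_neq0.
  rewrite log_moment_coefE// opprK expr_div_n.
  move: (hurwitz_zeta _ _) (hurwitz_zeta _ _) (hurwitz_zeta _ _) (power_sum _ _)
    (power_sum _ _) (mu ^+ p) (2 ^+ p) (p%:R : R) tn0 pn0 => z1 z2 z3 s1 s2 m1 t q tn0 pn0.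
  by field; rewrite tn0 pn0.
rewrite circle_moment_cube_integral (circle_mean_integral d0 dn dlam dk).
rewrite lne_EFin ?(circle_mean_gt0 d0 dn dlam dk)//; congr (_%:E).
rewrite (ln_circle_mean d0 dn dlam dk) /S1 /S2 /S3 /S4 /ln_Gamma_quotient.
have gen (L : R -> R) : L 1 = 0 ->
    \sum_(j < n.+1) (L (1 + 2 * lam + - (mu / 2) * j%:R) - 2 * L (1 + lam + - (mu / 2) * j%:R)) +
    \sum_(j < n.+2) L (1 + - (mu / 2) * j%:R) - n.+1%:R * L (1 - mu / 2) =
    n.+1%:R * (L (1 + 2 * lam) - 2 * L (1 + lam)) +
    (\sum_(j < n.+1) (L (1 + 2 * lam - mu / 2 * j%:R) - L (1 + 2 * lam)) -
     2 * (\sum_(j < n.+1) (L (1 + lam - mu / 2 * j%:R) - L (1 + lam))) +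
     \sum_(j < n.+2) (L (1 - mu / 2 * j%:R) - L 1) - n.+1%:R * (L (1 - mu / 2) - L 1)).
  move=> L1; rewrite sumrB -mulr_sumr.
  have sumC m (f : 'I_m -> R) c : \sum_(j < m) (f j - c) = \sum_(j < m) f j - m%:R * c.
    by rewrite sumrB sumr_const card_ord mulr_natl.
  have E a m : \sum_(j < m) L (a + - (mu / 2) * j%:R) = \sum_(j < m) L (a - mu / 2 * j%:R).
    by apply: eq_bigr => j _; rewrite mulNr.
  rewrite !sumC !E L1.
  by move: (\sum_(j < n.+1) _) (\sum_(j < n.+1) _) (\sum_(j < n.+2) _) (L _) (L _) (L _) => *; ring.
by apply: (gen (fun x => lnG x)); rewrite Gamma1 ln1.
Qed.

End log_moments.

Theorem lemma5 (R : realType) (lambda : R) (l : nat)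
    (lambda_ge0 : 0 <= lambda) (l_gt0 : (0 < l)%N) :
  let phi (s : R) := Normc.normc (1 - expi2pi s) `^ (2 * lambda) in
  \forall mu \near (0 : R), exists2 s : R,
    (\sum_(1 <= p < n) log_moment_coef lambda l p * mu ^+ p) @[n --> \oo] --> s &
    lne (circle_moment phi l mu) =
      (l%:R * (ln (Gamma (1 + 2 * lambda)) - 2 * ln (Gamma (1 + lambda)))
       + s)%:E.
Proof.
case: l l_gt0 => // n _ phi.
apply: filterS (near0_small n.+1) => mu [mu1 mu2].
exact: log_circle_moment.
Qed.
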